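(* Let $a,b,c\colon\mathbb{R}\to\mathbb{R}$ be functions with $a(x)>0$ for all $x\in\mathbb{R}$. Assume that there exists $\beta\in(0,1]$ such that $c$ is bounded and Hölder continuous with Hölder exponent $\beta$, and the functions $a$, $x\mapsto 1/a(x)$, $b$ are, together with their derivatives of order one and two, bounded and Hölder continuous with Hölder exponent $\beta$. Let $H$ be the linear operator in $C_0(\mathbb{R},\mathbb{R})$ with domain $D(H)=C^2_c(\mathbb{R},\mathbb{R})$ given by $$(Hf)(x)=a(x)f''(x)+b(x)f'(x)+c(x)f(x).$$ Assume that the closure $(\overline{H},D(\overline{H}))$ of $H$ exists and generates a $C_0$-semigroup $(e^{t\overline{H}})_{t\ge 0}$ in $C_0(\mathbb{R},\mathbb{R})$. Let $w=\max(0,\sup_{x\in\mathbb{R}}c(x))$. Then for all $\lambda\in\mathbb{C}$ satisfying $\mathrm{Re}\,\lambda>w$ the resolvent $R_\lambda=(\lambda I-\overline{H})^{-1}$ is given, for all $g\in C_0(\mathbb{R},\mathbb{R})$ and all $x_0\in\mathbb{R}$, by the formula $$ (R_\lambda g)(x_0) = \lim_{n\to\infty}\int_0^\infty e^{-\lambda t}\Bigg[\underbrace{\int_{\mathbb{R}}\dots\int_{\mathbb{R}}}_n \exp\left(\frac{t}{n}\sum_{j=1}^n\left(c(x_{j-1})-\frac{b(x_{j-1})^2}{4a(x_{j-1})}\right)\right) \exp\left(\sum_{j=1}^n\frac{b(x_{j-1})(x_j-x_{j-1})}{2a(x_{j-1})} \right)\times $$ $$ \times\left(\frac{\sqrt{n}}{\sqrt{4\pi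 t}}\right)^n\left(\prod_{j=0}^{n-1}a(x_j)\right)^{-1/2}\exp\left(-\frac{n}{4t}\sum_{j=0}^{n-1}\frac{(x_j-x_{j+1})^2}{a(x_j)}\right)g(x_n)\,dx_1\dots dx_n\Bigg] dt, $$ where the limit as $n\to\infty$ exists uniformly in $x_0\in\mathbb{R}$.
   Context: $C_0(\mathbb{R},\mathbb{R})$ is the Banach space of all continuous functions $f\colon\mathbb{R}\to\mathbb{R}$ with $\lim_{|x|\to\infty}f(x)=0$, with the uniform norm $\|f\|=\sup_{x\in\mathbb{R}}|f(x)|$. $C^2_c(\mathbb{R},\mathbb{R})$ is the space of all compactly supported functions $\mathbb{R}\to\mathbb{R}$ that are continuous together with their derivatives of order one and two; it is a dense linear subspace of $C_0(\mathbb{R},\mathbb{R})$. A $C_0$-semigroup is a strongly continuous one-parameter semigroup of bounded linear operators $(V(t))_{t\ge0}$ with $V(0)=I$; its generator is $L\varphi=\lim_{t\to+0}(V(t)\varphi-\varphi)/t$ on the domain of all $\varphi$ for which the limit exists, and one writes $V(t)=e^{tL}$. For non-real $\lambda$ the operator $\overline{H}$ and its resolvent are understood on the complexification of $C_0(\mathbb{R},\mathbb{R})$, i.e. on complex-valued continuous functions vanishing at infinity. *)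

(* Defs.v *)
From HB Require Import structures.
From mathcomp Require Import all_boot all_order all_algebra.
From mathcomp Require Import all_classical all_reals all_analysis.
From mathcomp Require Import complex.

Set Implicit Arguments.
Unset Strict Implicit.
Unset Printing Implicit Defensive.

Import Order.TTheory GRing.Theory Num.Theory.
Import numFieldNormedType.Exports.

Local Open Scope classical_set_scope.
Local Open Scope ring_scope.
Local Open Scope complex_scope.

(* The norm topology of R[i] is attached to R[i]^o, not to R[i] itself. *)
Definition C0_pred (R : realType) (K : numFieldType) : {pred R -> K^o} :=
  fun f => `[< [/\ continuous f, f x @[x --> +oo] --> (0 : K^o)
                 & f x @[x --> -oo] --> (0 : K^o)] >].

Lemma C0_predP (R : realType) (K : numFieldType) (f : R -> K^o) :
  reflect [/\ continuous f, f x @[x --> +oo] --> (0 : K^o)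
            & f x @[x --> -oo] --> (0 : K^o)] (f \in @C0_pred R K).
Proof. exact: asboolP. Qed.

Lemma C0_pred_submod (R : realType) (K : numFieldType) :
  submod_closed (@C0_pred R K).
Proof.
split.
  by apply/C0_predP; split; [move=> x| |]; exact: cvg_cst.
move=> k f g /C0_predP[cf pf nf] /C0_predP[cg pg ng]; apply/C0_predP; split.
- by move=> x; apply: cvgD; [apply: cvgZr; exact: cf|exact: cg].
- rewrite -[X in _ --> X](_ : k *: (0 : K^o) + 0 = 0); last first.
    by rewrite scaler0 addr0.
  by apply: cvgD => //; apply: cvgZr.
- rewrite -[X in _ --> X](_ : k *: (0 : K^o) + 0 = 0); last first.
    by rewrite scaler0 addr0.
  by apply: cvgD => //; apply: cvgZr.
Qed.

HB.instance Definition _ (R : realType) (K : numFieldType) :=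
  GRing.isSubmodClosed.Build K (R -> K^o) (@C0_pred R K)
    (@C0_pred_submod R K).

Record C0 (R : realType) :=
  MkC0 { C0_fun :> R -> R^o ; C0_funP : C0_fun \in @C0_pred R R }.

HB.instance Definition _ (R : realType) := [isSub for @C0_fun R].
HB.instance Definition _ (R : realType) := [Choice of C0 R by <:].
HB.instance Definition _ (R : realType) :=
  [SubChoice_isSubLmodule of C0 R by <:].

Record C0C (R : realType) :=
  MkC0C { C0C_fun :> R -> R[i]^o ; C0C_funP : C0C_fun \in @C0_pred R R[i] }.

HB.instance Definition _ (R : realType) := [isSub for @C0C_fun R].
HB.instance Definition _ (R : realType) := [Choice of C0C R by <:].
HB.instance Definition _ (R : realType) :=
  [SubChoice_isSubLmodule of C0C R by <:].

Section C0_norm.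
Variable R : realType.
Import Normc.

Let normr_normc (z : R[i]) : `|z| = (normc z)%:C.
Proof. by case: z. Qed.

Let normc_ge0 (z : R[i]) : 0 <= normc z.
Proof. by case: z => a b; exact: sqrtr_ge0. Qed.

Let gt0_complexE (e : R[i]) : 0 < e -> exists2 r : R, 0 < r & e = r%:C.
Proof.
case: e => r s; rewrite ltcE /= => /andP[/eqP -> r0]; by exists r.
Qed.

Let cvg_normc (T : Type) (F : set_system T) (FF : Filter F) (f : T -> R[i]^o)
    (l : R[i]^o) :
  f @ F --> l -> (fun x => normc (f x) : R^o) @ F --> (normc l : R^o).
Proof.
move=> /cvgrPdist_lt fl; apply/cvgrPdist_lt => e e0.
have ec : (0 : R[i]) < e%:C by rewrite ltcR.
apply: filterS (fl _ ec) => x; rewrite normr_normc ltcR; apply: le_lt_trans.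
have H (u v : R[i]) : normc u - normc v <= normc (u - v).
  by rewrite lerBlDr -[u in normc u](subrK v) le_normcD.
rewrite ler_norml H andbT lerNl opprB.
by apply: le_trans (H _ _) _; rewrite -(@normcN R (l - f x)) opprB.
Qed.

Let cvg_complex (T : Type) (F : set_system T) (FF : Filter F)
    (u v : T -> R^o) (a b : R^o) :
  u @ F --> a -> v @ F --> b ->
  (fun x => u x +i* v x : R[i]^o) @ F --> (a +i* b : R[i]^o).
Proof.
move=> /cvgrPdist_lt ua /cvgrPdist_lt vb; apply/cvgrPdist_lt => e.
move=> /gt0_complexE[r r0 ->].
have r2 : 0 < r / 2 by rewrite divr_gt0.
near=> x.
rewrite normr_normc ltcR.
have -> : (a +i* b - (u x +i* v x) : R[i]) = (a - u x)%:C + 0 +i* (b - v x).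
  by simpc.
apply: le_lt_trans (le_normcD _ _) _.
rewrite /= expr0n /= addr0 add0r !sqrtr_sqr [ltRHS]splitr ltrD //.
- by near: x; exact: ua.
- by near: x; exact: vb.
Unshelve. all: by end_near. Qed.

Lemma C0_bounded (f : R -> R^o) : f \in @C0_pred R R ->
  has_ubound (range (fun x => `|f x|)).
Proof.
move=> /C0_predP[cf /cvgrPdist_lt pf /cvgrPdist_lt nf].
have [A [Ar Af]] := pf _ (@ltr01 R); have [B [Br Bf]] := nf _ (@ltr01 R).
have : compact (f @` `[B, A]).
  apply: continuous_compact; last exact: segment_compact.
  exact: continuous_subspaceT.
move=> /compact_bounded[M [Mr Mf]].
exists (Num.max 1 (M + 1)) => _ [x _ <-]; rewrite le_max.
have [xA|xA] := ltP A x.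
  by have := Af _ xA; rewrite sub0r normrN => /ltW ->.
have [xB|xB] := ltP x B.
  by have := Bf _ xB; rewrite sub0r normrN => /ltW ->.
rewrite (Mf (M + 1)) ?orbT ?ltrDl //.
by exists x => //=; rewrite in_itv /= xB xA.
Qed.

Lemma normc_C0 (f : R -> R[i]^o) : f \in @C0_pred R R[i] ->
  (fun x => normc (f x) : R^o) \in @C0_pred R R.
Proof.
move=> /C0_predP[cf pf nf]; apply/C0_predP; split.
- by move=> x; apply: cvg_normc; exact: cf.
- by rewrite -(@normc0 R); exact: cvg_normc.
- by rewrite -(@normc0 R); exact: cvg_normc.
Qed.

Lemma C0C_bounded (f : R -> R[i]^o) : f \in @C0_pred R R[i] ->
  has_ubound (range (fun x => normc (f x))).
Proof.
move=> /normc_C0/C0_bounded.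
by under eq_fun do rewrite ger0_norm ?normc_ge0 //.
Qed.

Let range_neq0 (h : R -> R) : range h !=set0.
Proof. by exists (h 0), 0. Qed.

Let supZ (k : R) (h : R -> R) : 0 <= k -> has_ubound (range h) ->
  sup (range (fun x => k * h x)) = k * sup (range h).
Proof.
rewrite le_eqVlt => /predU1P[<-|k0] hh.
  rewrite mul0r -[RHS](sup1 (0 : R)); congr sup.
  apply/seteqP; split=> [_ [x _ <-]|_ ->] /=; first by rewrite mul0r.
  by exists 0 => //; rewrite mul0r.
apply/eqP; rewrite eq_le; apply/andP; split.
  apply: ge_sup => // _ [x _ <-]; rewrite ler_pM2l //.
  by apply: ub_le_sup => //; exists x.
rewrite -ler_pdivlMl //; apply: ge_sup => // _ [x _ <-].
rewrite ler_pdivlMl //; apply: ub_le_sup; last by exists x.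
case: hh => M hM; exists (k * M) => _ [y _ <-].
by rewrite ler_pM2l //; apply: hM; exists y.
Qed.

Definition C0_norm (f : C0 R) : R := sup (range (fun x => `|f x|)).

Lemma C0_normD f g : C0_norm (f + g) <= C0_norm f + C0_norm g.
Proof.
apply: ge_sup => // _ [x _ <-]; apply: le_trans (ler_normD (f x) (g x)) _.
by apply: lerD; (apply: ub_le_sup;
  [apply: C0_bounded; exact: C0_funP|by exists x]).
Qed.

Lemma C0_normZ (k : R) f : C0_norm (k *: f) = `|k| * C0_norm f.
Proof.
rewrite /C0_norm -supZ //; last by apply: C0_bounded; exact: C0_funP.
by congr (sup (_ @` _)); apply/funext => x; rewrite -normrM.
Qed.

Lemma C0_norm0_eq0 f : C0_norm f = 0 -> f = 0.
Proof.
move=> f0; apply/val_inj/funext => x /=.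
apply/eqP; rewrite -normr_le0 -f0; apply: ub_le_sup; last by exists x.
by apply: C0_bounded; exact: C0_funP.
Qed.

HB.instance Definition _ :=
  Lmodule_isNormed.Build R (C0 R) C0_normD C0_normZ C0_norm0_eq0.

(* The norm of a normed module over R[i] takes its values in R[i]. *)
Definition C0C_norm (f : C0C R) : R[i] :=
  (sup (range (fun x => normc (f x))))%:C.

Lemma C0C_normD f g : C0C_norm (f + g) <= C0C_norm f + C0C_norm g.
Proof.
rewrite /C0C_norm -rmorphD lecR.
apply: ge_sup => // _ [x _ <-]; apply: le_trans (le_normcD (f x) (g x)) _.
by apply: lerD; (apply: ub_le_sup;
  [apply: C0C_bounded; exact: C0C_funP|by exists x]).
Qed.

Lemma C0C_normZ (k : R[i]) f : C0C_norm (k *: f) = `|k| * C0C_norm f.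
Proof.
rewrite /C0C_norm normr_normc -rmorphM -supZ ?normc_ge0 //.
  by congr (sup (_ @` _))%:C; apply/funext => x; rewrite -normcM.
by apply: C0C_bounded; exact: C0C_funP.
Qed.

Lemma C0C_norm0_eq0 f : C0C_norm f = 0 -> f = 0.
Proof.
move=> [f0]; apply/val_inj/funext => x /=; apply: eq0_normc.
apply/eqP; rewrite eq_le normc_ge0 andbT -f0.
apply: ub_le_sup; last by exists x.
by apply: C0C_bounded; exact: C0C_funP.
Qed.

HB.instance Definition _ :=
  Lmodule_isNormed.Build R[i] (C0C R) C0C_normD C0C_normZ C0C_norm0_eq0.

Lemma C0_complex_subproof (u v : C0 R) :
  (fun x => u x +i* v x : R[i]^o) \in @C0_pred R R[i].
Proof.
have /C0_predP[cu pu nu] := C0_funP u; have /C0_predP[cv pv nv] := C0_funP v.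
apply/C0_predP; split; last 2 first.
- by rewrite (_ : 0 = 0 +i* 0 :> R[i]) //; exact: cvg_complex.
- by rewrite (_ : 0 = 0 +i* 0 :> R[i]) //; exact: cvg_complex.
- by move=> x; apply: cvg_complex; [exact: cu|exact: cv].
Qed.

Definition C0_complex (u v : C0 R) : C0C R := MkC0C (C0_complex_subproof u v).

End C0_norm.

(* An unbounded operator in X is given by its graph, a subset of X * X; its
   closure is the topological closure of the graph. *)
Definition closable {R : realType} {X : normedModType R} (A : set (X * X)) :=
  forall f h1 h2 : X, closure A (f, h1) -> closure A (f, h2) -> h1 = h2.

(* Only the values T t for t >= 0 are relevant. *)
Definition C0_semigroup {R : realType} {X : normedModType R}
    (T : R -> {linear X -> X}) :=
  [/\ forall t, 0 <= t -> continuous (T t),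
      forall f, T 0 f = f,
      forall s t, 0 <= s -> 0 <= t -> forall f, T (s + t) f = T s (T t f)
    & forall f, {within `[0, +oo[, continuous (fun t => T t f)}].

Definition generator {R : realType} {X : normedModType R}
    (T : R -> {linear X -> X}) : set (X * X) :=
  [set p | t^-1 *: (T t p.1 - p.1) @[t --> 0^'+] --> p.2].

Definition generates_C0_semigroup {R : realType} {X : normedModType R}
    (A : set (X * X)) :=
  exists T : R -> {linear X -> X}, C0_semigroup T /\ generator T = A.

Definition is_resolvent {K : numFieldType} {X : normedModType K}
    (A : set (X * X)) (lam : K) (Q : {linear X -> X}) :=
  [/\ continuous Q,
      forall f h, A (f, h) -> Q (lam *: f - h) = f
    & forall g, exists2 h, A (Q g, h) & lam *: Q g - h = g].

Definition complexification {R : realType} (A : set (C0 R * C0 R)) :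
    set (C0C R * C0C R) :=
  [set (C0_complex p.1 q.1, C0_complex p.2 q.2) | p in A & q in A].

Definition hoelder {R : realType} (beta : R) (f : R -> R) :=
  exists C : R, forall x y, `|f x - f y| <= C * `|x - y| `^ beta.

Definition bounded_hoelder {R : realType} (beta : R) (f : R -> R) :=
  bounded_fun f /\ hoelder beta f.

Definition bounded_hoelder2 {R : realType} (beta : R) (f : R -> R) :=
  [/\ forall x, derivable f x 1, forall x, derivable (derive1 f) x 1,
      bounded_hoelder beta f, bounded_hoelder beta (derive1 f)
    & bounded_hoelder beta (derive1 (derive1 f))].

(* f and its first derivative are continuous, being differentiable. *)
Definition C2c {R : realType} (f : R -> R) :=
  [/\ forall x, derivable f x 1, forall x, derivable (derive1 f) x 1,
      continuous (derive1 (derive1 f))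
    & compact (closure [set x | f x != 0])].

Definition diff_op {R : realType} (a b c : R -> R) : set (C0 R * C0 R) :=
  [set p : C0 R * C0 R | C2c p.1 /\ forall x,
     p.2 x = a x * derive1 (derive1 p.1) x + b x * derive1 p.1 x + c x * p.1 x].

(* [iter_int n F] is the iterated integral of F [:: x_1; ...; x_n], with x_1 as
   the outermost variable. *)
Fixpoint iter_int {R : realType} (n : nat) (F : seq R -> R) : R :=
  if n is m.+1 then
    \int[lebesgue_measure]_(x in setT) iter_int m (fun s => F (x :: s))
  else F [::].

(* Integrals of non-integrable functions have junk values; this says that every
   integral in [iter_int n F] converges. *)
Fixpoint iter_integrable {R : realType} (n : nat) (F : seq R -> R) : Prop :=
  if n is m.+1 then
    (forall x, iter_integrable m (fun s => F (x :: s))) /\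
    lebesgue_measure.-integrable setT
      (fun x : R => (iter_int m (fun s => F (x :: s)))%:E)
  else True.

Definition cexp {R : realType} (z : R[i]) : R[i] :=
  (expR (complex.Re z) * cos (complex.Im z)) +i*
  (expR (complex.Re z) * sin (complex.Im z)).

Definition cint {R : realType} (D : set R) (f : R -> R[i]) : R[i] :=
  (\int[lebesgue_measure]_(t in D) complex.Re (f t)) +i*
  (\int[lebesgue_measure]_(t in D) complex.Im (f t)).

Definition cintegrable {R : realType} (D : set R) (f : R -> R[i]) :=
  lebesgue_measure.-integrable D (fun t : R => (complex.Re (f t))%:E) /\
  lebesgue_measure.-integrable D (fun t : R => (complex.Im (f t))%:E).

(* Here s = [:: x_1; ...; x_n]. *)
Definition feynman_integrand {R : realType} (a b c g : R -> R)
    (n : nat) (t x0 : R) (s : seq R) : R :=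
  let x j := (x0 :: s)`_j in
  expR (t / n%:R * \sum_(1 <= j < n.+1)
     (c (x j.-1) - b (x j.-1) ^+ 2 / (4 * a (x j.-1)))) *
  expR (\sum_(1 <= j < n.+1)
     b (x j.-1) * (x j - x j.-1) / (2 * a (x j.-1))) *
  (Num.sqrt n%:R / Num.sqrt (4 * pi * t)) ^+ n *
  (\prod_(0 <= j < n) a (x j)) `^ (- (1 / 2)) *
  expR (- (n%:R / (4 * t)) *
     \sum_(0 <= j < n) (x j - x j.+1) ^+ 2 / a (x j)) *
  g (x n).

Definition laplace_integrand {R : realType} (a b c g : R -> R) (lam : R[i])
    (n : nat) (x0 t : R) : R[i] :=
  cexp (- lam * t%:C) * (iter_int n (feynman_integrand a b c g n t x0))%:C.

(* Main.v *)
Require Import Defs.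
From HB Require Import structures.
From mathcomp Require Import all_boot all_order all_algebra.
From mathcomp Require Import all_classical all_reals all_analysis.
From mathcomp Require Import complex.
From mathcomp Require Import measurable_realfun ring lra.
Import Order.TTheory GRing.Theory Num.Theory.
Import numFieldNormedType.Exports.
Local Open Scope classical_set_scope.
Local Open Scope ring_scope.

(** The n-fold integral is [(S (t / n) ^ n) g x0], where [S h f x] is
    [e ^ (h * c x)] times the mean of [f] under the normal law of mean
    [x + b x * h] and variance [2 * a x * h]: expanding the square in the normal
    density produces exactly the exponentials and the normalisation of the
    integrand ([heat_kernelE], [feynman_integrandE]). Taylor expansion to second
    order gives [S h f = f + h * (a f'' + b f' + c f) + o(h)] uniformly in [x] for
    [f] in C^2_c ([chernoff_lin_generator]), and [|S h| <= e ^ (w0 * h)] for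
    [w0 = max 0 (sup c)], since a mean does not increase the norm. So [S] is a
    Chernoff approximation of the semigroup [T] generated by the closure of [H].

    Growth of [T]. Both properties of [S] give
    [(1 - eta * w') |f| <= |f - eta * H f|] for [w' > w0] on the core, hence on the
    whole generator ([generator_dissipative]). Along an orbit this says that a
    backward Euler step gains at most the factor [(1 - w' * h) ^ -1], and a
    continuous induction yields [|T t| <= e ^ (w * t)] for every [w > w0]
    ([semigroup_growth]).

    Chernoff's theorem. Let [U] and [V] be [T] and [S] multiplied by [e ^ (- l t)];
    both decay exponentially. With [G = h * (1 + V h + ... + V h ^ (N - 1))], where
    [V h ^ N] is negligible, [G] tends to the resolvent of [U] at 0 as [h] tends to 0
    ([discrete_resolvent_cvg]) and [V h G - G U h] is [o(h)] along orbits. Summing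
    the telescoping errors against the geometric decay of [V h ^ n] bounds
    [V h ^ n G - G U h ^ n] for all [n] at once, so that [V h ^ n - U (n h)] tends
    to 0 strongly, uniformly in [n] ([chernoff]). With [h = t / n] this becomes
    [|S (t / n) ^ n f - T t f| <= e * e ^ (l * t)] for all [t > 0] and all large [n]
    ([chernoff_semigroup]).

    Laplace transform. The resolvent at [mu + i nu] is the integral of
    [e ^ (- (mu + i nu) t) T t]. On real functions it splits into two transforms,
    with weights [e ^ (- mu t) cos (nu t)] and [e ^ (- mu t) sin (nu t)]; these are
    pointwise integrals which are shown to be C_0-valued and to commute with [T].
    The addition formulas for cos and sin give the images of the two transforms
    under the generator ([laplace_cos_generator], [laplace_sin_generator]), and the
    resolvent identities follow by linear algebra ([complex_lin_resolvent]).
    Finally, replacing [T t g] by [S (t / n) ^ n g] changes each of the two transforms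
    by at most the integral of [e ^ (- mu t) * e * e ^ (l * t)], which is
    [e / (mu - l)] and does not depend on [x0] ([laplace_iter_S_cvg]). *)

Set Implicit Arguments.
Unset Strict Implicit.
Unset Printing Implicit Defensive.

(** * Continuous induction and linear identities *)

(** Every statement below that propagates along the half-line (uniform
    continuity, approximation of integrals, growth of orbits) is an instance:
    consider the supremum of the initial segments on which [P] holds. *)
Lemma real_induction (R : realType) (P : R -> Prop) :
  P 0 ->
  (forall t : R, 0 <= t -> P t -> \forall h \near (0 : R)^'+, P (t + h)) ->
  (forall t : R, 0 < t -> (forall s : R, 0 <= s < t -> P s) -> P t) ->
  forall t : R, 0 <= t -> P t.
Proof.
move=> P0 Pstep Plim t t0; apply: contrapT => nPt.
pose E := [set s | 0 <= s /\ forall r, 0 <= r <= s -> P r].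
have E0 : E 0 by split=> // r /andP[r0 r1]; rewrite (_ : r = 0) //; apply/eqP; rewrite eq_le r0 r1.
have Eub : ubound E t.
  move=> s [s0 Ps]; rewrite leNgt; apply/negP => ts; apply: nPt; apply: Ps.
  by rewrite t0 ltW.
have hE : has_sup E by split; [exists 0|exists t].
pose m := sup E.
have m0 : 0 <= m by exact: ub_le_sup (proj2 hE) _ E0.
have below s : 0 <= s < m -> P s.
  move=> /andP[s0 sm].
  have [r [r0 Pr] sr] := sup_adherent (eps := m - s) ltac:(by rewrite subr_gt0) hE.
  by apply: Pr; rewrite s0 ltW // (le_lt_trans _ sr) // subKr.
have Pm : P m.
  by have [->//|mn0] := eqVneq m 0; apply: Plim => //; rewrite lt_def mn0.
have := Pstep _ m0 Pm; rewrite near_withinE => /nbhs_ballP[d /= d0 Hd].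
have Pd s : m < s < m + d -> P s.
  move=> /andP[ms sd]; rewrite -(subrKC m s); apply: Hd; last by rewrite /= subr_gt0.
  by rewrite /ball /= sub0r normrN gtr0_norm ?subr_gt0 // ltrBlDl.
have Emd : E (m + d / 2).
  split; first by rewrite addr_ge0 // divr_ge0 // ltW.
  move=> r /andP[r0 rm]; have [rm'|mr|->//] := ltgtP r m.
    by apply: below; rewrite r0.
  apply: Pd; rewrite mr (le_lt_trans rm) // ltrD2l ltr_pdivrMr // mulr2n mulrDr mulr1.
  by rewrite ltrDl.
have := ub_le_sup (proj2 hE) Emd.
by rewrite -/m leNgt ltrDl divr_gt0.
Qed.

Lemma le_of_eq d (T : porderType d) (x y : T) : x = y -> (x <= y)%O.
Proof. by move=> ->. Qed.

(** Reflection for identities between sums and differences in an abelian group: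
    both sides are reified over a common list of atoms and compared by their
    integer coefficients. *)
Inductive zexpr := ZVar of nat | Z0 | ZAdd of zexpr & zexpr | ZOpp of zexpr.

Fixpoint zcoef (e : zexpr) (i : nat) : int :=
  match e with
  | ZVar j => (i == j)%:Z
  | Z0 => 0
  | ZAdd e1 e2 => zcoef e1 i + zcoef e2 i
  | ZOpp e1 => - zcoef e1 i
  end.

Fixpoint zbelow (n : nat) (e : zexpr) : bool :=
  match e with
  | ZVar j => (j < n)%N
  | Z0 => true
  | ZAdd e1 e2 => zbelow n e1 && zbelow n e2
  | ZOpp e1 => zbelow n e1
  end.

Fixpoint zeval (X : zmodType) (env : seq X) (e : zexpr) : X :=
  match e with
  | ZVar j => nth 0 env j
  | Z0 => 0
  | ZAdd e1 e2 => zeval env e1 + zeval env e2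
  | ZOpp e1 => - zeval env e1
  end.

Lemma zevalE (X : zmodType) (env : seq X) e : zbelow (size env) e ->
  zeval env e = \sum_(i < size env) nth 0 env i *~ zcoef e i.
Proof.
elim: e => [j /= jn|_|e1 IH1 e2 IH2 /= /andP[H1 H2]|e1 IH1 /= H1].
- rewrite (bigD1 (Ordinal jn)) //= eqxx mulr1z big1 ?addr0 // => i.
  by rewrite -val_eqE /= => /negbTE ->.
- by rewrite /= big1.
- by rewrite IH1 // IH2 // -big_split; apply: eq_bigr => i _; rewrite mulrzDr.
- by rewrite IH1 // -sumrN; apply: eq_bigr => i _; rewrite mulrNz.
Qed.

Lemma zeval_eq (X : zmodType) (env : seq X) e1 e2 :
  [&& zbelow (size env) e1, zbelow (size env) e2
    & all (fun i => zcoef e1 i == zcoef e2 i) (iota 0 (size env))] ->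
  zeval env e1 = zeval env e2.
Proof.
move=> /and3P[H1 H2 /allP H]; rewrite !zevalE //; apply: eq_bigr => i _.
by rewrite (eqP (H i _)) // mem_iota /=.
Qed.

(** Atoms are compared syntactically, because conversion between distinct
    elements of a function space may unfold the whole algebraic structure; only
    scalars, which can carry different coercion paths, are compared up to
    conversion. *)
Ltac zmod_same x y :=
  lazymatch x with
  | y => constr:(true)
  | ?a *: ?u =>
    lazymatch y with
    | ?b *: ?v =>
      match goal with
      | |- _ => let _ := constr:(erefl a : a = b) in zmod_same u v
      | |- _ => constr:(false)
      end
    | _ => constr:(false)
    end
  | _ => constr:(false)
  end.
Ltac zmod_index x env :=
  lazymatch env with
  | nil => constr:(@None nat)
  | ?y :: ?env' =>
    lazymatch zmod_same x y with
    | true => constr:(Some 0%N)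
    | false => lazymatch zmod_index x env' with
               | Some ?n => constr:(Some n.+1)
               | None => constr:(@None nat)
               end
    end
  end.
Ltac zmod_atoms t env :=
  lazymatch t with
  | ?a + ?b => let env1 := zmod_atoms a env in zmod_atoms b env1
  | - ?a => zmod_atoms a env
  | 0 => env
  | _ => lazymatch zmod_index t env with
         | Some _ => env
         | None => constr:(t :: env)
         end
  end.
Ltac zmod_reify t env :=
  lazymatch t with
  | ?a + ?b => let e1 := zmod_reify a env in
               let e2 := zmod_reify b env in constr:(ZAdd e1 e2)
  | - ?a => let e := zmod_reify a env in constr:(ZOpp e)
  | 0 => constr:(Z0)
  | _ => lazymatch zmod_index t env with Some ?n => constr:(ZVar n) end
  end.
Ltac zmod :=
  lazymatch goal with
  | |- @eq ?X ?a ?b =>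
    let env := zmod_atoms a (@nil X) in
    let env := zmod_atoms b env in
    let e1 := zmod_reify a env in
    let e2 := zmod_reify b env in
    exact: (@zeval_eq _ env e1 e2 isT)
  end.

(** * Chernoff's theorem, uniformly in the number of steps *)

Section chernoff.
Context {R : realType} {X : normedModType R}.
Implicit Types (f g : X) (V : {linear X -> X}) (h : R).

Lemma iter_linear_sub V n f g : iter n V (f - g) = iter n V f - iter n V g.
Proof. by elim: n => //= n ->; rewrite linearB. Qed.

Lemma iter_contract V (rho : R) n f : 0 <= rho ->
  (forall g, `|V g| <= rho * `|g|) -> `|iter n V f| <= rho ^+ n * `|f|.
Proof.
move=> r0 hV; elim: n => [|n ih] /=; first by rewrite mul1r.
by rewrite (le_trans (hV _)) // exprS -mulrA ler_wpM2l.
Qed.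

(** Riemann sum of step [h] of the integral over time that defines the resolvent
    at 0, cut after [N] steps. *)
Definition discrete_resolvent h (N : nat) V f : X :=
  h *: \sum_(k < N) iter k V f.
Local Notation G := discrete_resolvent.

Lemma discrete_resolventB h N V f g : G h N V (f - g) = G h N V f - G h N V g.
Proof.
rewrite /G -scalerBr; congr (_ *: _); rewrite -sumrB.
by apply: eq_bigr => i _; rewrite iter_linear_sub.
Qed.

Lemma discrete_resolventD h N V f g : G h N V (f + g) = G h N V f + G h N V g.
Proof.
rewrite /G -scalerDr; congr (_ *: _); rewrite -big_split.
by apply: eq_bigr => i _; elim: (nat_of_ord i) => //= n ->; rewrite linearD.
Qed.

Lemma discrete_resolventZ h N V (k : R) f : G h N V (k *: f) = k *: G h N V f.
Proof.
rewrite /G scalerA mulrC -scalerA; congr (_ *: _); rewrite scaler_sumr.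
by apply: eq_bigr => i _; elim: (nat_of_ord i) => //= n ->; rewrite linearZ.
Qed.

(** Summation of the geometric series: the defect of [G h N V f] from being a
    fixed point of [V] is its first term minus the one that follows its last. *)
Lemma discrete_resolvent_stepl h N V f :
  V (G h N V f) = G h N V f - h *: (f - iter N V f).
Proof.
rewrite /G linearZ -scalerBr; congr (_ *: _); rewrite (linear_sum V).
elim: N => [|N ih] /=; first by rewrite !big_ord0 subrr subr0.
rewrite !big_ord_recr /= linearD ih /= !opprD !opprK.
by rewrite -!addrA; congr (_ + _); rewrite addrCA.
Qed.

Lemma discrete_resolvent_stepr h N V f : G h N V (V f) = V (G h N V f).
Proof.
rewrite /G linearZ (linear_sum V) /=; congr (_ *: _); apply: eq_bigr => i _ /=.
by rewrite -iterS -iterSr.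
Qed.

(** The constant does not depend on [N]; it is [h] times the sum of the geometric
    series. *)
Lemma discrete_resolvent_le h N V (rho : R) f : 0 <= h -> 0 <= rho < 1 ->
  (forall g, `|V g| <= rho * `|g|) -> `|G h N V f| <= h / (1 - rho) * `|f|.
Proof.
move=> h0 /andP[r0 r1] hV; rewrite /G normrZ ger0_norm // -mulrA ler_wpM2l //.
rewrite mulrC ler_pdivlMr ?subr_gt0 //.
have H : `|\sum_(k < N) iter k V f| <= \sum_(k < N) rho ^+ k * `|f|.
  apply: le_trans (ler_norm_sum _ _ _) _; apply: ler_sum => i _.
  exact: iter_contract.
have H2 : \sum_(k < N) rho ^+ k * (1 - rho) = 1 - rho ^+ N.
  elim: {H} N => [|N ih]; first by rewrite big_ord0 subrr.
  by rewrite big_ord_recr /= ih exprSr; ring.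
apply: (@le_trans _ _ ((\sum_(k < N) rho ^+ k * `|f|) * (1 - rho))).
  by rewrite ler_wpM2r // subr_ge0 ltW.
rewrite -mulr_suml mulrAC mulr_suml H2 mulrBl mul1r gerBl.
by rewrite mulr_ge0 // exprn_ge0.
Qed.

(** One step from [V ^ n K] to [K U ^ n] costs [eta], and earlier errors are
    contracted by [V], so that the total error is a geometric sum, bounded
    uniformly in [n]. *)
Lemma telescope_le (V U : {linear X -> X}) (K : X -> X) (rho eta : R) v n :
  0 <= rho < 1 -> 0 <= eta -> (forall g, `|V g| <= rho * `|g|) ->
  (forall k, `|V (K (iter k U v)) - K (U (iter k U v))| <= eta) ->
  `|iter n V (K v) - K (iter n U v)| <= eta / (1 - rho).
Proof.
move=> /andP[r0 r1] e0 hV hK; have r1' : 0 < 1 - rho by rewrite subr_gt0.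
elim: n => [|n ih] /=; first by rewrite subrr normr0 divr_ge0 // ltW.
rewrite -[X in `|X|](subrKA (V (K (iter n U v)))) -linearB.
apply: le_trans (ler_normD _ _) _.
apply: (@le_trans _ _ (rho * (eta / (1 - rho)) + eta)).
  by apply: lerD => //; apply: le_trans (hV _) _; rewrite ler_wpM2l.
by apply: le_of_eq; field; rewrite lt0r_neq0.
Qed.

(** The factor [h / (1 - rho)] of the two preceding bounds stays bounded as [h]
    tends to 0 when [rho = e ^ (- d h)]. *)
Lemma expRN_frac_le (d h : R) : 0 < d -> 0 < h <= 1 ->
  h / (1 - expR (- (d * h))) <= d^-1 + 1.
Proof.
move=> d0 /andP[h0 h1]; have dh0 : 0 < d * h by rewrite mulr_gt0.
have e1 : expR (- (d * h)) < 1 by rewrite expR_lt1 oppr_lt0.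
rewrite ler_pdivrMr ?subr_gt0 //.
have : expR (- (d * h)) * (1 + d * h) <= 1.
  rewrite -[leRHS](expRxMexpNx_1 (d * h)) [leRHS]mulrC ler_wpM2l ?expR_ge0 //.
  exact: expR_ge1Dx.
set e := expR _ in e1 *; move=> H.
have H2 : d * h <= (1 - e) * (1 + d * h) by lra.
have : (1 - e) * (1 + d * h) <= (1 - e) * (1 + d).
  rewrite ler_wpM2l //; first by rewrite subr_ge0 ltW.
  by rewrite lerD2l ler_piMr // ltW.
move=> H3; have := le_trans H2 H3.
rewrite (_ : (d^-1 + 1) * (1 - e) = d^-1 * ((1 - e) * (1 + d))); last first.
  by field; rewrite lt0r_neq0.
by move=> H4; rewrite -(ler_pM2l d0) mulVKf ?lt0r_neq0.
Qed.

Lemma near_forall_le (T : Type) (F : set_system T) (FF : Filter F)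
    (P : nat -> T -> Prop) M :
  (forall j, \forall x \near F, P j x) ->
  \forall x \near F, forall j, (j <= M)%N -> P j x.
Proof.
move=> HP; elim: M => [|M ih].
  by apply: filterS (HP 0) => x Px j; rewrite leqn0 => /eqP ->.
apply: filterS2 ih (HP M.+1) => x H1 H2 j.
by rewrite leq_eqVlt => /predU1P[->//|]; rewrite ltnS; exact: H1.
Qed.

Lemma near0_gt0_le (e : R) : 0 < e -> \forall h \near (0 : R)^'+, 0 < h <= e.
Proof.
move=> e0; near=> h; apply/andP; split; first by near: h; exact: nbhs_right_gt.
by near: h; exact: nbhs_right_le.
Unshelve. all: by end_near. Qed.

Lemma exists_expn_le (rho h : R) : 0 <= rho < 1 -> 0 < h -> exists N, rho ^+ N <= h.
Proof.
move=> /andP[r0 r1] h0.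
have : (fun n => rho ^+ n : R^o) @ \oo --> (0 : R^o).
  by apply: cvg_expr; rewrite ger0_norm.
move=> /cvgrPdist_le /(_ _ h0) [N _ HN]; exists N.
by have := HN N (leqnn _); rewrite sub0r normrN ger0_norm // exprn_ge0.
Qed.

Section semigroups.
Variables (U V : R -> {linear X -> X}) (d : R).
Hypothesis d0 : 0 < d.
Hypothesis U0 : forall f, U 0 f = f.
Hypothesis UD : forall (s t : R) f, 0 <= s -> 0 <= t -> U (s + t) f = U s (U t f).
Hypothesis Ucont : forall f (e : R), 0 < e ->
  exists2 tau : R, 0 < tau & forall s : R, 0 <= s <= tau -> `|U s f - f| <= e.
Hypothesis Ule : forall (s : R) f, 0 <= s -> `|U s f| <= expR (- (d * s)) * `|f|.
Hypothesis Vle : forall (s : R) f, 0 <= s -> `|V s f| <= expR (- (d * s)) * `|f|.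

Let Ule1 (s : R) f : 0 <= s -> `|U s f| <= `|f|.
Proof.
move=> s0; apply: le_trans (Ule _ s0) _; rewrite ler_piMl //.
by rewrite expR_le1 oppr_le0 mulr_ge0 // ltW.
Qed.

Lemma semigroup_iter n h f : 0 <= h -> iter n (U h) f = U (n%:R * h) f.
Proof.
move=> h0; elim: n => [|n ih]; first by rewrite mul0r U0.
by rewrite iterS ih -UD ?mulr_ge0 //; congr (U _ f); rewrite -natr1; ring.
Qed.

(** An orbit with exponential decay is totally bounded: a finite grid of times
    covers it up to [e], the tail being small. *)
Lemma orbit_net f (e : R) : 0 < e -> exists tau (M : nat), 0 < tau /\
  forall s, 0 <= s -> exists2 j, (j <= M)%N & `|U s f - U (j%:R * tau) f| <= e.
Proof.
move=> e0; have [tau tau0 Htau] := Ucont f e0.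
have r01 : 0 <= expR (- (d * tau)) < 1.
  by rewrite expR_ge0 expR_lt1 oppr_lt0 mulr_gt0.
have p0 : 0 < `|f| + `|f| + 1 by rewrite ltr_wpDl // addr_ge0.
have [M HM] := exists_expn_le r01 (divr_gt0 e0 p0).
exists tau, M; split=> // s s0.
have key j : j%:R * tau <= s ->
    U s f - U (j%:R * tau) f = U (j%:R * tau) (U (s - j%:R * tau) f - f).
  move=> js; rewrite linearB -UD ?subr_ge0 ?mulr_ge0 // ?ltW //.
  by rewrite subrKC.
have [sM|Ms] := ltP s (M%:R * tau); last first.
  exists M => //; rewrite key //; apply: le_trans (Ule _ _) _.
    by rewrite mulr_ge0 // ltW.
  have -> : expR (- (d * (M%:R * tau))) = expR (- (d * tau)) ^+ M.
    by rewrite -expRM_natl; congr expR; rewrite -mulr_natl; ring.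
  apply: (@le_trans _ _ (e / (`|f| + `|f| + 1) * (`|f| + `|f| + 1))); last first.
    by rewrite divfK // lt0r_neq0.
  apply: ler_pM => //.
  apply: le_trans (ler_normB _ _) _.
  rewrite -addrA lerD ?Ule1 ?subr_ge0 // lerDl //.
have st0 : 0 <= s / tau by rewrite divr_ge0 // ltW.
have /andP[j1 j2] := truncn_itv st0.
set j := Num.truncn _ in j1 j2.
have j1' : j%:R * tau <= s by rewrite -ler_pdivlMr.
exists j.
  rewrite -(ler_nat R) (le_trans j1) // ler_pdivrMr //; exact: ltW.
rewrite key //; apply: le_trans (Ule1 _ _) _; first by rewrite mulr_ge0 // ltW.
apply: Htau; rewrite subr_ge0 j1' /= lerBlDl.
by move: j2; rewrite ltr_pdivrMr // -natr1 mulrDl mul1r => /ltW.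
Qed.

Variables (D : set (X * X)) (Rl : {linear X -> X}) (C : R).
Hypothesis Vgen : forall f k, D (f, k) -> forall e : R, 0 < e ->
  \forall h \near (0 : R)^'+, `|V h f - f - h *: k| <= e * h.
Hypothesis Rle : forall f, `|Rl f| <= C * `|f|.
Hypothesis RU : forall (s : R) f, 0 <= s -> Rl (U s f) = U s (Rl f).
Hypothesis Rgen : forall f (e : R), 0 < e ->
  \forall h \near (0 : R)^'+, `|U h (Rl f) - Rl f + h *: f| <= e * h.
Hypothesis Rcore : forall f (e : R), 0 < e ->
  exists g k, [/\ D (g, k), `|Rl f - g| <= e & `|f + k| <= e].
Hypothesis Rdense : forall f (e : R), 0 < e -> exists g, `|f - Rl g| <= e.

Let B := d^-1 + 1.
Let B0 : 0 < B. Proof. by rewrite addr_gt0 ?invr_gt0. Qed.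

Let rho h := expR (- (d * h)).
Let rho01 h : 0 < h -> 0 <= rho h < 1.
Proof. by move=> h0; rewrite expR_ge0 expR_lt1 oppr_lt0 mulr_gt0. Qed.

Let G h N f := G h N (V h) f.

Let Gle h N f : 0 < h <= 1 -> `|G h N f| <= B * `|f|.
Proof.
move=> /[dup] hh /andP[h0 h1].
apply: le_trans (discrete_resolvent_le (rho := rho h) _ _ (ltW h0) (rho01 h0) _) _.
  by move=> g; apply: Vle; exact: ltW.
by rewrite ler_wpM2r // expRN_frac_le.
Qed.

Let VNle h N f : 0 < h -> rho h ^+ N <= h -> `|iter N (V h) f| <= h * `|f|.
Proof.
move=> h0 hN; apply: le_trans (iter_contract (rho := rho h) _ _ _ _) _.
- exact: expR_ge0.
- by move=> g; apply: Vle; exact: ltW.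
- by rewrite ler_wpM2r.
Qed.

(** By density of the core, [Rl f] is close to some [g] with [D (g, k)] and [f]
    close to [- k]. On such a [g], [h ^ -1 (g - V h g)] is close to [- k], and [G]
    maps it to [g] up to the negligible [V h ^ N g]. *)
Lemma discrete_resolvent_cvg f (e : R) : 0 < e ->
  \forall h \near (0 : R)^'+, forall N, rho h ^+ N <= h -> `|G h N f - Rl f| <= e.
Proof.
(* the four error terms below add up to [(B + B + 1 + 1) * e1] *)
move=> e0; pose e1 := e / (B + B + 1 + 1).
have q0 : 0 < B + B + 1 + 1 by do 3! apply: addr_gt0 => //.
have e10 : 0 < e1 by rewrite divr_gt0.
have [g [k [Dgk Hg Hk]]] := Rcore f e10.
have m0 : 0 < e1 / (`|g| + 1) by rewrite divr_gt0 // ltr_wpDl.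
near=> h => N hN.
have /andP[h0 h1] : 0 < h <= 1 by near: h; exact: near0_gt0_le.
have hm : h <= e1 / (`|g| + 1) by near: h; exact: nbhs_right_le.
have HV : `|V h g - g - h *: k| <= e1 * h by near: h; exact: Vgen Dgk _ e10.
have E1 : G h N (g - V h g) = h *: (g - iter N (V h) g).
  rewrite /G discrete_resolventB discrete_resolvent_stepr.
  by rewrite discrete_resolvent_stepl opprB addrC subrK.
have E2 : G h N (h^-1 *: (g - V h g)) = g - iter N (V h) g.
  rewrite (_ : g - iter N _ g = h^-1 *: G h N (g - V h g)); last first.
    by rewrite E1 scalerA mulVf ?scale1r // lt0r_neq0.
  exact: discrete_resolventZ.
have -> : G h N f - Rl f = G h N (f - h^-1 *: (g - V h g)) + (g - Rl f) - iter N (V h) g.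
  by rewrite [in RHS]/G discrete_resolventB -!/(G _ _ _) E2; zmod.
apply: le_trans (ler_normB _ _) _.
have N1 : `|iter N (V h) g| <= e1.
  apply: le_trans (VNle _ h0 hN) _.
  apply: (@le_trans _ _ (e1 / (`|g| + 1) * (`|g| + 1))); last first.
    by rewrite divfK // lt0r_neq0 // ltr_wpDl.
  by apply: ler_pM => //; rewrite ?(ltW h0) // lerDl.
apply: le_trans (lerD (ler_normD _ _) N1) _.
have N2 : `|G h N (f - h^-1 *: (g - V h g))| <= B * (e1 + e1).
  apply: le_trans (Gle _ _ _) _; first by rewrite h0.
  rewrite ler_wpM2l ?(ltW B0) //.
  have -> : f - h^-1 *: (g - V h g) = (f + k) + h^-1 *: (V h g - g - h *: k).
    rewrite !scalerBr scalerA mulVf ?lt0r_neq0 // scale1r; zmod.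
  apply: le_trans (ler_normD _ _) _; apply: lerD => //.
  rewrite normrZ ger0_norm ?invr_ge0 ?(ltW h0) //.
  by rewrite ler_pdivrMl // mulrC.
have N3 : `|g - Rl f| <= e1 by rewrite distrC.
apply: le_trans (lerD (lerD N2 N3) (lexx _)) _.
apply: le_of_eq; rewrite /e1; field; exact: lt0r_neq0.
Unshelve. all: by end_near. Qed.

(** Strong convergence of uniformly bounded operators is uniform on totally
    bounded sets, here on an orbit. *)
Lemma discrete_resolvent_cvg_orbit f (e : R) : 0 < e ->
  \forall h \near (0 : R)^'+, forall N, rho h ^+ N <= h ->
  forall s, 0 <= s -> `|G h N (U s f) - Rl (U s f)| <= e.
Proof.
move=> e0; pose C' := Num.max C 0.
have C0 : 0 <= C' by rewrite le_max lexx orbT.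
have Rle' g : `|Rl g| <= C' * `|g|.
  by apply: le_trans (Rle _) _; rewrite ler_wpM2r // le_max lexx.
have q0 : 0 < B + C' + 1 by rewrite ltr_wpDl // addr_ge0 // ltW.
pose e1 := e / (B + C' + 1).
have e10 : 0 < e1 by rewrite divr_gt0.
have [tau [M [tau0 net]]] := orbit_net f e10.
near=> h => N hN s s0.
have hh : 0 < h <= 1 by near: h; exact: near0_gt0_le.
have Hj j : (j <= M)%N -> `|G h N (U (j%:R * tau) f) - Rl (U (j%:R * tau) f)| <= e1.
  move=> jM; move: j jM N hN; near: h.
  have := @near_forall_le _ _ (at_right_proper_filter (0 : R)) (fun j h => forall N, rho h ^+ N <= h ->
    `|G h N (U (j%:R * tau) f) - Rl (U (j%:R * tau) f)| <= e1) M.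
  by apply => j; exact: discrete_resolvent_cvg.
have [j jM js] := net _ s0.
set p := U s f in js *; set q := U _ f in js.
have -> : G h N p - Rl p = G h N (p - q) + (G h N q - Rl q) - Rl (p - q).
  have -> : Rl (p - q) = Rl p - Rl q by exact: linearB.
  by rewrite /G discrete_resolventB; zmod.
apply: le_trans (ler_normB _ _) _.
apply: le_trans (lerD (le_trans (ler_normD _ _) (lerD (Gle _ _ hh) (Hj _ jM))) (Rle' _)) _.
have -> : e = B * e1 + e1 + C' * e1 by rewrite /e1; field; exact: lt0r_neq0.
by rewrite lerD // ?lerD // ler_wpM2l // ltW.
Unshelve. all: by end_near. Qed.

(** On vectors [Rl (Rl f)] the step error [V G - G U] of the telescoping argument is
    [o(h)]: the generator relation for [Rl] and the convergence of [G], uniform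
    along the orbit of [f], both apply. *)
Lemma chernoff_range f (e : R) : 0 < e ->
  \forall h \near (0 : R)^'+, forall n,
    `|iter n (V h) (Rl (Rl f)) - iter n (U h) (Rl (Rl f))| <= e.
Proof.
move=> e0; pose e1 := e / (B * (B + 1 + 1) + 1 + 1).
have q0 : 0 < B * (B + 1 + 1) + 1 + 1 by do 2! apply: addr_gt0 => //; apply: mulr_gt0 => //; do 2! apply: addr_gt0 => //.
have e10 : 0 < e1 by rewrite divr_gt0.
have m0 : 0 < e1 / (`|Rl f| + 1) by rewrite divr_gt0 // ltr_wpDl.
near=> h => n.
have hh : 0 < h <= 1 by near: h; exact: near0_gt0_le.
have /andP[h0 h1] := hh.
have hm : h <= e1 / (`|Rl f| + 1) by near: h; exact: nbhs_right_le.
have [N hN] := exists_expn_le (rho01 h0) h0.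
have HG s : 0 <= s -> `|G h N (U s f) - Rl (U s f)| <= e1.
  by move: N hN s; near: h; exact: discrete_resolvent_cvg_orbit.
have HG' s : 0 <= s -> `|G h N (U s (Rl f)) - Rl (U s (Rl f))| <= e1.
  by move: N hN {HG} s; near: h; exact: discrete_resolvent_cvg_orbit.
have HR : `|U h (Rl f) - Rl f + h *: f| <= e1 * h.
  by near: h; exact: Rgen.
have nh n' : 0 <= n'%:R * h by rewrite mulr_ge0 // ltW.
have step k : `|V h (G h N (iter k (U h) (Rl f))) -
    G h N (U h (iter k (U h) (Rl f)))| <= h * (e1 * (B + 1 + 1)).
  rewrite semigroup_iter ?(ltW h0) // -RU ?nh //; set p := U (k%:R * h) f.
  (* up to [V h ^ N], the difference is [G (Rl p - U h (Rl p)) - h * Rl p], where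
     [Rl p - U h (Rl p)] is [h * p] up to [o(h)] *)
  have -> : V h (G h N (Rl p)) - G h N (U h (Rl p)) =
      - G h N (U h (Rl p) - Rl p + h *: p) + h *: (G h N p - Rl p)
      + h *: iter N (V h) (Rl p).
    rewrite discrete_resolvent_stepl !/(G _ _ _) /G discrete_resolventD.
    rewrite discrete_resolventB discrete_resolventZ !scalerBr.
    zmod.

  rewrite (_ : h * _ = B * (e1 * h) + h * e1 + h * e1); last by ring.
  apply: le_trans (ler_normD _ _) _; apply: lerD.
    apply: le_trans (ler_normD _ _) _; rewrite normrN; apply: lerD.
      apply: le_trans (Gle _ _ hh) _; rewrite ler_wpM2l ?(ltW B0) //.
      have -> : U h (Rl p) - Rl p + h *: p = U (k%:R * h) (U h (Rl f) - Rl f + h *: f).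
        rewrite linearD linearB linearZ /= -!RU ?nh ?(ltW h0) //; congr (Rl _ - _ + _).
        by rewrite -!UD ?nh ?(ltW h0) // addrC.
      by apply: le_trans (Ule1 _ (nh _)) HR.
    rewrite normrZ (ger0_norm (ltW h0)) ler_wpM2l ?(ltW h0) //; exact: HG.
  rewrite normrZ (ger0_norm (ltW h0)) ler_wpM2l ?(ltW h0) //.
  apply: le_trans (VNle _ h0 hN) _.
  apply: (@le_trans _ _ (e1 / (`|Rl f| + 1) * (`|Rl f| + 1))); last first.
    by rewrite divfK // lt0r_neq0 // ltr_wpDl.
  apply: ler_pM => //; rewrite ?(ltW h0) // RU ?nh //.
  by rewrite (le_trans (Ule1 _ (nh _))) // lerDl.
have eta0 : 0 <= h * (e1 * (B + 1 + 1)).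
  by apply/ltW/mulr_gt0 => //; apply: mulr_gt0 => //; do 2! apply: addr_gt0 => //.
have VV g : `|V h g| <= rho h * `|g| by apply: Vle; exact: ltW.
have tel := telescope_le n (rho01 h0) eta0 VV step.
(* replace [Rl] by [G] at both ends; the middle difference telescopes *)
have -> : iter n (V h) (Rl (Rl f)) - iter n (U h) (Rl (Rl f)) =
   - iter n (V h) (G h N (Rl f) - Rl (Rl f)) +
   (iter n (V h) (G h N (Rl f)) - G h N (iter n (U h) (Rl f))) +
   (G h N (iter n (U h) (Rl f)) - Rl (iter n (U h) (Rl f))).
  have -> : iter n (U h) (Rl (Rl f)) = Rl (iter n (U h) (Rl f)).
    by rewrite !semigroup_iter ?(ltW h0) // RU.
  by rewrite iter_linear_sub; zmod.
have -> : e = e1 + B * (e1 * (B + 1 + 1)) + e1 by rewrite /e1; field; exact: lt0r_neq0.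
apply: le_trans (ler_normD _ _) _; apply: lerD; last first.
  by rewrite semigroup_iter ?(ltW h0) //; exact: HG'.
apply: le_trans (ler_normD _ _) _; apply: lerD; last first.
  apply: le_trans tel _; rewrite mulrAC ler_wpM2r //; last exact: expRN_frac_le.
  by apply/ltW/mulr_gt0 => //; do 2! apply: addr_gt0 => //.
rewrite normrN; apply: le_trans (iter_contract (rho := rho h) _ _ _ VV) _.
  exact: expR_ge0.
have := HG' 0 (lexx _); rewrite U0 => H0.
apply: le_trans H0; rewrite ler_piMl //.
have /andP[r0 r1] := rho01 h0.
by rewrite exprn_ile1 // ltW.
Unshelve. all: by end_near. Qed.

(** The vectors [Rl (Rl g)] are dense and both families are contractive, so the
    convergence on the range of [Rl ^ 2] extends to the whole space. *)
Theorem chernoff f (e : R) : 0 < e ->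
  \forall h \near (0 : R)^'+, forall n,
    `|iter n (V h) f - U (n%:R * h) f| <= e.
Proof.
move=> e0; pose C' := Num.max C 0.
have C0 : 0 <= C' by rewrite le_max lexx orbT.
have Rle' g : `|Rl g| <= C' * `|g|.
  by apply: le_trans (Rle _) _; rewrite ler_wpM2r // le_max lexx.
have q0 : 0 < (1 + C') * 2 + 1 by rewrite ltr_wpDl // mulr_ge0 // addr_ge0.
pose e1 := e / ((1 + C') * 2 + 1).
have e10 : 0 < e1 by rewrite divr_gt0.
have [g1 Hg1] := Rdense f e10; have [g Hg] := Rdense g1 e10.
near=> h => n.
have h0 : 0 < h by near: h; exact: nbhs_right_gt.
have H : `|iter n (V h) (Rl (Rl g)) - iter n (U h) (Rl (Rl g))| <= e1.
  by move: n; near: h; exact: chernoff_range.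
rewrite -semigroup_iter ?(ltW h0) //.
set p := Rl (Rl g) in H.
have fp : `|f - p| <= (1 + C') * e1.
  rewrite -(subrKA (Rl g1)) mulrDl mul1r; apply: le_trans (ler_normD _ _) _.
  rewrite lerD // /p -linearB; apply: le_trans (Rle' _) _.
  by rewrite ler_wpM2l.
have -> : iter n (V h) f - iter n (U h) f = iter n (V h) (f - p) +
   (iter n (V h) p - iter n (U h) p) - iter n (U h) (f - p).
  by rewrite !iter_linear_sub; zmod.
have -> : e = (1 + C') * e1 + e1 + (1 + C') * e1.
  by rewrite /e1; field; exact: lt0r_neq0.
have le1 (W : {linear X -> X}) : (forall g, `|W g| <= rho h * `|g|) ->
    `|iter n W (f - p)| <= (1 + C') * e1.
  move=> HW; apply: le_trans fp.
  apply: le_trans (iter_contract n _ _ HW) _; first exact: expR_ge0.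
  by have /andP[r0 r1] := rho01 h0; rewrite ler_piMl // exprn_ile1 // ltW.
apply: le_trans (ler_normB _ _) _; apply: lerD; last first.
  by apply: le1 => g'; apply: Ule; exact: ltW.
apply: le_trans (ler_normD _ _) _; apply: lerD => //.
by apply: le1 => g'; apply: Vle; exact: ltW.
Unshelve. all: by end_near. Qed.

End semigroups.
End chernoff.

(** * Growth of a semigroup with a dissipative approximation *)

Section growth.
Context {R : realType} {X : normedModType R}.
Implicit Types (f k : X) (T : R -> {linear X -> X}).

Lemma semigroup_cont T t f (e : R) : C0_semigroup T -> 0 <= t -> 0 < e ->
  exists2 d, 0 < d & forall s, 0 <= s -> `|s - t| < d -> `|T s f - T t f| <= e.
Proof.
move=> [_ _ _ /(_ f)/subspace_continuousP cT] t0 e0.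
have /cT /cvgrPdist_le/(_ _ e0) : `[0, +oo[%classic t by rewrite /= in_itv /= t0.
rewrite near_withinE => /nbhs_ballP[d /= d0 Hd]; exists d => // s s0 st.
rewrite distrC; apply: Hd; last by rewrite /= in_itv /= s0.
by rewrite /ball /= distrC.
Qed.

(** The difference quotient without division: a form of the tangency at 0 that is
    shared with families [S h] that are not semigroups. *)
Lemma generatorP T f k : generator T (f, k) <-> forall e : R, 0 < e ->
  \forall h \near (0 : R)^'+, `|T h f - f - h *: k| <= e * h.
Proof.
have E (h : R) : 0 < h ->
    `|k - h^-1 *: (T h f - f)| = h^-1 * `|T h f - f - h *: k|.
  move=> h0; rewrite -[X in X * _]gtr0_norm ?invr_gt0 // -normrZ -normrN.
  congr `| _ |; rewrite !scalerBr scalerA mulVf ?lt0r_neq0 // scale1r; zmod.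
split=> [/cvgrPdist_le H e e0|H].
  near=> h; have h0 : 0 < h by near: h; exact: nbhs_right_gt.
  rewrite mulrC -ler_pdivrMl // -E //; near: h; exact: H.
apply/cvgrPdist_le => e e0; near=> h.
have h0 : 0 < h by near: h; exact: nbhs_right_gt.
rewrite /= E // ler_pdivrMl // mulrC; near: h; exact: H.
Unshelve. all: by end_near. Qed.

Lemma generator_orbit T f k t : C0_semigroup T -> 0 <= t ->
  generator T (f, k) -> generator T (T t f, T t k).
Proof.
move=> [cT _ TD _] t0; rewrite /generator /= => H.
have H2 : T t (h^-1 *: (T h f - f)) @[h --> (0 : R)^'+] --> T t k.
  by apply: continuous_cvg => //; exact: cT.
apply: cvg_trans H2.
apply: near_eq_cvg; near=> h.
have h0 : 0 <= h by near: h; exact: nbhs_right_ge.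
by rewrite linearZ linearB /= -!TD // [t + h]addrC.
Unshelve. all: by end_near. Qed.

Lemma expR_near_le (w w' : R) : 0 <= w < w' ->
  \forall h \near (0 : R)^'+, expR (w * h) <= 1 + w' * h.
Proof.
move=> /andP[w0 ww]; have w'0 : 0 < w' by exact: le_lt_trans ww.
have d0 : 0 < (w' - w) / ((w + 1) * w') by rewrite divr_gt0 ?subr_gt0 ?mulr_gt0 ?ltr_wpDl.
near=> h.
have h0 : 0 < h by near: h; exact: nbhs_right_gt.
have : h <= (w' - w) / ((w + 1) * w') by near: h; exact: nbhs_right_le.
rewrite ler_pdivlMr ?mulr_gt0 ?ltr_wpDl // => H.
have H1 : 1 <= (1 - w * h) * (1 + w' * h).
  have : h * (w * w' * h) <= h * (w' - w).
    rewrite ler_pM2l //; apply: le_trans H; rewrite [leRHS]mulrC ler_pM2r //.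
    by rewrite ler_pM2r // lerDl.
  lra.
have p0 : 0 < 1 + w' * h by rewrite ltr_pwDr ?mulr_gt0.
have : expR (w * h) * (1 - w * h) <= 1.
  rewrite -[leRHS](expRxMexpNx_1 (w * h)) ler_wpM2l ?expR_ge0 //.
  exact: expR_ge1Dx.
have e0 := expR_gt0 (w * h).
move=> H2; rewrite -[leLHS]mulr1.
apply: le_trans (ler_wpM2l (ltW e0) H1) _.
by rewrite mulrA ler_piMl // ltW.
Unshelve. all: by end_near. Qed.

Variables (T S : R -> {linear X -> X}) (D : set (X * X)) (w w' : R).
Hypothesis hT : C0_semigroup T.
Hypothesis ww : 0 <= w < w'.
Hypothesis Sle : forall (h : R) f, 0 <= h -> `|S h f| <= expR (w * h) * `|f|.
Hypothesis Sgen : forall f k, D (f, k) -> forall e : R, 0 < e ->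
  \forall h \near (0 : R)^'+, `|S h f - f - h *: k| <= e * h.
Hypothesis TD : generator T = closure D.

(** Write [(h + eta) f] as [h (f - eta k) + eta (S h f)] up to [o(h)] and use
    [|S h| <= 1 + w' h] for small [h]. *)
Lemma core_dissipative f k (eta : R) : D (f, k) -> 0 < eta ->
  (1 - eta * w') * `|f| <= `|f - eta *: k|.
Proof.
move=> Dfk eta0; apply/ler_addgt0Pl => e e0.
have e1 : 0 < e / eta by rewrite divr_gt0.
near (0 : R)^'+ => h.
have h0 : 0 < h by near: h; exact: nbhs_right_gt.
have H1 : `|S h f - f - h *: k| <= e / eta * h by near: h; exact: Sgen Dfk _ e1.
have H2 : expR (w * h) <= 1 + w' * h by near: h; exact: expR_near_le.
have E : (h + eta) *: f = h *: (f - eta *: k) - eta *: (S h f - f - h *: k) + eta *: S h f.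
  by rewrite !scalerBr scalerDl !scalerA [eta * h]mulrC; zmod.
have : (h + eta) * `|f| <= h * `|f - eta *: k| + eta * (e / eta * h) +
    eta * ((1 + w' * h) * `|f|).
  rewrite -[X in X * _ <= _]gtr0_norm ?addr_gt0 // -normrZ E.
  apply: le_trans (ler_normD _ _) _; apply: lerD.
    apply: le_trans (ler_normB _ _) _; rewrite !normrZ !gtr0_norm //.
    by rewrite lerD2l ler_pM2l.
  rewrite normrZ gtr0_norm // ler_pM2l //; apply: le_trans (Sle _ (ltW h0)) _.
  by rewrite ler_wpM2r.
rewrite (_ : eta * (e / eta * h) = h * e); last by field; rewrite lt0r_neq0.
move=> H; rewrite -(ler_pM2l h0); lra.
Unshelve. all: by end_near. Qed.

(** The inequality of [core_dissipative] is closed in the pair [(f, k)]. *)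
Lemma generator_dissipative f k (eta : R) : generator T (f, k) -> 0 < eta ->
  (1 - eta * w') * `|f| <= `|f - eta *: k|.
Proof.
rewrite TD => cl eta0; apply/ler_addgt0Pl => e e0.
have q0 : 0 < `|1 - eta * w'| + 1 + eta by rewrite addr_gt0 // ltr_wpDl.
pose e1 := e / (`|1 - eta * w'| + 1 + eta).
have e10 : 0 < e1 by rewrite divr_gt0.
have [[g j] [/= Dgj [/= B1 B2]]] : D `&` ball (f, k) e1 !=set0.
  by apply: cl; exact: nbhsx_ballx.
have H := core_dissipative Dgj eta0.
have fg : `|f - g| <= e1 by apply: ltW; move: B1; rewrite -ball_normE.
have kj : `|k - j| <= e1 by apply: ltW; move: B2; rewrite -ball_normE.
have -> : (1 - eta * w') * `|f| = (1 - eta * w') * `|g| + (1 - eta * w') * (`|f| - `|g|) by ring.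
have -> : e = e1 + eta * e1 + `|1 - eta * w'| * e1 by rewrite /e1; field; rewrite lt0r_neq0.
have H3 : (1 - eta * w') * (`|f| - `|g|) <= `|1 - eta * w'| * e1.
  apply: le_trans (ler_norm _) _; rewrite normrM ler_wpM2l //.
  exact: le_trans (ler_dist_dist _ _) fg.
have H4 : `|g - eta *: j| <= `|f - eta *: k| + e1 + eta * e1.
  have -> : g - eta *: j = (f - eta *: k) - (f - g) + eta *: (k - j).
    by rewrite scalerBr; zmod.
  apply: le_trans (ler_normD _ _) _; apply: lerD.
    by apply: le_trans (ler_normB _ _) _; rewrite lerD2l.
  by rewrite normrZ gtr0_norm // ler_pM2l.
lra.
Qed.

(** Continuous induction on [t]. At [t + h] the dissipativity inequality is applied
    to [T (t + h) f] with [eta = h]; since [T (t + h) f - h T (t + h) k] is [T t f] up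
    to [o(h)], the norm grows at most by the factor [(1 - h w') ^ -1], which is
    below [e ^ (w1 h)]. *)
Lemma orbit_growth w1 f k t : w' < w1 -> generator T (f, k) -> 0 <= t ->
  `|T t f| <= expR (w1 * t) * `|f|.
Proof.
move=> ww1 Gfk t0; have [_ T0 TDD _] := hT.
have w'0 : 0 < w' by case/andP: ww => /le_lt_trans; apply.
have w10 : 0 < w1 by exact: lt_trans ww1.
suff H K : `|f| < K -> `|T t f| <= expR (w1 * t) * K.
  rewrite -ler_pdivrMl ?expR_gt0 //; apply/ler_addgt0Pr => e e0.
  by rewrite ler_pdivrMl ?expR_gt0 //; apply: H; rewrite ltrDl.
move=> fK; have K0 : 0 < K by exact: le_lt_trans fK.
move: t t0; apply: real_induction.
- by rewrite T0 mulr0 expR0 mul1r ltW.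
- move=> t t0 Ht; set M := _ * K in Ht.
  have M0 : 0 < M by rewrite mulr_gt0 ?expR_gt0.
  have w10' : 0 < w1 - w' by rewrite subr_gt0.
  pose e := (w1 - w') * M / 4.
  (* half of the gap [w1 - w'] absorbs the two [o(h)] errors [e * h] *)
  have e0 : 0 < e by rewrite divr_gt0 // mulr_gt0.
  have Gt := generator_orbit hT t0 Gfk.
  have [d d0 Hd] := semigroup_cont k hT t0 e0.
  have m0 : 0 < (w1 - w') / (2 * (w' * w1)) by rewrite divr_gt0 // !mulr_gt0.
  near=> h.
  have h0 : 0 < h by near: h; exact: nbhs_right_gt.
  have hw : h * w' < 1 by rewrite -ltr_pdivlMr // mul1r; near: h; apply: nbhs_right_lt; rewrite invr_gt0.
  have hm : h <= (w1 - w') / (2 * (w' * w1)) by near: h; exact: nbhs_right_le.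
  have H1 : `|T h (T t f) - T t f - h *: T t k| <= e * h.
    by near: h; move/generatorP : Gt; apply.
  have H2 : `|T (t + h) k - T t k| <= e.
    apply: Hd; first by rewrite addr_ge0 // ltW.
    by rewrite [t + h]addrC addrK gtr0_norm //; near: h; exact: nbhs_right_lt.
  have th0 : 0 <= t + h by rewrite addr_ge0 // ltW.
  have := generator_dissipative (generator_orbit hT th0 Gfk) h0.
  have -> : T (t + h) f - h *: T (t + h) k = T t f +
      (T (t + h) f - T t f - h *: T t k) - h *: (T (t + h) k - T t k).
    by rewrite scalerBr; zmod.
  have H3 : `|T t f + (T (t + h) f - T t f - h *: T t k) -
      h *: (T (t + h) k - T t k)| <= M + e * h + h * e.
    apply: le_trans (ler_normB _ _) _; apply: lerD.
      apply: le_trans (ler_normD _ _) _; apply: lerD => //.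
      by rewrite [t + h]addrC TDD // ltW.
    by rewrite normrZ gtr0_norm // ler_pM2l.
  move=> H4; have {H3 H4} := le_trans H4 H3.
  move=> H5; rewrite -(ler_pM2l (_ : 0 < 1 - h * w')) ?subr_gt0 //.
  apply: le_trans H5 _.
  rewrite mulrDr expRD -[expR (w1 * t) * _ * K]mulrAC -/M [leRHS]mulrCA.
  have H6 : 1 + w1 * h <= expR (w1 * h) by exact: expR_ge1Dx.
  apply: (@le_trans _ _ (M * ((1 - h * w') * (1 + w1 * h)))); last first.
    by rewrite ler_pM2l // ler_pM2l // subr_gt0.
  rewrite (_ : M + e * h + h * e = M * (1 + (w1 - w') / 2 * h)); last by rewrite /e; field.
  rewrite ler_pM2l //.
  move: hm; rewrite ler_pdivlMr ?mulr_gt0 // => /(ler_wpM2l (ltW h0)); lra.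
- move=> t t0 H; apply/ler_addgt0Pl => e e0.
  have [d d0 Hd] := semigroup_cont f hT (ltW t0) e0.
  pose s := Num.max 0 (t - d / 2).
  have s0 : 0 <= s by rewrite le_max lexx.
  have st : s < t by rewrite gt_max t0 /= gtrBl divr_gt0.
  have := H s; rewrite s0 st => /(_ isT) Hs.
  have H1 : `|T s f - T t f| <= e.
    apply: Hd => //; rewrite distrC gtr0_norm ?subr_gt0 //.
    rewrite ltrBlDl -ltrBlDr lt_max; apply/orP; right.
    by rewrite ltrD2l ltrN2 ltr_pdivrMr // ltr_pMr // ltr1n.
  rewrite -[T t f](subrKC (T s f)); apply: le_trans (ler_normD _ _) _.
  rewrite addrC lerD //; first by rewrite distrC.
  apply: le_trans Hs _; rewrite ler_pM2r // ler_expR ler_pM2l //; exact: ltW.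
Unshelve. all: by end_near. Qed.

Lemma semigroup_growth w1 f t : w' < w1 ->
  (forall f e, 0 < e -> exists g k, generator T (g, k) /\ `|f - g| <= e) ->
  0 <= t -> `|T t f| <= expR (w1 * t) * `|f|.
Proof.
move=> ww1 dense t0; apply/ler_addgt0Pl => e e0.
have [cT _ _ _] := hT.
have q0 : 0 < expR (w1 * t) + 1 by rewrite addr_gt0 ?expR_gt0.
pose e1 := e / (expR (w1 * t) + 1).
have e10 : 0 < e1 by rewrite divr_gt0.
have /cvgrPdist_le/(_ _ e10)/nbhs_ballP[d /= d0 Hd] := cT t t0 f.
pose d1 := Num.min (d / 2) e1.
have d10 : 0 < d1 by rewrite lt_min e10 divr_gt0.
have [g [k [Ggk fg]]] := dense f d1 d10.
have H1 : `|T t f - T t g| <= e1.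
  apply: Hd; rewrite -ball_normE /=; apply: le_lt_trans fg _.
  by rewrite gt_min ltr_pdivrMr // ltr_pMr // ltr1n.
have H2 := orbit_growth ww1 Ggk t0.
have H3 : `|g| <= `|f| + e1.
  rewrite -[g](subKr f); apply: le_trans (ler_normB _ _) _; rewrite lerD2l.
  by apply: le_trans fg _; rewrite ge_min lexx orbT.
have H4 : `|T t f| <= `|T t g| + e1.
  by rewrite -[T t f](subrKC (T t g)); apply: le_trans (ler_normD _ _) _; rewrite lerD2l.
apply: le_trans H4 _; apply: le_trans (lerD H2 (lexx _)) _.
apply: le_trans (lerD (ler_wpM2l (expR_ge0 _) H3) (lexx _)) _.
have -> : e = expR (w1 * t) * e1 + e1 by rewrite /e1; field; rewrite lt0r_neq0.
by rewrite mulrDr; lra.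
Qed.

End growth.

(** * Integrals of continuous C_0-valued functions *)

Section C0_basics.
Context {R : realType}.
Implicit Types (f g : C0 R) (x : R).

Lemma C0_ler f x : `|f x| <= `|f|.
Proof. by apply: ub_le_sup; [apply: C0_bounded; exact: C0_funP|exists x]. Qed.

Lemma C0_norm_ler f (M : R) : (forall x, `|f x| <= M) -> `|f| <= M.
Proof. by move=> H; apply: ge_sup; [exists `|f 0|, 0|move=> _ [x _ <-]]. Qed.

Lemma C0_addE f g x : (f + g) x = f x + g x. Proof. by []. Qed.
Lemma C0_subE f g x : (f - g) x = f x - g x. Proof. by []. Qed.
Lemma C0_scaleE (k : R) f x : (k *: f) x = k * f x. Proof. by []. Qed.
Lemma C0_zeroE x : (0 : C0 R) x = 0. Proof. by []. Qed.
Lemma C0_ext f g : (forall x, f x = g x) -> f = g.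
Proof. by move=> H; apply/val_inj/funext. Qed.

Lemma C0_continuous f : continuous (f : R -> R).
Proof. by have /C0_predP[] := C0_funP f. Qed.

(** Locked, so that unification never compares two such functions by unfolding the
    membership test. *)
Definition mkC0 (f : R -> R) : C0 R := locked (insubd (0 : C0 R) (f : R -> R^o)).

Lemma mkC0E (f : R -> R) x : (f : R -> R^o) \in @C0_pred R R -> mkC0 f x = f x.
Proof. by move=> Hf; rewrite /mkC0 -lock; have := insubdK (0 : C0 R) Hf => /(congr1 (fun h => h x)). Qed.

(** C_0 is closed under uniform limits. This is how functions given by integrals
    are recognised as elements of C_0. *)
Lemma C0_unif_closed (f : R -> R) :
  (forall e : R, 0 < e -> exists q : C0 R, forall x, `|f x - q x| <= e) ->
  (f : R -> R^o) \in @C0_pred R R.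
Proof.
move=> H.
have lim (F : set_system R) (FF : Filter F) (l : R) :
    (forall e : R, 0 < e -> exists q : C0 R, (forall x, `|f x - q x| <= e) /\
      \forall x \near F, `|l - q x| <= e) -> (f : R -> R^o) @ F --> (l : R^o).
  move=> Hl; apply/cvgrPdist_le => e e0.
  have [q [Hq1 Hq2]] := Hl (e / 2) (divr_gt0 e0 (ltr0Sn _ _)).
  apply: filterS Hq2 => x Hx; rewrite -(subrKA (q x)).
  apply: le_trans (ler_normD _ _) _; rewrite [leRHS]splitr lerD //.
  by rewrite distrC.
apply/C0_predP; split.
- move=> x; apply: lim => e e0.
  have [q Hq] := H (e / 2) (divr_gt0 e0 (ltr0Sn _ _)).
  have e2 : e / 2 <= e by rewrite ler_pdivrMr // ler_peMr ?ler1n // ltW.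
  exists q; split; first by move=> y; apply: le_trans (Hq y) _.
  have /cvgrPdist_le/(_ (e / 2) (divr_gt0 e0 (ltr0Sn _ _))) := @C0_continuous q x.
  apply: filterS => y Hy; rewrite -(subrKA (q x)).
  by apply: le_trans (ler_normD _ _) _; rewrite [leRHS]splitr lerD.
- apply: lim => e e0; have [q Hq] := H e e0; exists q; split=> //.
  by have /C0_predP[_ /cvgrPdist_le/(_ _ e0) Hy _] := C0_funP q.
- apply: lim => e e0; have [q Hq] := H e e0; exists q; split=> //.
  by have /C0_predP[_ _ /cvgrPdist_le/(_ _ e0) Hy] := C0_funP q.
Qed.

End C0_basics.

Section vector_integral.
Context {R : realType}.
Local Notation mu := (@lebesgue_measure R).
Implicit Types (F : R -> C0 R) (x t : R).

(** Continuity on the closed half-line of a function whose values at negative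
    arguments are arbitrary. *)
Definition cont_pos F := forall t e : R, 0 <= t -> 0 < e ->
  exists2 d : R, 0 < d & forall s : R, 0 <= s -> `|s - t| < d -> `|F s - F t| <= e.

Lemma cont_pos_ext F F' : (forall s : R, 0 <= s -> F s = F' s) ->
  cont_pos F -> cont_pos F'.
Proof.
move=> E cF t e t0 e0; have [d d0 Hd] := cF t e t0 e0; exists d => // s s0 sd.
by rewrite -!E //; exact: Hd.
Qed.

Lemma cont_pos_within F x : cont_pos F ->
  {within `[0, +oo[, continuous (fun s => F s x : R)}.
Proof.
move=> cF; apply/subspace_continuousP => t; rewrite /= in_itv /= andbT => t0.
apply/cvgrPdist_le => e e0; have [d d0 Hd] := cF t e t0 e0.
rewrite near_withinE; apply/nbhs_ballP; exists d => // s.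
rewrite /ball /= => ts; rewrite in_itv /= andbT => s0; rewrite distrC -C0_subE.
by apply: le_trans (C0_ler _ _) _; apply: Hd => //; rewrite distrC.
Qed.

Lemma cont_pos_integrable F x a b : cont_pos F -> 0 <= a ->
  mu.-integrable `[a, b] (EFin \o (fun s => F s x)).
Proof.
move=> cF a0; apply: continuous_compact_integrable; first exact: segment_compact.
apply: (@continuous_subspaceW R R _ `[0, +oo[%classic (fun s => F s x : R)).
  2: exact: cont_pos_within.
move=> s /=.
by rewrite !in_itv /= => /andP[/(le_trans a0) ->].
Qed.

Definition vint F t x : R := \int[mu]_(s in `[0, t]) F s x.

Lemma Rintegral_near_cst (f : R -> R) a b c (e : R) : a <= b ->
  mu.-integrable `]a, b] (EFin \o f) -> (forall s, a < s <= b -> `|f s - c| <= e) ->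
  `|\int[mu]_(s in `]a, b]) f s - (b - a) * c| <= (b - a) * e.
Proof.
move=> ab intf H.
have ic k : mu.-integrable `]a, b] (EFin \o (cst k : R -> R)).
  have H0 : mu.-integrable `[a, b] (EFin \o (cst k : R -> R)).
    apply: continuous_compact_integrable; first exact: segment_compact.
    by apply: continuous_subspaceT => y; exact: cvg_cst.
  apply: integrableS H0 => //.
  by apply: subset_itvr; rewrite bnd_simp.
have len : fine (mu `]a, b]%classic) = b - a.
  rewrite lebesgue_measure_itv /= lte_fin; move: ab; rewrite le_eqVlt => /predU1P[->|->//].
  by rewrite ltxx subrr.
have cstE k : \int[mu]_(s in `]a, b]) k = (b - a) * k.
  by rewrite Rintegral_cst // len mulrC.
have i1 : mu.-integrable `]a, b] (EFin \o (fun s => f s - c)).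
  by apply: (integrableB _ intf (ic c)).
rewrite -cstE -RintegralB //; last exact: ic.
apply: le_trans (le_normr_Rintegral _ _) _ => //.
rewrite -cstE; apply: le_Rintegral => //.
- exact: integrable_norm i1.
- exact: ic.
Qed.

Lemma vint_itv F x a b : cont_pos F -> 0 <= a <= b ->
  vint F b x - vint F a x = \int[mu]_(s in `]a, b]) F s x.
Proof.
move=> cF /andP[a0 ab]; rewrite /vint Rintegral_itvB //.
exact: cont_pos_integrable.
Qed.

Lemma vint_step F x a b (v : C0 R) (e : R) : cont_pos F -> 0 <= a <= b ->
  (forall s : R, a <= s <= b -> `|F s - v| <= e) ->
  `|vint F b x - vint F a x - (b - a) * v x| <= (b - a) * e.
Proof.
move=> cF /andP[a0 ab] H; rewrite vint_itv // ?a0 //; apply: Rintegral_near_cst => //.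
- apply: integrableS (cont_pos_integrable x b cF a0) => //.
  by apply: subset_itvr; rewrite bnd_simp.
- move=> s /andP[/ltW sa sb]; rewrite -C0_subE; apply: le_trans (C0_ler _ _) _.
  by apply: H; rewrite sa.
Qed.

Lemma vint0 F x : vint F 0 x = 0.
Proof. by rewrite /vint set_itv1 Rintegral_set1. Qed.

(** Continuous induction on [t] constructs a Riemann sum [q] of [F], adding one term
    at each step; the same sum controls the integral of [B (F s)], which is what
    exchanges [B] and the integral. *)
Lemma vint_approx F (B : {linear C0 R -> C0 R}) t (e : R) :
  cont_pos F -> cont_pos (fun s => B (F s)) -> 0 < e -> 0 <= t ->
  exists q : C0 R, forall x, `|vint F t x - q x| <= t * e /\
     `|vint (fun s => B (F s)) t x - B q x| <= t * e.
Proof.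
move=> cF cBF e0; have key a b v (q : C0 R) : 0 <= a <= b ->
    (forall s : R, a <= s <= b -> `|F s - v| <= e) ->
    (forall s : R, a <= s <= b -> `|B (F s) - B v| <= e) ->
    (forall x, `|vint F a x - q x| <= a * e /\
     `|vint (fun s => B (F s)) a x - B q x| <= a * e) ->
    exists q' : C0 R, forall x, `|vint F b x - q' x| <= b * e /\
     `|vint (fun s => B (F s)) b x - B q' x| <= b * e.
  move=> ab H1 H2 Hq; exists (q + (b - a) *: v) => x; have [Q1 Q2] := Hq x.
  have -> : B (q + (b - a) *: v) = B q + (b - a) *: B v by rewrite linearD linearZ.
  rewrite !C0_addE !C0_scaleE.
  have S1 := vint_step x cF ab H1.
  have S2 := vint_step (v := B v) x cBF ab H2.
  have -> : b * e = a * e + (b - a) * e by ring.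
  split.
    rewrite (_ : _ - _ = (vint F a x - q x) + (vint F b x - vint F a x - (b - a) * v x)); last by ring.
    by apply: le_trans (ler_normD _ _) _; rewrite lerD.
  rewrite (_ : _ - _ = (vint (fun s => B (F s)) a x - B q x) +
     (vint (fun s => B (F s)) b x - vint (fun s => B (F s)) a x - (b - a) * B v x)); last by ring.
  by apply: le_trans (ler_normD _ _) _; rewrite lerD.
move: t; apply: real_induction.
- by exists 0 => x; rewrite [B 0]linear0 !vint0 C0_zeroE subrr normr0 mul0r.
- move=> t t0 [q Hq].
  have [d1 d10 Hd1] := cF t e t0 e0; have [d2 d20 Hd2] := cBF t e t0 e0.
  near=> h; have h0 : 0 < h by near: h; exact: nbhs_right_gt.
  apply: key Hq; first by rewrite t0 lerDl ltW.
    move=> s /andP[ts sh]; apply: Hd1; first exact: le_trans ts.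
    rewrite ger0_norm ?subr_ge0 // ltrBlDl; apply: le_lt_trans sh _; rewrite ltrD2l.
    by near: h; exact: nbhs_right_lt.
  move=> s /andP[ts sh]; apply: Hd2; first exact: le_trans ts.
  rewrite ger0_norm ?subr_ge0 // ltrBlDl; apply: le_lt_trans sh _; rewrite ltrD2l.
  by near: h; exact: nbhs_right_lt.
- move=> t t0 H.
  have [d1 d10 Hd1] := cF t e (ltW t0) e0; have [d2 d20 Hd2] := cBF t e (ltW t0) e0.
  pose s := Num.max 0 (t - Num.min d1 d2 / 2).
  have m0 : 0 < Num.min d1 d2 by rewrite lt_min d10.
  have s0 : 0 <= s by rewrite le_max lexx.
  have st : s < t by rewrite gt_max t0 /= gtrBl divr_gt0.
  have [q Hq] := H s (introT andP (conj s0 st)).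
  have sr r : s <= r <= t -> 0 <= r /\ `|r - t| < Num.min d1 d2.
    move=> /andP[sr rt]; split; first exact: le_trans sr.
    rewrite distrC ger0_norm ?subr_ge0 // ltrBlDl -ltrBlDr.
    apply: lt_le_trans sr; rewrite lt_max; apply/orP; right.
    by rewrite ltrD2l ltrN2 ltr_pdivrMr // ltr_pMr // ltr1n.
  apply: key Hq; first by rewrite s0 ltW.
    by move=> r /sr[r0]; rewrite lt_min => /andP[r1 _]; exact: Hd1.
  by move=> r /sr[r0]; rewrite lt_min => /andP[_ r1]; exact: Hd2.
Unshelve. all: by end_near. Qed.

Definition Vint F t : C0 R := mkC0 (vint F t).

Lemma VintE F t x : cont_pos F -> 0 <= t -> Vint F t x = vint F t x.
Proof.
move=> cF t0; rewrite /Vint mkC0E //; apply: C0_unif_closed => e e0.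
have t1 : 0 < t + 1 by rewrite ltr_wpDl.
have [q Hq] := vint_approx (B := idfun) cF cF (divr_gt0 e0 t1) t0.
exists q => y; apply: le_trans (Hq y).1 _.
by rewrite mulrCA ler_piMr ?(ltW e0) // ler_pdivrMr // mul1r lerDl.
Qed.

Lemma Vint_ext F F' t : (forall s : R, 0 <= s -> F s = F' s) -> Vint F t = Vint F' t.
Proof.
move=> E; rewrite /Vint; congr mkC0; apply/funext => x; apply: eq_Rintegral => s.
by rewrite inE /= in_itv /= => /andP[s0 _]; rewrite E.
Qed.

(** Both sides are close to [B q], where [q] is a common Riemann sum. *)
Lemma Vint_comm F (B : {linear C0 R -> C0 R}) t : continuous B ->
  cont_pos F -> cont_pos (fun s => B (F s)) -> 0 <= t ->
  B (Vint F t) = Vint (fun s => B (F s)) t.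
Proof.
move=> cB cF cBF t0; apply: C0_ext => x; apply/eqP; rewrite -subr_eq0 -normr_le0.
apply/ler_addgt0Pl => e e0; rewrite addr0.
have e2 : 0 < e / 2 by rewrite divr_gt0.
have /cvgrPdist_le/(_ _ e2)/nbhs_ballP[d /= d0 Hd] := cB (Vint F t).
pose e1 := Num.min (d / 2) (e / 2) / (t + 1).
have t1 : 0 < t + 1 by rewrite ltr_wpDl.
have m0 : 0 < Num.min (d / 2) (e / 2) by rewrite lt_min e2 divr_gt0.
have e10 : 0 < e1 by rewrite divr_gt0.
have te : t * e1 <= Num.min (d / 2) (e / 2).
  by rewrite /e1 mulrCA ler_piMr ?(ltW m0) // ler_pdivrMr // mul1r lerDl.
have [q Hq] := vint_approx cF cBF e10 t0.
have H1 : `|B (Vint F t) - B q| <= e / 2.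
  apply: Hd; rewrite -ball_normE /=.
  apply: (@le_lt_trans _ _ (d / 2)); last by rewrite ltr_pdivrMr // ltr_pMr // ltr1n.
  apply: C0_norm_ler => y; rewrite C0_subE VintE //; apply: le_trans (Hq y).1 _.
  by apply: le_trans te _; rewrite ge_min lexx.
have H2 : `|vint (fun s => B (F s)) t x - B q x| <= e / 2.
  by apply: le_trans (Hq x).2 _; apply: le_trans te _; rewrite ge_min lexx orbT.
rewrite (VintE _ cBF) // -(subrKA (B q x)) -C0_subE.
apply: le_trans (ler_normD _ _) _; rewrite [leRHS]splitr lerD //.
  exact: le_trans (C0_ler _ _) H1.
by rewrite distrC.
Qed.

Lemma Vint_diff F t (e : R) : cont_pos F -> 0 <= t -> 0 < e ->
  \forall h \near (0 : R)^'+, `|Vint F (t + h) - Vint F t - h *: F t| <= e * h.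
Proof.
move=> cF t0 e0; have [d d0 Hd] := cF t e t0 e0.
near=> h; have h0 : 0 < h by near: h; exact: nbhs_right_gt.
have th0 : 0 <= t + h by rewrite addr_ge0 // ltW.
apply: C0_norm_ler => x; rewrite !C0_subE C0_scaleE !VintE // mulrC.
have -> : h = t + h - t by rewrite [t + h]addrC addrK.
rewrite mulrC [e * _]mulrC [X in vint _ X x]subrKC; apply: vint_step => //.
  by rewrite t0 lerDl ltW.
move=> s /andP[ts sh]; apply: Hd; first exact: le_trans ts.
rewrite ger0_norm ?subr_ge0 // ltrBlDl; apply: le_lt_trans sh _; rewrite ltrD2l.
by near: h; exact: nbhs_right_lt.
Unshelve. all: by end_near. Qed.

End vector_integral.

(** * Laplace transforms of a semigroup *)

Section exponential_tail.
Context {R : realType}.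
Local Notation mu := (@lebesgue_measure R).

Lemma exp_tail (k N : R) : 0 < k ->
  (\int[mu]_(s in `]N, +oo[) (expR (- (k * s)))%:E = (expR (- (k * N)) / k)%:E)%E.
Proof.
move=> k0; have cE : continuous (fun s : R => expR (- (k * s))).
  move=> s; apply: (continuous_comp (f := fun s : R => - (k * s))); last exact: continuous_expR.
  by apply: cvgN; apply: cvgM; [exact: cvg_cst|exact: cvg_id].
rewrite integral_itv_obnd_cbnd; last first.
  apply/measurable_EFinP/measurable_funTS; exact: continuous_measurable_fun.
pose F (s : R) := - (expR (- (k * s)) / k).
have dF (s : R) : is_derive s 1 F (expR (- (k * s))).
  by rewrite /F; apply: is_derive_eq; rewrite scaler0 add0r /GRing.scale /=; field; rewrite lt0r_neq0.
rewrite (@ge0_continuous_FTC2y R (fun s => expR (- (k * s))) F N 0).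
- by rewrite /F sub0e -EFinN opprK.
- by move=> x _; exact: expR_ge0.
- exact: continuous_subspaceT.
- rewrite /F -oppr0; apply: cvgN; rewrite -[X in _ --> X](mul0r k^-1).
  apply: cvgM; last exact: cvg_cst.
  apply: (cvg_comp (fun s : R => k * s) (fun y : R => expR (- y))); last exact: cvgr_expR.
  have -> : (fun s : R => k * s) = (fun s : R => s * k) by apply/funext => s; rewrite mulrC.
  by apply/gt0_cvgMly => //; exact: cvg_id.
- by move=> x _; have [] := dF x.
- apply: cvg_at_right_filter.
  apply/differentiable_continuous/derivable1_diffP; by have [] := dF N.
- by move=> x _; rewrite derive1E; apply: derive_val.
Qed.

Lemma exp_integrable (k N : R) : 0 < k ->
  mu.-integrable `]N, +oo[ (EFin \o (fun s : R => expR (- (k * s)))).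
Proof.
move=> k0; apply/integrableP; split.
  apply/measurable_EFinP/measurable_funTS; apply: continuous_measurable_fun => s.
  apply: (continuous_comp (f := fun s : R => - (k * s))); last exact: continuous_expR.
  by apply: cvgN; apply: cvgM; [exact: cvg_cst|exact: cvg_id].
under eq_integral do rewrite /= ger0_norm ?expR_ge0 //.
by rewrite exp_tail // ltry.
Qed.

Lemma dom_integrable (u : R -> R) (C k : R) : 0 < k ->
  measurable_fun (`]0, +oo[%classic : set R) u -> (forall s : R, 0 < s -> `|u s| <= C * expR (- (k * s))) ->
  mu.-integrable `]0, +oo[ (EFin \o u).
Proof.
move=> k0 mu_ H.
have i1 : mu.-integrable `]0, +oo[ (EFin \o (fun s : R => C * expR (- (k * s)))).
  by apply: (integrableZl _ C (exp_integrable 0 k0)).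
apply: le_integrable i1 => //; first exact/measurable_EFinP.
move=> s /=; rewrite in_itv /= andbT => s0; rewrite lee_fin.
by apply: le_trans (H s s0) _; exact: ler_norm.
Qed.

(** For [N = 0] this bounds the whole integral, for large [N] the truncation error. *)
Lemma dom_tail (u : R -> R) (C k N : R) : 0 < k -> 0 <= N ->
  measurable_fun (`]0, +oo[%classic : set R) u -> (forall s : R, 0 < s -> `|u s| <= C * expR (- (k * s))) ->
  `|\int[mu]_(s in `]N, +oo[) u s| <= C * (expR (- (k * N)) / k).
Proof.
move=> k0 N0 mu_ H; have i0 := dom_integrable k0 mu_ H.
have sub : (`]N, +oo[%classic : set R) `<=` `]0, +oo[%classic.
  by apply: subset_itvr; rewrite bnd_simp.
have iN : mu.-integrable `]N, +oo[ (EFin \o u) by apply: integrableS i0.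
apply: le_trans (le_normr_Rintegral _ iN) _ => //.
have iE := exp_integrable N k0.
have -> : C * (expR (- (k * N)) / k) = \int[mu]_(s in `]N, +oo[) (C * expR (- (k * s))).
  by rewrite RintegralZl // /Rintegral exp_tail.
apply: le_Rintegral => //.
- exact: integrable_norm iN.
- by apply: (integrableZl _ C iE).
- by move=> s /sub /=; rewrite in_itv /= andbT => s0; exact: H.
Qed.

End exponential_tail.

Lemma is_derive_near0 (R : realType) (f : R -> R) (df : R) : is_derive (0 : R) 1 f df ->
  forall e : R, 0 < e -> \forall h \near (0 : R)^'+, `|f h - f 0 - h * df| <= e * h.
Proof.
move=> [Hd Hv] e e0; move: Hd; rewrite /derivable => /cvg_ex[l Hl].
have El : l = df by rewrite -Hv /derive; apply/esym; exact: cvg_lim Hl.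
move: Hl; rewrite El => /cvgrPdist_le/(_ _ e0).
rewrite near_withinE => /nbhs_ballP[d /= d0 Hd]; near=> h.
have h0 : 0 < h by near: h; exact: nbhs_right_gt.
have : `|df - h^-1 *: (f (h *: 1 + 0) - f 0)| <= e.
  apply: Hd; last exact: lt0r_neq0.
  rewrite /ball /= sub0r normrN gtr0_norm //; near: h; exact: nbhs_right_lt.
rewrite addr0 /GRing.scale /= mulr1 => H.
have -> : f h - f 0 - h * df = - (h * (df - h^-1 * (f h - f 0))) by field; rewrite lt0r_neq0.
by rewrite normrN normrM gtr0_norm // mulrC ler_pM2r.
Unshelve. all: by end_near. Qed.

(** The product rule at 0 for [a h *: (A - Va h) + b h *: (B - Vb h)], with a scalar
    [a] near 1 and all the other factors vanishing. It gives the generator of a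
    shifted Laplace transform as well as that of a rescaled semigroup. *)
Lemma near0_combine (R : realType) (X : normedModType R) (A B va vb : X)
    (a b : R -> R) (Va Vb : R -> X) (a' b' : R) :
  (forall e : R, 0 < e -> \forall h \near (0 : R)^'+, `|a h - 1 - h * a'| <= e * h) ->
  (forall e : R, 0 < e -> \forall h \near (0 : R)^'+, `|b h - h * b'| <= e * h) ->
  (forall e : R, 0 < e -> \forall h \near (0 : R)^'+, `|Va h - h *: va| <= e * h) ->
  (forall e : R, 0 < e -> \forall h \near (0 : R)^'+, `|Vb h - h *: vb| <= e * h) ->
  forall e : R, 0 < e -> \forall h \near (0 : R)^'+,
    `|a h *: (A - Va h) + b h *: (B - Vb h) - A - h *: (a' *: A + b' *: B - va)| <= e * h.
Proof.
move=> Ha Hb HVa HVb e e0.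
pose M := `|A| + `|B| + 2 + 2 * `|va| + (1 + 2 * `|vb|).
have M0 : 0 < M.
  have := normr_ge0 A; have := normr_ge0 B; have := normr_ge0 va; have := normr_ge0 vb.
  rewrite /M; lra.
pose e1 := Num.min (e / M) (1 / 2).
have e10 : 0 < e1 by rewrite lt_min !divr_gt0.
have e1h : e1 <= 1 / 2 by rewrite ge_min lexx orbT.
have e1M : e1 * M <= e by rewrite -ler_pdivlMr // ge_min lexx.
have q0 : 0 < e1 / (1 + `|a'| + `|b'|).
  by rewrite divr_gt0 // ltr_pwDl // ltr_pwDl.
near=> h.
have h0 : 0 < h by near: h; exact: nbhs_right_gt.
have h1 : h <= 1 by near: h; exact: nbhs_right_le.
have hq : h <= e1 / (1 + `|a'| + `|b'|) by near: h; exact: nbhs_right_le.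
have H1 : `|a h - 1 - h * a'| <= e1 * h by near: h; exact: Ha.
have H2 : `|b h - h * b'| <= e1 * h by near: h; exact: Hb.
have H3 : `|Va h - h *: va| <= e1 * h by near: h; exact: HVa.
have H4 : `|Vb h - h *: vb| <= e1 * h by near: h; exact: HVb.
have hab : h * `|a'| <= e1 /\ h * `|b'| <= e1.
  move: hq; rewrite ler_pdivlMr ?ltr_pwDl // => hq.
  by split; apply: le_trans hq; rewrite ler_pM2l // ?lerDr ?addr_ge0 // -addrA addrCA lerDl addr_ge0.
have e1h' : e1 * h <= e1 by rewrite ler_piMr // ltW.
have a1 : `|a h - 1| <= e1 + e1.
  rewrite -[a h - 1](subrK (h * a')); apply: le_trans (ler_normD _ _) _.
  by rewrite lerD ?normrM ?(gtr0_norm h0) ?hab.1 // (le_trans H1).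
have b1 : `|b h| <= e1 + e1.
  rewrite -[b h](subrK (h * b')); apply: le_trans (ler_normD _ _) _.
  by rewrite lerD ?normrM ?(gtr0_norm h0) ?hab.2 // (le_trans H2).
have a2 : `|a h| <= 2.
  rewrite -[a h](subrK 1); apply: le_trans (ler_normD _ _) _; rewrite normr1; lra.
have -> : a h *: (A - Va h) + b h *: (B - Vb h) - A - h *: (a' *: A + b' *: B - va) =
  (a h - 1 - h * a') *: A + (b h - h * b') *: B - a h *: (Va h - h *: va)
   - ((a h - 1) * h) *: va - b h *: (Vb h - h *: vb) - (b h * h) *: vb.
  by rewrite !(scalerBr, scalerBl, scalerDr, scalerA, mulrBl, mul1r, scale1r); zmod.
have bnd (c : R) (v : X) K : `|c| <= K -> `|c *: v| <= K * `|v|.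
  by move=> H; rewrite normrZ ler_wpM2r.
have bnd' (c K : R) (v : X) : `|c| <= K -> `|v| <= e1 * h -> `|c *: v| <= K * (e1 * h).
  by move=> H Hv; rewrite normrZ ler_pM.
have H5 : `|(a h - 1) * h| <= (e1 + e1) * h by rewrite normrM (gtr0_norm h0) ler_pM2r.
have H6 : `|b h * h| <= (e1 + e1) * h by rewrite normrM (gtr0_norm h0) ler_pM2r.
have b2 : `|b h| <= 1 by apply: le_trans b1 _; lra.
apply: (@le_trans _ _ (e1 * M * h)); last by rewrite ler_pM2r.
have -> : e1 * M * h = e1 * h * `|A| + e1 * h * `|B| + 2 * (e1 * h) + (e1 + e1) * h * `|va|
   + 1 * (e1 * h) + (e1 + e1) * h * `|vb| by rewrite /M; ring.
apply: le_trans (ler_normB _ _) _; apply: lerD; last exact: bnd.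
apply: le_trans (ler_normB _ _) _; apply: lerD; last exact: bnd'.
apply: le_trans (ler_normB _ _) _; apply: lerD; last exact: bnd.
apply: le_trans (ler_normB _ _) _; apply: lerD; last exact: bnd'.
by apply: le_trans (ler_normD _ _) _; apply: lerD; exact: bnd.
Unshelve. all: by end_near. Qed.

Section semigroup_integral.
Context {R : realType}.
Local Notation mu := (@lebesgue_measure R).
Variable T : R -> {linear C0 R -> C0 R}.
Hypothesis hT : C0_semigroup T.
Implicit Types (g : C0 R) (F : R -> C0 R) (phi : R -> R).

Lemma orbit_cont_pos phi g : continuous phi -> cont_pos (fun s => phi s *: T s g).
Proof.
move=> cphi t e t0 e0; pose M := `|phi t| + 1 + `|T t g|.
have M0 : 0 < M by rewrite ltr_pwDl // ltr_wpDl.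
have e10 : 0 < Num.min 1 (e / M) by rewrite lt_min ltr01 divr_gt0.
have [d1 d10 H1] := semigroup_cont g hT t0 e10.
have /cvgrPdist_le/(_ _ e10)/nbhs_ballP[d2 /= d20 H2] := cphi t.
exists (Num.min d1 d2); first by rewrite lt_min d10.
move=> s s0; rewrite lt_min => /andP[sd1 sd2].
have K1 := H1 s s0 sd1.
have K2 : `|phi t - phi s| <= Num.min 1 (e / M) by apply: H2; rewrite /ball /= distrC.
have -> : phi s *: T s g - phi t *: T t g =
    phi s *: (T s g - T t g) - (phi t - phi s) *: T t g.
  by rewrite scalerBr scalerBl; zmod.
have K3 : `|phi s| <= `|phi t| + 1.
  rewrite -[phi s](subKr (phi t)); apply: le_trans (ler_normB _ _) _; rewrite lerD2l.
  by apply: le_trans K2 _; rewrite ge_min lexx.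
have m1 : Num.min 1 (e / M) <= e / M by rewrite ge_min lexx orbT.
apply: le_trans (ler_normB _ _) _; rewrite !normrZ.
have -> : e = (`|phi t| + 1) * (e / M) + (e / M) * `|T t g|.
  by rewrite [(e / M) * _]mulrC -mulrDl -/M mulrC divfK // lt0r_neq0.
apply: lerD; first by apply: ler_pM => //; exact: le_trans K1 m1.
by rewrite ler_wpM2r // (le_trans K2).
Qed.

Lemma vint_shift F x (a h : R) : cont_pos F -> 0 <= a -> 0 <= h ->
  vint (fun s => F (s + h)) a x = vint F (a + h) x - vint F h x.
Proof.
move=> cF a0 h0; have ha : 0 <= h <= a + h by rewrite h0 lerDr.
rewrite vint_itv // /vint Rintegral_itv_obnd_cbnd; last first.
  apply: integrableS (cont_pos_integrable x (a + h) cF h0) => //.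
  by apply: subset_itvr; rewrite bnd_simp.
rewrite /Rintegral; congr fine.
have dS (s : R) : is_derive s 1 (fun s : R => s + h) 1.
  by apply: is_derive_eq; rewrite addr0.
have dE : (fun s : R => s + h)^`()%classic = cst 1.
  by apply/funext => s; rewrite derive1E; apply: derive_val.
have := @integration_by_substitution_increasing R (fun s => s + h) (fun s => F s x) 0 a a0.
rewrite add0r dE => ->.
- by apply: eq_integral => s _; rewrite fctE /= mulr1.
- by move=> s s' _ _; rewrite ltrD2r.
- by move=> s _; exact: cvg_cst.
- exact: is_cvg_cst.
- exact: is_cvg_cst.
- have cS : continuous (fun s : R => s + h).
    by move=> s; apply: cvgD; [exact: cvg_id|exact: cvg_cst].
  split; first by move=> s _; have [] := dS s.
    by apply: cvg_at_right_filter; exact: cS.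
  by apply: cvg_at_left_filter; exact: cS.
- apply: (@continuous_subspaceW R R _ `[0, +oo[%classic (fun s => F s x : R)).
    by move=> s /=; rewrite !in_itv /= => /andP[/(le_trans h0) ->].
  exact: cont_pos_within.
Qed.

Lemma cont_pos_shift F h : cont_pos F -> 0 <= h -> cont_pos (fun s => F (s + h)).
Proof.
move=> cF h0 t e t0 e0; have [d d0 Hd] := cF (t + h) e (addr_ge0 t0 h0) e0.
exists d => // s s0 sd; apply: Hd; first exact: addr_ge0.
by rewrite opprD addrACA subrr addr0.
Qed.

Lemma cont_pos_comb F1 F2 (k1 k2 : R) : cont_pos F1 -> cont_pos F2 ->
  cont_pos (fun s => k1 *: F1 s + k2 *: F2 s).
Proof.
move=> c1 c2 t e t0 e0; pose M := `|k1| + 1 + `|k2|.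
have M0 : 0 < M by rewrite ltr_pwDl // ltr_wpDl.
have e10 : 0 < e / M by rewrite divr_gt0.
have [d1 d10 H1] := c1 t _ t0 e10; have [d2 d20 H2] := c2 t _ t0 e10.
exists (Num.min d1 d2); first by rewrite lt_min d10.
move=> s s0; rewrite lt_min => /andP[/(H1 _ s0) K1 /(H2 _ s0) K2].
have -> : k1 *: F1 s + k2 *: F2 s - (k1 *: F1 t + k2 *: F2 t) =
  k1 *: (F1 s - F1 t) + k2 *: (F2 s - F2 t) by rewrite !scalerBr; zmod.
apply: le_trans (ler_normD _ _) _; rewrite !normrZ.
apply: le_trans (lerD (ler_wpM2l (normr_ge0 _) K1) (ler_wpM2l (normr_ge0 _) K2)) _.
rewrite -mulrDl; apply: (@le_trans _ _ (M * (e / M))).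
  by rewrite ler_pM2r // /M lerD2r lerDl.
by rewrite mulrC divfK // lt0r_neq0.
Qed.

Lemma vint_comb F1 F2 (k1 k2 : R) t x : cont_pos F1 -> cont_pos F2 ->
  vint (fun s => k1 *: F1 s + k2 *: F2 s) t x = k1 * vint F1 t x + k2 * vint F2 t x.
Proof.
move=> c1 c2; have i1 := cont_pos_integrable x t c1 (lexx 0).
have i2 := cont_pos_integrable x t c2 (lexx 0).
rewrite /vint -RintegralZl // -RintegralZl // -RintegralD //.
- by apply: (integrableZl _ k1 i1).
- by apply: (integrableZl _ k2 i2).
Qed.

Lemma Vint_comb F1 F2 (k1 k2 : R) t : cont_pos F1 -> cont_pos F2 -> 0 <= t ->
  Vint (fun s => k1 *: F1 s + k2 *: F2 s) t = k1 *: Vint F1 t + k2 *: Vint F2 t.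
Proof.
move=> c1 c2 t0; apply: C0_ext => x; rewrite C0_addE !C0_scaleE !VintE //.
  exact: vint_comb.
exact: cont_pos_comb.
Qed.

Lemma Vint_shift F (a h : R) : cont_pos F -> 0 <= a -> 0 <= h ->
  Vint (fun s => F (s + h)) a = Vint F (a + h) - Vint F h.
Proof.
move=> cF a0 h0; apply: C0_ext => x; rewrite C0_subE !VintE ?addr_ge0 //.
  exact: vint_shift.
exact: cont_pos_shift.
Qed.

Lemma Vint0 F : cont_pos F -> Vint F 0 = 0.
Proof. by move=> cF; apply: C0_ext => x; rewrite VintE // vint0. Qed.

Let orb g s := T s g.
Let orb_cont g : cont_pos (orb g).
Proof.
have c1 : continuous (fun _ : R => 1 : R) by move=> x; exact: cvg_cst.
by apply: cont_pos_ext (orbit_cont_pos g c1) => s _; rewrite scale1r.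
Qed.

(** The mean of an orbit over [[0, h]] lies in the domain of the generator and
    tends to [g] as [h] tends to 0. *)
Lemma generator_dense g (e : R) : 0 < e ->
  exists f k, generator T (f, k) /\ `|g - f| <= e.
Proof.
move=> e0; have [cT T0 TD _] := hT.
have H := Vint_diff (orb_cont g) (lexx 0) e0.
near (0 : R)^'+ => h.
have h0 : 0 < h by near: h; exact: nbhs_right_gt.
have : `|Vint (orb g) (0 + h) - Vint (orb g) 0 - h *: orb g 0| <= e * h.
  by near: h; exact: H.
rewrite add0r Vint0 ?subr0 // {2}/orb T0 => H'.
exists (h^-1 *: Vint (orb g) h), (h^-1 *: (T h g - g)); split; last first.
  have -> : g - h^-1 *: Vint (orb g) h = - (h^-1 *: (Vint (orb g) h - h *: g)).
    by rewrite scalerBr scalerA mulVf ?lt0r_neq0 // scale1r; zmod.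
  rewrite normrN normrZ gtr0_norm ?invr_gt0 // ler_pdivrMl // mulrC; exact: H'.
apply/generatorP => r r0; have r1 : 0 < r * h / 2 by rewrite divr_gt0 // mulr_gt0.
near=> u.
have u0 : 0 < u by near: u; exact: nbhs_right_gt.
have H1 : `|Vint (orb g) (h + u) - Vint (orb g) h - u *: T h g| <= r * h / 2 * u.
  by near: u; exact: Vint_diff (ltW h0) r1.
have H2 : `|Vint (orb g) (0 + u) - Vint (orb g) 0 - u *: T 0 g| <= r * h / 2 * u.
  by near: u; exact: Vint_diff (lexx 0) r1.
rewrite add0r Vint0 ?subr0 // T0 in H2.
have E s : 0 <= s -> orb g (s + u) = T u (orb g s).
  by move=> s0; rewrite /orb addrC TD // ltW.
have cu := cont_pos_ext E (cont_pos_shift (orb_cont g) (ltW u0)).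
have -> : T u (h^-1 *: Vint (orb g) h) =
    h^-1 *: (Vint (orb g) (h + u) - Vint (orb g) u).
  rewrite linearZ /= Vint_comm ?(ltW h0) //; last exact: cT (ltW u0).
  by rewrite -(Vint_ext _ E) Vint_shift ?(ltW h0) ?(ltW u0).
have -> : h^-1 *: (Vint (orb g) (h + u) - Vint (orb g) u) - h^-1 *: Vint (orb g) h -
    u *: (h^-1 *: (T h g - g)) =
    h^-1 *: ((Vint (orb g) (h + u) - Vint (orb g) h - u *: T h g) -
             (Vint (orb g) u - u *: g)).
  by rewrite !(scalerBr, scalerA) [u * _]mulrC; zmod.
rewrite normrZ gtr0_norm ?invr_gt0 // ler_pdivrMl //.
apply: le_trans (ler_normB _ _) _; apply: le_trans (lerD H1 H2) _.
by apply: le_of_eq; field.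
Unshelve. all: by end_near. Qed.

Variable w mu0 : R.
Hypothesis Tle : forall (s : R) g, 0 <= s -> `|T s g| <= expR (w * s) * `|g|.
Hypothesis wmu : w < mu0.
Let kap := mu0 - w.
Let kap0 : 0 < kap. Proof. by rewrite subr_gt0. Qed.

(** Real and imaginary parts of [e ^ (- (mu0 + i nu) s)] have this bound,
    which makes weighted orbits integrable. *)
Definition weight phi :=
  continuous phi /\ forall s : R, 0 <= s -> `|phi s| <= expR (- (mu0 * s)).

Definition laplace phi g : C0 R :=
  mkC0 (fun x => \int[mu]_(s in `]0, +oo[) (phi s * T s g x)).

Lemma weighted_orbit_le phi g x s : weight phi -> 0 < s ->
  `|phi s * T s g x| <= `|g| * expR (- (kap * s)).
Proof.
move=> [_ Hphi] s0; rewrite normrM.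
apply: le_trans (ler_pM _ _ (Hphi s (ltW s0)) (le_trans (C0_ler _ _) (Tle _ (ltW s0)))) _ => //.
rewrite mulrA -expRD [leRHS]mulrC; apply: le_of_eq; congr (expR _ * _).
by rewrite /kap; ring.
Qed.

Lemma weighted_orbit_measurable phi g x : weight phi ->
  measurable_fun (`]0, +oo[%classic : set R) (fun s => phi s * T s g x).
Proof.
move=> [cphi _].
have cW : {within `]0, +oo[%classic, continuous (fun s : R => phi s * T s g x : R)}.
  apply: (@continuous_subspaceW R R _ `[0, +oo[%classic).
    by apply: subset_itvr; rewrite bnd_simp.
  exact: (@cont_pos_within _ _ x (orbit_cont_pos g cphi)).
by apply: subspace_continuous_measurable_fun => //; exact: cW.
Qed.

Lemma laplace_tail phi g x (N : R) : weight phi -> 0 <= N ->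
  `|\int[mu]_(s in `]0, +oo[) (phi s * T s g x) - vint (fun s => phi s *: T s g) N x|
    <= `|g| * (expR (- (kap * N)) / kap).
Proof.
move=> wphi N0; have mf := weighted_orbit_measurable g x wphi.
have H s : 0 < s -> `|phi s * T s g x| <= `|g| * expR (- (kap * s)).
  exact: weighted_orbit_le.
have i0 := dom_integrable kap0 mf H.
rewrite /vint -Rintegral_itv_obnd_cbnd; last first.
  by apply: integrableS i0 => //; apply: subset_itvl; rewrite bnd_simp.
by rewrite Rintegral_itvB ?bnd_simp //; exact: dom_tail.
Qed.

Lemma exp_cvg0 (C : R) : C * (expR (- (kap * N)) / kap) @[N --> +oo] --> (0 : R).
Proof.
rewrite -(mulr0 C); apply: cvgM; first exact: cvg_cst.
rewrite -(mul0r kap^-1); apply: cvgM; last exact: cvg_cst.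
apply: (cvg_comp (fun s : R => kap * s) (fun y : R => expR (- y))); last exact: cvgr_expR.
have -> : (fun s : R => kap * s) = (fun s : R => s * kap) by apply/funext => s; rewrite mulrC.
by apply/gt0_cvgMly => //; exact: cvg_id.
Qed.

Lemma laplaceE phi g x : weight phi ->
  laplace phi g x = \int[mu]_(s in `]0, +oo[) (phi s * T s g x).
Proof.
move=> wphi; rewrite /laplace mkC0E //; apply: C0_unif_closed => e e0.
have /cvgrPdist_le/(_ _ e0) H := exp_cvg0 `|g|.
near (+oo : set_system R) => N; exists (Vint (fun s => phi s *: T s g) N) => y.
have N0 : 0 <= N by near: N; exact: nbhs_pinfty_ge.
rewrite VintE //; last by apply: orbit_cont_pos; case: wphi.
apply: le_trans (laplace_tail g y wphi N0) _.
have : `|0 - `|g| * (expR (- (kap * N)) / kap)| <= e by near: N; exact: H.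
by rewrite sub0r normrN; apply: le_trans; exact: ler_norm.
Unshelve. all: by end_near. Qed.

Lemma laplace_approx phi g (N : R) : weight phi -> 0 <= N ->
  `|laplace phi g - Vint (fun s => phi s *: T s g) N| <= `|g| * (expR (- (kap * N)) / kap).
Proof.
move=> wphi N0; apply: C0_norm_ler => x; rewrite C0_subE laplaceE // VintE //.
  exact: laplace_tail.
by apply: orbit_cont_pos; case: wphi.
Qed.

Lemma laplace_le phi g : weight phi -> `|laplace phi g| <= kap^-1 * `|g|.
Proof.
move=> wphi; have := laplace_approx g wphi (lexx 0).
rewrite Vint0 ?subr0; last by apply: orbit_cont_pos; case: wphi.
by rewrite mulr0 oppr0 expR0 div1r mulrC.
Qed.

Lemma laplace_cvg phi g : weight phi ->
  Vint (fun s => phi s *: T s g) N @[N --> +oo] --> laplace phi g.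
Proof.
move=> wphi; apply/cvgrPdist_le => e e0.
have /cvgrPdist_le/(_ _ e0) H := exp_cvg0 `|g|.
near=> N; have N0 : 0 <= N by near: N; exact: nbhs_pinfty_ge.
apply: le_trans (laplace_approx g wphi N0) _.
have : `|0 - `|g| * (expR (- (kap * N)) / kap)| <= e by near: N; exact: H.
by rewrite sub0r normrN; apply: le_trans; exact: ler_norm.
Unshelve. all: by end_near. Qed.

Lemma laplace_comb phi (k : R) g1 g2 : weight phi ->
  laplace phi (k *: g1 + g2) = k *: laplace phi g1 + laplace phi g2.
Proof.
move=> wphi; apply: C0_ext => x; rewrite C0_addE C0_scaleE !laplaceE //.
have i g := dom_integrable kap0 (weighted_orbit_measurable g x wphi)
  (fun s s0 => weighted_orbit_le g x wphi s0).
rewrite -RintegralZl // -RintegralD //; last by apply: (integrableZl _ k (i g1)).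
apply: eq_Rintegral => s _; rewrite linearD linearZ C0_addE C0_scaleE; ring.
Qed.

(** [T h] is continuous, commutes with the integrals over bounded intervals and
    with the other operators of the semigroup. *)
Lemma laplace_comm phi g h : weight phi -> 0 <= h ->
  T h (laplace phi g) = laplace phi (T h g).
Proof.
move=> wphi h0; have [cT _ TD _] := hT; have [cphi _] := wphi.
have c g' := orbit_cont_pos g' cphi.
have H1 : T h (Vint (fun s => phi s *: T s g) N) @[N --> +oo] --> T h (laplace phi g).
  apply: continuous_cvg; first exact: cT.
  exact: laplace_cvg.
have H2 := laplace_cvg (g := T h g) wphi.
apply: (cvg_unique _ H1) => //; apply: cvg_trans H2; apply: near_eq_cvg.
near=> N; have N0 : 0 <= N by near: N; exact: nbhs_pinfty_ge.
have E s : 0 <= s -> phi s *: T s (T h g) = T h (phi s *: T s g).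
  by move=> s0; rewrite linearZ /= -!TD // addrC.
rewrite Vint_comm //; first exact: (Vint_ext _ E).
- exact: cT.
- exact: cont_pos_ext E (c _).
Unshelve. all: by end_near. Qed.

Variable nu : R.
Definition cosw (s : R) := expR (- (mu0 * s)) * cos (nu * s).
Definition sinw (s : R) := expR (- (mu0 * s)) * sin (nu * s).

Lemma continuous_expRM (k : R) : continuous (fun s : R => expR (- (k * s))).
Proof.
move=> s; apply: (continuous_comp (f := fun s : R => - (k * s))); last exact: continuous_expR.
by apply: cvgN; apply: cvgM; [exact: cvg_cst|exact: cvg_id].
Qed.

Lemma weight_cosw : weight cosw.
Proof.
split=> [s|s s0].
  apply: cvgM; first exact: continuous_expRM.
  apply: (continuous_comp (f := fun s : R => nu * s)); last exact: continuous_cos.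
  by apply: cvgM; [exact: cvg_cst|exact: cvg_id].
rewrite normrM ger0_norm ?expR_ge0 // ler_piMr ?expR_ge0 //.
by rewrite ler_norml cos_geN1 cos_le1.
Qed.

Lemma weight_sinw : weight sinw.
Proof.
split=> [s|s s0].
  apply: cvgM; first exact: continuous_expRM.
  apply: (continuous_comp (f := fun s : R => nu * s)); last exact: continuous_sin.
  by apply: cvgM; [exact: cvg_cst|exact: cvg_id].
rewrite normrM ger0_norm ?expR_ge0 // ler_piMr ?expR_ge0 //.
by rewrite ler_norml sin_geN1 sin_le1.
Qed.

Local Notation Fc g := (fun s => cosw s *: T s g).
Local Notation Fs g := (fun s => sinw s *: T s g).
Let ca (h : R) := expR (mu0 * h) * cos (nu * h).
Let sa (h : R) := expR (mu0 * h) * sin (nu * h).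

Lemma expR_cancel (h s : R) : expR (mu0 * h) * expR (- (mu0 * (s + h))) = expR (- (mu0 * s)).
Proof. by rewrite -expRD; congr expR; ring. Qed.

(** The addition formulas express the weight at [s] through both weights at
    [s + h]; hence [T h] acts on the pair of transforms as a rotation and
    dilation, up to the missing integral over [[0, h]]. *)
Lemma cosw_shift h s : cosw s = ca h * cosw (s + h) + sa h * sinw (s + h).
Proof.
rewrite /cosw /sinw /ca /sa -(expR_cancel h s).
have {1}-> : nu * s = nu * (s + h) - nu * h by ring.
rewrite cosB; ring.
Qed.

Lemma sinw_shift h s : sinw s = ca h * sinw (s + h) - sa h * cosw (s + h).
Proof.
rewrite /cosw /sinw /ca /sa -(expR_cancel h s).
have {1}-> : nu * s = nu * (s + h) - nu * h by ring.
rewrite sinB; ring.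
Qed.

(** A weight that satisfies a shift relation yields the action of [T h] on its
    transform: [T h] advances the orbit by [h], and the part of the integral over
    [[0, h]] is lost. *)
Lemma laplace_shift_gen phi psi (k1 k2 : R) g h : weight phi -> weight psi -> 0 <= h ->
  (forall s, phi s = k1 * phi (s + h) + k2 * psi (s + h)) ->
  T h (laplace phi g) =
    k1 *: (laplace phi g - Vint (fun s => phi s *: T s g) h) +
    k2 *: (laplace psi g - Vint (fun s => psi s *: T s g) h).
Proof.
move=> wphi wpsi h0 E; have [cT _ TD _] := hT.
have c1 := orbit_cont_pos g wphi.1; have c2 := orbit_cont_pos g wpsi.1.
have H1 : T h (Vint (fun s => phi s *: T s g) N) @[N --> +oo] --> T h (laplace phi g).
  apply: continuous_cvg; first exact: cT.
  exact: laplace_cvg.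
have shift f l : f N @[N --> +oo] --> (l : C0 R) -> f (N + h) @[N --> +oo] --> l.
  move=> fl; apply: (cvg_comp (fun N : R => N + h) f _ fl).
  apply/cvgryPge => A; near=> N; rewrite -lerBlDr; near: N.
  by apply: nbhs_pinfty_ge; exact: num_real.
have H2 : k1 *: (Vint (fun s => phi s *: T s g) (N + h) - Vint (fun s => phi s *: T s g) h) +
    k2 *: (Vint (fun s => psi s *: T s g) (N + h) - Vint (fun s => psi s *: T s g) h)
    @[N --> +oo] --> k1 *: (laplace phi g - Vint (fun s => phi s *: T s g) h) +
    k2 *: (laplace psi g - Vint (fun s => psi s *: T s g) h).
  apply: cvgD; apply: cvgZr; (apply: cvgB; last exact: cvg_cst).
  - by apply: shift; exact: laplace_cvg.
  - by apply: shift; exact: laplace_cvg.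
apply: (cvg_unique _ H1) => //; apply: cvg_trans H2; apply: near_eq_cvg.
near=> N; have N0 : 0 <= N by near: N; exact: nbhs_pinfty_ge.
have Es s : 0 <= s -> k1 *: (phi (s + h) *: T (s + h) g) + k2 *: (psi (s + h) *: T (s + h) g)
   = T h (phi s *: T s g).
  move=> s0; rewrite [T h _]linearZ /= -!TD // [h + s]addrC !scalerA -scalerDl; congr (_ *: _).
  by rewrite -E.
have c1' := cont_pos_shift c1 h0; have c2' := cont_pos_shift c2 h0.
have c12 := cont_pos_comb k1 k2 c1' c2'.
rewrite Vint_comm //; last 2 first.
- exact: cT.
- exact: cont_pos_ext Es c12.
have V1 := Vint_shift c1 N0 h0; have V2 := Vint_shift c2 N0 h0.
have V3 := Vint_comb k1 k2 c1' c2' N0; have V4 := Vint_ext N Es.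
by rewrite -V4 V3 V1 V2.
Unshelve. all: by end_near. Qed.

Lemma Vint_near0 phi g : weight phi -> forall e : R, 0 < e ->
  \forall h \near (0 : R)^'+, `|Vint (fun s => phi s *: T s g) h - h *: (phi 0 *: g)| <= e * h.
Proof.
move=> wphi e e0; have [_ T0 _ _] := hT; have c := orbit_cont_pos g wphi.1.
have := Vint_diff c (lexx 0) e0; apply: filterS => h.
by rewrite add0r Vint0 // subr0 T0.
Qed.

Lemma ca_near0 (e : R) : 0 < e -> \forall h \near (0 : R)^'+, `|ca h - 1 - h * mu0| <= e * h.
Proof.
have D : is_derive (0 : R) 1 ca mu0.
  rewrite /ca; apply: is_derive_eq.
  by rewrite !mulr0 expR0 cos0 sin0 /GRing.scale /=; ring.
have ca0 : ca 0 = 1 by rewrite /ca !mulr0 expR0 cos0 mulr1.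
by move=> /(is_derive_near0 D); rewrite ca0.
Qed.

Lemma sa_near0 (e : R) : 0 < e -> \forall h \near (0 : R)^'+, `|sa h - h * nu| <= e * h.
Proof.
have D : is_derive (0 : R) 1 sa nu.
  rewrite /sa; apply: is_derive_eq.
  by rewrite !mulr0 expR0 cos0 sin0 /GRing.scale /=; ring.
have sa0 : sa 0 = 0 by rewrite /sa !mulr0 sin0 mulr0.
by move=> /(is_derive_near0 D); under eq_near do rewrite sa0 subr0.
Qed.

(** Together with [laplace_sin_generator] this is [A R g = (mu0 + i nu) R g - g]
    for [R = L_cos - i L_sin], separated into real and imaginary parts. *)
Lemma laplace_cos_generator g : generator T
  (laplace cosw g, mu0 *: laplace cosw g + nu *: laplace sinw g - g).
Proof.
apply/generatorP => e e0.
have := near0_combine (laplace cosw g) (laplace sinw g) ca_near0 sa_near0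
  (Vint_near0 g weight_cosw) (Vint_near0 g weight_sinw) e0.
have -> : cosw 0 *: g = g by rewrite /cosw !mulr0 oppr0 expR0 cos0 mulr1 scale1r.
move=> H; near=> h; have h0 : 0 <= h by near: h; exact: nbhs_right_ge.
rewrite (laplace_shift_gen g weight_cosw weight_sinw h0 (cosw_shift h)).
by near: h.
Unshelve. all: by end_near. Qed.

Lemma laplace_sin_generator g : generator T
  (laplace sinw g, mu0 *: laplace sinw g - nu *: laplace cosw g).
Proof.
apply/generatorP => e e0.
have sa' (r : R) : 0 < r -> \forall h \near (0 : R)^'+, `|- sa h - h * - nu| <= r * h.
  by move=> /sa_near0; apply: filterS => h; rewrite mulrN -opprD normrN.
have := near0_combine (laplace sinw g) (laplace cosw g) ca_near0 sa'
  (Vint_near0 g weight_sinw) (Vint_near0 g weight_cosw) e0.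
have -> : sinw 0 *: g = 0 by rewrite /sinw !mulr0 sin0 mulr0 scale0r.
rewrite subr0 scaleNr.
move=> H; near=> h; have h0 : 0 <= h by near: h; exact: nbhs_right_ge.
have E s : sinw s = ca h * sinw (s + h) + - sa h * cosw (s + h).
  by rewrite mulNr; exact: sinw_shift.
rewrite (laplace_shift_gen g weight_sinw weight_cosw h0 E).
by near: h.
Unshelve. all: by end_near. Qed.

(** [T h] commutes with the transform, which is bounded, so the transform maps the
    graph of the generator into itself. *)
Lemma laplace_generator phi f k : weight phi -> generator T (f, k) ->
  generator T (laplace phi f, laplace phi k).
Proof.
move=> wphi /generatorP Gfk; apply/generatorP => e e0.
have e1 : 0 < e * kap by rewrite mulr_gt0.
have := Gfk _ e1; apply: filter_app; near=> h => H.
have h0 : 0 <= h by near: h; exact: nbhs_right_ge.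
rewrite laplace_comm //.
have -> : laplace phi (T h f) - laplace phi f - h *: laplace phi k =
    laplace phi (T h f - f - h *: k).
  have -> : T h f - f - h *: k = (- h) *: k + ((-1) *: f + T h f).
    by rewrite scaleNr scaleN1r; zmod.
  by rewrite !laplace_comb // scaleNr scaleN1r; zmod.
apply: le_trans (laplace_le _ wphi) _; rewrite ler_pdivrMl //.
by apply: le_trans H _; apply: le_of_eq; ring.
Unshelve. all: by end_near. Qed.

End semigroup_integral.

(** * Chernoff approximation of a semigroup *)

(** Multiplication by [e ^ (- l h)] subtracts [l] from the derivative at 0. *)
Lemma rescale_near (R : realType) (X : normedModType R) (Phi : R -> X) (f k : X) (l : R) :
  (forall e : R, 0 < e -> \forall h \near (0 : R)^'+, `|Phi h - f - h *: k| <= e * h) ->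
  forall e : R, 0 < e ->
  \forall h \near (0 : R)^'+, `|expR (- (l * h)) *: Phi h - f - h *: (k - l *: f)| <= e * h.
Proof.
move=> H e e0.
have Ha (r : R) : 0 < r -> \forall h \near (0 : R)^'+, `|expR (- (l * h)) - 1 - h * (- l)| <= r * h.
  have D : is_derive (0 : R) 1 (fun h : R => expR (- (l * h))) (- l).
    by apply: is_derive_eq; rewrite mulr0 oppr0 expR0 /GRing.scale /=; ring.
  by move=> /(is_derive_near0 D); rewrite mulr0 oppr0 expR0.
have Hb (r : R) : 0 < r -> \forall h \near (0 : R)^'+, `|0 - h * 0| <= r * h.
  move=> r0; near=> h; rewrite mulr0 subrr normr0; apply: mulr_ge0; first exact: ltW.
  by near: h; exact: nbhs_right_ge.
have HV (r : R) : 0 < r -> \forall h \near (0 : R)^'+, `|(f - Phi h) - h *: (- k)| <= r * h.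
  move=> /H; apply: filterS => h; rewrite -normrN; apply: le_trans.
  by apply: le_of_eq; congr `| _ |; rewrite scalerN; zmod.
have H0 (r : R) : 0 < r -> \forall h \near (0 : R)^'+, `|0 - h *: (0 : X)| <= r * h.
  move=> r0; near=> h; rewrite scaler0 subrr normr0; apply: mulr_ge0; first exact: ltW.
  by near: h; exact: nbhs_right_ge.
have := near0_combine f 0 Ha Hb HV H0 e0; apply: filterS => h.
apply: le_trans; apply: le_of_eq; congr `| _ |.
by rewrite scale0r scaler0 scaleNr subKr; congr (_ - _); [zmod|congr (_ *: _); zmod].
Unshelve. all: by end_near. Qed.

Section laplace_linear.
Context {R : realType}.
Variables (T : R -> {linear C0 R -> C0 R}) (w mu0 : R) (phi : R -> R).
Hypothesis hT : C0_semigroup T.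
Hypothesis Tle : forall (s : R) g, 0 <= s -> `|T s g| <= expR (w * s) * `|g|.
Hypothesis wmu : w < mu0.
Hypothesis wphi : weight mu0 phi.

Fact laplace_linear : linear (laplace T phi).
Proof. by move=> k f g; rewrite (laplace_comb hT Tle wmu). Qed.

Definition laplace_lin : {linear C0 R -> C0 R} :=
  HB.pack (laplace T phi)
    (GRing.isLinear.Build R (C0 R) (C0 R) *:%R (laplace T phi) laplace_linear).

Lemma laplace_linE f : laplace_lin f = laplace T phi f.
Proof. by []. Qed.

End laplace_linear.

Section semigroup_convergence.
Context {R : realType}.
Variables (T S : R -> {linear C0 R -> C0 R}) (D : set (C0 R * C0 R)) (w0 w : R).
Hypothesis hT : C0_semigroup T.
Hypothesis w00 : 0 <= w0.
Hypothesis w0w : w0 < w.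
Hypothesis Sle : forall (h : R) f, 0 <= h -> `|S h f| <= expR (w0 * h) * `|f|.
Hypothesis Sgen : forall f k, D (f, k) -> forall e : R, 0 < e ->
  \forall h \near (0 : R)^'+, `|S h f - f - h *: k| <= e * h.
Hypothesis TD : generator T = closure D.

(** Since [w0 < w], the two strict inequalities that [semigroup_growth] consumes can
    be placed at [w0 < (w0 + w) / 2 < w]. *)
Lemma growth (t : R) f : 0 <= t -> `|T t f| <= expR (w * t) * `|f|.
Proof.
have h1 : 0 <= w0 < (w0 + w) / 2 by apply/andP; split; [|exact: (midf_lt w0w).1].
apply: (semigroup_growth hT h1 Sle Sgen TD); first exact: (midf_lt w0w).2.
exact: generator_dense.
Qed.

Lemma generator_functional f k1 k2 : generator T (f, k1) -> generator T (f, k2) -> k1 = k2.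
Proof. by rewrite /generator /= => H1 H2; exact: (cvg_unique _ H1 H2). Qed.

Variable l : R.
Hypothesis wl : w < l.

Local Notation Rl := (laplace T (cosw l 0)).
Let wc : weight l (cosw l 0). Proof. exact: weight_cosw. Qed.

Let RL : {linear C0 R -> C0 R} := laplace_lin hT growth wl wc.

Lemma Rl_generator f : generator T (Rl f, l *: Rl f - f).
Proof.
have := @laplace_cos_generator R T hT w l growth wl 0 f.
by rewrite scale0r addr0.
Qed.

Let RLE f : RL f = Rl f. Proof. exact: laplace_linE. Qed.

Let RLZ k f : Rl (k *: f) = k *: Rl f. Proof. by rewrite -!RLE linearZZ. Qed.

Definition rescaled (V : R -> {linear C0 R -> C0 R}) (s : R) : {linear C0 R -> C0 R} :=
  (expR (- (l * s)) \*: V s)%R.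

Lemma rescaledE V s f : rescaled V s f = expR (- (l * s)) *: V s f.
Proof. by []. Qed.

Lemma rescaled_le (V : R -> {linear C0 R -> C0 R}) : (forall (h : R) f, 0 <= h -> `|V h f| <= expR (w * h) * `|f|) ->
  forall (s : R) f, 0 <= s -> `|rescaled V s f| <= expR (- ((l - w) * s)) * `|f|.
Proof.
move=> HV s f s0; rewrite rescaledE normrZ ger0_norm ?expR_ge0 //.
apply: le_trans (ler_wpM2l (expR_ge0 _) (HV s f s0)) _.
by rewrite mulrA -expRD; apply: le_of_eq; congr (expR _ * _); ring.
Qed.

Lemma Sle' (h : R) f : 0 <= h -> `|S h f| <= expR (w * h) * `|f|.
Proof.
move=> h0; apply: le_trans (Sle f h0) _; rewrite ler_wpM2r // ler_expR ler_wpM2r //.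
exact: ltW.
Qed.

Lemma iter_rescaled (V : R -> {linear C0 R -> C0 R}) n h f :
  iter n (rescaled V h) f = expR (- (l * (n%:R * h))) *: iter n (V h) f.
Proof.
elim: n => [|n ih]; first by rewrite mul0r mulr0 oppr0 expR0 scale1r.
rewrite !iterS ih rescaledE [V h _]linearZ /= scalerA -expRD; congr (expR _ *: _).
by rewrite -natr1; ring.
Qed.

(** [Rl] is the resolvent of [T] at [l], that is, minus the inverse of the generator
    of the rescaled semigroup; the generator is the closure of [D], which supplies
    the core, and is densely defined, which supplies the density of the range. *)
Lemma rescaled_chernoff f (e : R) : 0 < e ->
  \forall h \near (0 : R)^'+, forall n,
    `|iter n (rescaled S h) f - rescaled T (n%:R * h) f| <= e.
Proof.
have d0 : 0 < l - w by rewrite subr_gt0.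
have [cT T0 TDD _] := hT.
pose D' := [set p : C0 R * C0 R | D (p.1, p.2 + l *: p.1)].
apply: (@chernoff R (C0 R) (rescaled T) (rescaled S) (l - w) d0 _ _ _ _ _ D' RL (l - w)^-1).
- by move=> g; rewrite rescaledE mulr0 oppr0 expR0 scale1r T0.
- move=> s t g s0 t0; rewrite !rescaledE [T s _]linearZ /= scalerA TDD // -expRD.
  by congr (expR _ *: _); ring.
- move=> g r r0; have c1 : continuous (fun s : R => expR (- (l * s))) by exact: continuous_expRM.
  have [d dd0 Hd] := orbit_cont_pos hT g c1 (lexx 0) r0.
  exists (d / 2); first by rewrite divr_gt0.
  move=> s /andP[s0 sd]; have := Hd s s0.
  rewrite subr0 ger0_norm // mulr0 oppr0 expR0 scale1r T0; apply.
  by apply: le_lt_trans sd _; rewrite ltr_pdivrMr // ltr_pMr // ltr1n.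
- exact: rescaled_le growth.
- exact: rescaled_le Sle'.
- move=> g k Dgk r r0; have := rescale_near l (Sgen Dgk) r0.
  by apply: filterS => h; rewrite addrK.
- by move=> g; rewrite RLE; exact: (laplace_le hT growth wl g wc).
- move=> s g s0; rewrite !RLE !rescaledE.
  rewrite RLZ; congr (_ *: _).
  by apply/esym; exact: (laplace_comm hT growth wl g wc s0).
- move=> g r r0; have /generatorP G := @Rl_generator g.
  have := rescale_near l G r0; apply: filterS => h; rewrite RLE rescaledE.
  apply: le_trans; apply: le_of_eq; congr `| _ |.
  have -> : l *: Rl g - g - l *: Rl g = - g by zmod.
  by rewrite scalerN opprK.
- move=> g r r0; have q0 : 0 < 1 + `|l| by rewrite ltr_pwDl.
  have r1 : 0 < r / (1 + `|l|) by rewrite divr_gt0.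
  have := @Rl_generator g; rewrite TD => cl.
  have [[p k] [/= Dpk [/= B1 B2]]] : D `&` ball (Rl g, l *: Rl g - g) (r / (1 + `|l|)) !=set0.
    by apply: cl; exact: nbhsx_ballx.
  have {}B1 : `|Rl g - p| <= r / (1 + `|l|) by apply: ltW; move: B1; rewrite -ball_normE.
  have {}B2 : `|l *: Rl g - g - k| <= r / (1 + `|l|) by apply: ltW; move: B2; rewrite -ball_normE.
  have rle : r / (1 + `|l|) <= r.
    by rewrite ler_pdivrMr // ler_peMr ?(ltW r0) // lerDl.
  exists p, (k - l *: p); split.
  + by rewrite /D' /= subrK.
  + exact: le_trans B1 rle.
  + have -> : g + (k - l *: p) = l *: (Rl g - p) - (l *: Rl g - g - k).
      by rewrite scalerBr; zmod.
    apply: le_trans (ler_normB _ _) _; rewrite normrZ.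
    apply: le_trans (lerD (ler_wpM2l (normr_ge0 _) B1) B2) _.
    by apply: le_of_eq; field; rewrite lt0r_neq0.
- move=> g r r0; have [p [k [Gpk gp]]] := generator_dense hT g r0.
  exists (l *: p - k); rewrite RLE.
  have E : Rl k = l *: Rl p - p.
    by apply: generator_functional (@Rl_generator p); exact: (laplace_generator hT growth wl wc Gpk).
  have -> : Rl (l *: p - k) = p.
    have -> : Rl (l *: p - k) = l *: Rl p - Rl k by rewrite -!RLE linearB linearZ.
    by rewrite E; zmod.
  exact: gp.
Qed.

(** If [t / n] is below the threshold of [rescaled_chernoff] then this lemma
    applies. Otherwise [t >= n d], and both terms are small by themselves because
    the rescaled families decay. *)
Theorem chernoff_semigroup f (e : R) : 0 < e -> exists N : nat, forall n (t : R),
  (N <= n)%N -> (0 < n)%N -> 0 < t ->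
  `|iter n (S (t / n%:R)) f - T t f| <= e * expR (l * t).
Proof.
move=> e0; have d0 : 0 < l - w by rewrite subr_gt0.
have := rescaled_chernoff f e0; rewrite near_withinE => /nbhs_ballP[d /= dd0 Hd].
pose M := `|f| + `|f|.
have M1 : 0 < M + 1 by rewrite ltr_wpDl // addr_ge0.
have r01 : 0 <= expR (- ((l - w) * d)) < 1.
  by rewrite expR_ge0 expR_lt1 oppr_lt0 mulr_gt0.
have [N HN] := exists_expn_le r01 (divr_gt0 e0 M1).
exists N => n t Nn n0 t0; have nn : 0 < (n%:R : R) by rewrite ltr0n.
have nt : n%:R * (t / n%:R) = t by rewrite mulrC divfK // lt0r_neq0.
have main : `|iter n (rescaled S (t / n%:R)) f - rescaled T t f| <= e.
  have [td|td] := ltP (t / n%:R) d; last first.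
    have le1 V : (forall (s : R) g, 0 <= s -> `|rescaled V s g| <= expR (- ((l - w) * s)) * `|g|) ->
        `|iter n (rescaled V (t / n%:R)) f| <= expR (- ((l - w) * t)) * `|f|.
      move=> HV; have h0 : 0 <= t / n%:R by rewrite divr_ge0 // ltW.
      have := iter_contract n f (expR_ge0 _) (fun g => HV _ g h0).
      by rewrite -expRM_natl mulrN mulrCA nt.
    have H1 := le1 S (rescaled_le Sle'); have H2 := rescaled_le growth f (ltW t0).
    apply: le_trans (ler_normB _ _) _; apply: le_trans (lerD H1 H2) _.
    rewrite -mulrDr -/M.
    have H3 : expR (- ((l - w) * t)) <= e / (M + 1).
      apply: le_trans HN; rewrite -expRM_natl ler_expR mulrN lerN2 mulrCA ler_pM2l //.
      rewrite -nt; apply: ler_pM => //; rewrite ?ler_nat //; exact: ltW.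
    apply: (@le_trans _ _ (e / (M + 1) * (M + 1))); last by rewrite divfK // lt0r_neq0.
    by apply: ler_pM => //; rewrite ?expR_ge0 ?addr_ge0 // lerDl.
  have h0 : 0 < t / n%:R by rewrite divr_gt0.
  have := Hd (t / n%:R) _ h0 n; rewrite nt; apply.
  by rewrite /ball /= sub0r normrN gtr0_norm.
rewrite iter_rescaled nt rescaledE -scalerBr normrZ ger0_norm ?expR_ge0 // in main.
have := ler_wpM2r (expR_ge0 (l * t)) main.
by rewrite mulrAC [expR (- _) * _]mulrC expRxMexpNx_1 mul1r.
Qed.

End semigroup_convergence.

(** * Uniform continuity and Gaussian moments *)

Lemma segment_unif_continuous (R : realType) (f : R -> R) (a b e : R) :
  continuous f -> 0 < e -> exists2 d : R, 0 < d &
    forall y z : R, a <= y <= b -> a <= z <= b -> `|y - z| < d -> `|f y - f z| <= e.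
Proof.
move=> cf e0.
suff H (t : R) : 0 <= t -> exists2 d : R, 0 < d & forall y z : R,
    a <= y <= a + t -> a <= z <= a + t -> `|y - z| < d -> `|f y - f z| <= e.
  have [ab|ba] := leP a b.
    by have := H (b - a); rewrite subr_ge0 subrKC; apply.
  by exists 1 => // y z /andP[ay yb]; have := le_trans ay yb; rewrite leNgt ba.
have loc (c : R) : exists2 r : R, 0 < r & forall y z : R, `|c - y| < r -> `|c - z| < r ->
    `|f y - f z| <= e.
  have /cvgrPdist_le/(_ (e / 2) (divr_gt0 e0 (ltr0Sn _ _)))/nbhs_ballP[r /= r0 Hr] := cf c.
  exists r => // y z cy cz; rewrite -(subrKA (f c)) [leRHS]splitr.
  apply: le_trans (ler_normD _ _) _; rewrite lerD //; last exact: Hr.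
  by rewrite distrC; exact: Hr.
(* a uniform modulus on [a, s] extends past s by the local modulus at a + u *)
have ext (s u v r : R) : u - r / 2 <= s -> v <= u + r / 2 -> 0 < r ->
    (forall y z : R, `|a + u - y| < r -> `|a + u - z| < r -> `|f y - f z| <= e) ->
    (exists2 d : R, 0 < d & forall y z : R,
       a <= y <= a + s -> a <= z <= a + s -> `|y - z| < d -> `|f y - f z| <= e) ->
    exists2 d : R, 0 < d & forall y z : R,
       a <= y <= a + v -> a <= z <= a + v -> `|y - z| < d -> `|f y - f z| <= e.
  move=> us vu r0 Hr [d d0 Hd]; exists (Num.min d (r / 2)).
    by rewrite lt_min d0 divr_gt0.
  suff W y z : y <= z -> a <= y -> z <= a + v -> z - y < Num.min d (r / 2) -> `|f y - f z| <= e.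
    move=> y z /andP[ay yv] /andP[az zv].
    have [yz|zy] := leP y z.
      by rewrite distrC ger0_norm ?subr_ge0 // => ?; exact: W.
    by rewrite ger0_norm ?subr_ge0 ?(ltW zy) // distrC => ?; apply: W => //; exact: ltW.
  move=> yz ay zv; rewrite lt_min => /andP[yzd yzr].
  have [zs|sz] := leP z (a + s).
    apply: Hd; rewrite ?ay ?zs ?(le_trans ay yz) ?(le_trans yz zs) //.
    by rewrite distrC ger0_norm ?subr_ge0.
  by apply: Hr; rewrite ltr_norml; apply/andP; split; lra.
move: t; apply: (real_induction (P := fun t => exists2 d : R, 0 < d & forall y z : R,
    a <= y <= a + t -> a <= z <= a + t -> `|y - z| < d -> `|f y - f z| <= e)).
- exists 1 => // y z; rewrite addr0 => /le_anti -> /le_anti ->.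
  by move=> _; rewrite subrr normr0 ltW.
- move=> t t0 Pt; have [r r0 Hr] := loc (a + t).
  near=> h; apply: (ext t t _ r) => //; first by rewrite gerBl ltW // divr_gt0.
  rewrite lerD2l; near: h; apply: nbhs_right_le; exact: divr_gt0.
- move=> t t0 H; have [r r0 Hr] := loc (a + t).
  apply: (ext (Num.max 0 (t - r / 2)) t t r) => //.
  + by rewrite le_max lexx orbT.
  + by rewrite lerDl ltW // divr_gt0.
  + by apply: H; rewrite le_max lexx gt_max t0 gtrBl divr_gt0.
Unshelve. all: by end_near. Qed.

Section C0_modulus.
Context {R : realType}.
Implicit Types f : C0 R.

Lemma C0_small_outside f (e : R) : 0 < e ->
  exists2 N : R, 0 < N & forall y : R, N < `|y| -> `|f y| <= e.
Proof.
move=> e0; have /C0_predP[_ /cvgrPdist_le/(_ _ e0) [A [Ar HA]] /cvgrPdist_le/(_ _ e0) [B [Br HB]]] := C0_funP f.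
exists (`|A| + `|B| + 1); first by rewrite ltr_wpDl // addr_ge0.
move=> y yN; have [y0|y0] := leP 0 y.
  have := HA y; rewrite sub0r normrN; apply; move: yN; rewrite (ger0_norm y0).
  by have := ler_norm A; have := normr_ge0 B; lra.
have := HB y; rewrite sub0r normrN; apply; move: yN; rewrite (ltr0_norm y0).
by have := ler_norm (- B); rewrite normrN; have := normr_ge0 A; lra.
Qed.

Lemma C0_unif_continuous f (e : R) : 0 < e -> exists2 d : R, 0 < d &
  forall y z : R, `|y - z| < d -> `|f y - f z| <= e.
Proof.
move=> e0; have e2 : 0 < e / 2 by rewrite divr_gt0.
have [N N0 HN] := C0_small_outside f e2.
have [d d0 Hd] := segment_unif_continuous (- (N + 1)) (N + 1) (@C0_continuous R f) e0.
exists (Num.min d 1); first by rewrite lt_min d0 ltr01.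
move=> y z; rewrite lt_min => /andP[yzd yz1].
have [yN|yN] := leP `|y| N.
  apply: Hd => //.
    by move: yN; rewrite ler_norml => /andP[? ?]; apply/andP; split; lra.
  move: yN yz1; rewrite ler_norml ltr_norml => /andP[? ?] /andP[? ?].
  by apply/andP; split; lra.
have [zN|zN] := leP `|z| N.
  apply: Hd => //; last first.
    by move: zN; rewrite ler_norml => /andP[? ?]; apply/andP; split; lra.
  move: zN yz1; rewrite ler_norml ltr_norml => /andP[? ?] /andP[? ?].
  by apply/andP; split; lra.
by apply: le_trans (ler_normB _ _) _; rewrite [leRHS]splitr lerD ?HN.
Qed.

(** The quadratic form of uniform continuity: it can be integrated against a
    normal law, where only second moments enter. *)
Lemma C0_modulus f (e : R) : 0 < e -> exists2 K : R, 0 <= K &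
  forall y z : R, `|f y - f z| <= e + K * (y - z) ^+ 2.
Proof.
move=> e0; have [d d0 Hd] := C0_unif_continuous f e0.
exists ((`|f| + `|f|) / d ^+ 2); first by rewrite divr_ge0 ?addr_ge0 ?sqr_ge0.
move=> y z; have [/Hd H|dyz] := ltP `|y - z| d.
  apply: le_trans H _; rewrite lerDl mulr_ge0 ?sqr_ge0 //.
  by rewrite divr_ge0 ?addr_ge0 ?sqr_ge0.
apply: (@le_trans _ _ (`|f| + `|f|)).
  by apply: le_trans (ler_normB _ _) _; rewrite lerD ?C0_ler.
apply: (@le_trans _ _ ((`|f| + `|f|) / d ^+ 2 * (y - z) ^+ 2)); last by rewrite lerDr ltW.
rewrite -mulrA ler_peMr ?addr_ge0 // mulrC ler_pdivlMr ?exprn_gt0 // mul1r.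
by rewrite -[(y - z) ^+ 2]ger0_norm ?sqr_ge0 // normrX ler_pXn2r // nnegrE ltW.
Qed.

End C0_modulus.

Section gaussian.
Context {R : realType}.
Local Notation mu := (@lebesgue_measure R).
Implicit Types (phi psi : R -> R).

Definition std_pdf (z : R) : R := normal_pdf 0 1 z.
Definition std_mean phi : R := \int[mu]_z (phi z * std_pdf z).

Lemma std_pdfE z : std_pdf z = normal_peak 1 * expR (- (z ^+ 2 / 2)).
Proof.
rewrite /std_pdf normal_pdfE ?oner_neq0 // /normal_fun subr0 expr1n.
by congr (_ * expR _); rewrite mulNr.
Qed.

Lemma std_pdf_ge0 z : 0 <= std_pdf z. Proof. exact: normal_pdf_ge0. Qed.

Lemma std_pdf_continuous : continuous std_pdf.
Proof. by apply: continuous_normal_pdf; exact: oner_neq0. Qed.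

Lemma std_mean1 : std_mean (fun=> 1) = 1.
Proof.
rewrite /std_mean /Rintegral; under eq_integral do rewrite mul1r.
by rewrite integral_normal_pdf.
Qed.

Let s2 : R := Num.sqrt 2.
Let s2_neq0 : s2 != 0. Proof. by rewrite sqrtr_eq0 -ltNge. Qed.

(** The factor [e ^ (- z^2 / 4)] absorbs [z ^ 4] and leaves a normal density of
    variance 2. *)
Lemma quartic_std_pdf_le (z : R) : z ^+ 4 * std_pdf z <=
  32 * normal_peak 1 / normal_peak s2 * normal_pdf 0 s2 z.
Proof.
have p2 := normal_peak_gt0 s2_neq0.
rewrite std_pdfE normal_pdfE // mulrA divfK ?lt0r_neq0 //.
have -> : normal_fun 0 s2 z = expR (- (z ^+ 2 / 4)).
  rewrite /normal_fun subr0 sqr_sqrtr // mulNr; congr (expR (- (_ / _))).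
  by rewrite -mulr_natl; ring.
have -> : expR (- (z ^+ 2 / 2)) = expR (- (z ^+ 2 / 4)) * expR (- (z ^+ 2 / 4)).
  by rewrite -expRD; congr expR; field.
have key : z ^+ 4 * expR (- (z ^+ 2 / 4)) <= 32.
  have H := @expR_ge1Dxn R (z ^+ 2 / 4) 1 ltac:(by rewrite divr_ge0 ?sqr_ge0).
  have H2 : z ^+ 4 <= 32 * expR (z ^+ 2 / 4).
    have E : 32 * (1 + (z ^+ 2 / 4) ^+ 2 / 2) = z ^+ 4 + 32 by field.
    apply: (@le_trans _ _ (32 * (1 + (z ^+ 2 / 4) ^+ 2 / 2))); first by rewrite E lerDl.
    by rewrite ler_pM2l.
  have := ler_wpM2r (expR_ge0 (- (z ^+ 2 / 4))) H2.
  by rewrite -[32 * _ * _]mulrA expRxMexpNx_1 mulr1.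
set E := expR _ in key *.
have -> : z ^+ 4 * (normal_peak 1 * (E * E)) = (normal_peak 1 * E) * (z ^+ 4 * E) by ring.
have -> : 32 * normal_peak 1 * E = (normal_peak 1 * E) * 32 by ring.
by rewrite ler_wpM2l // mulr_ge0 ?normal_peak_ge0 ?expR_ge0.
Qed.

Lemma quartic_integrable : mu.-integrable setT (EFin \o (fun z => z ^+ 4 * std_pdf z)).
Proof.
have i1 : mu.-integrable setT (EFin \o (fun z : R =>
    32 * normal_peak 1 / normal_peak s2 * normal_pdf 0 s2 z)).
  by apply: (integrableZl _ _ (integrable_normal_pdf 0 s2)).
apply: le_integrable i1 => //.
  apply/measurable_EFinP; apply: continuous_measurable_fun => z.
  by apply: cvgM; [exact: exprn_continuous|exact: std_pdf_continuous].
move=> z _ /=; rewrite lee_fin ger0_norm; last first.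
  by rewrite mulr_ge0 ?std_pdf_ge0 // exprn_even_ge0.
by apply: le_trans (quartic_std_pdf_le z) _; exact: ler_norm.
Qed.

Lemma std_mean_integrable phi (A B : R) : measurable_fun setT phi ->
  (forall z, `|phi z| <= A + B * z ^+ 4) ->
  mu.-integrable setT (EFin \o (fun z => phi z * std_pdf z)).
Proof.
move=> mphi H.
have i1 : mu.-integrable setT (EFin \o (fun z : R => A * std_pdf z)).
  by apply: (integrableZl _ A (integrable_normal_pdf 0 1)).
have i2 : mu.-integrable setT (EFin \o (fun z : R => B * (z ^+ 4 * std_pdf z))).
  by apply: (integrableZl _ B quartic_integrable).
have i3 := integrableD _ i1 i2.
apply: le_integrable (i3 _) => //.
  apply/measurable_EFinP/measurable_funM => //.
  exact: continuous_measurable_fun std_pdf_continuous.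
move=> z _ /=; rewrite lee_fin normrM (ger0_norm (std_pdf_ge0 z)).
rewrite mulrA -mulrDl; apply: le_trans (ler_norm _).
by rewrite ler_wpM2r ?std_pdf_ge0.
Qed.

Lemma std_mean_comb phi psi (k A B A' B' : R) : measurable_fun setT phi -> measurable_fun setT psi ->
  (forall z, `|phi z| <= A + B * z ^+ 4) -> (forall z, `|psi z| <= A' + B' * z ^+ 4) ->
  std_mean (fun z => k * phi z + psi z) = k * std_mean phi + std_mean psi.
Proof.
move=> m1 m2 H1 H2; have i1 := std_mean_integrable m1 H1; have i2 := std_mean_integrable m2 H2.
rewrite /std_mean -RintegralZl // -RintegralD //; last by apply: (integrableZl _ k i1).
by apply: eq_Rintegral => z _; ring.
Qed.

(** Fundamental theorem of calculus over [[-n, n]] and dominated convergence. It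
    gives the Gaussian moments from [std_pdf' = - z std_pdf]. *)
Lemma Rintegral_derive_eq0 (F f : R -> R) : (forall x : R, is_derive x 1 F (f x)) ->
  continuous f -> mu.-integrable setT (EFin \o f) ->
  (F n%:R - F (- n%:R)) @[n --> \oo] --> (0 : R) -> \int[mu]_z f z = 0.
Proof.
move=> dF cf intf F0; have mf : measurable_fun setT f by exact: continuous_measurable_fun.
pose I (n : nat) : set R := `[- n%:R, n%:R]%classic.
pose f_ (n : nat) (x : R) : \bar R := (f \_ (I n) x)%:E.
have mI n : measurable (I n) by exact: measurable_itv.
have [] := @dominated_convergence _ _ R mu setT measurableT f_ (EFin \o f) (abse \o (EFin \o f)).
- move=> n; apply/measurable_EFinP; apply/(measurable_restrictT f (mI n)).
  exact: measurable_funTS.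
- exact/measurable_EFinP.
- apply: aeW => x _; apply: cvg_near_cst; near=> n; rewrite /f_ patchE mem_set //.
  rewrite /I /= in_itv /= -ler_norml; near: n; exists (Num.trunc `|x|).+1 => // n /= Hn.
  apply: le_trans (ltW (truncnS_gt _)) _; rewrite ler_nat //.
- exact: integrable_abse.
- apply: aeW => x n _; rewrite /f_ /= patchE; case: ifPn => // _.
  by rewrite lee_fin normr0.
move=> _ _; have E n : (\int[mu]_(x in setT) f_ n x)%E = (F n%:R - F (- n%:R))%:E.
  have -> : (\int[mu]_(x in setT) f_ n x = \int[mu]_(x in I n) (f x)%:E)%E.
    rewrite [RHS]integral_mkcond; apply: eq_integral => x _.
    by rewrite /f_ !patchE; case: ifP.
  case: n => [|n].
    by rewrite /I oppr0 set_itv1 integral_set1 subrr.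
  rewrite /I (@continuous_FTC2 R f F) -?EFinB //.
  - by rewrite gtrN // ltr0n.
  - exact: continuous_subspaceT.
  - have cF : continuous F.
      by move=> x; apply/differentiable_continuous/derivable1_diffP; have [] := dF x.
    split; first by move=> x _; have [] := dF x.
      by apply: cvg_at_right_filter; exact: cF.
    by apply: cvg_at_left_filter; exact: cF.
  - by move=> x _; rewrite derive1E; apply: derive_val.
move=> H; have {}H : ((F n%:R - F (- n%:R))%:E @[n --> \oo] --> (\int[mu]_z (f z)%:E)%E)%classic.
  by apply: cvg_trans H; apply: near_eq_cvg; near=> n; rewrite /= E.
have H0 : ((F n%:R - F (- n%:R))%:E @[n --> \oo] --> (0 : R)%:E)%classic.
  by apply: cvg_EFin => //; apply: nearW.
by rewrite /Rintegral (cvg_unique _ H H0).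
Unshelve. all: by end_near. Qed.

Lemma std_pdf_even z : std_pdf (- z) = std_pdf z.
Proof. by rewrite !std_pdfE sqrrN. Qed.

Lemma is_derive_std_pdf (z : R) : is_derive z 1 std_pdf (- (z * std_pdf z)).
Proof.
have -> : std_pdf = (fun z => normal_peak 1 * expR (- (z ^+ 2 / 2))).
  by apply/funext => y; rewrite std_pdfE.
by apply: is_derive_eq; rewrite /GRing.scale /=; field.
Qed.

Lemma pow_le_quartic (z : R) : `|z| <= 1 + 1 * z ^+ 4 /\ z ^+ 2 <= 1 + 1 * z ^+ 4.
Proof.
have H : z ^+ 2 <= 1 + 1 * z ^+ 4.
  have -> : 1 + 1 * z ^+ 4 = z ^+ 2 + (3 / 4 + (z ^+ 2 - 1 / 2) ^+ 2) by field.
  by rewrite lerDl addr_ge0 ?sqr_ge0 // divr_ge0.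
split=> //; have [z1|z1] := leP `|z| 1.
  by apply: le_trans z1 _; rewrite lerDl mul1r exprn_even_ge0.
apply: le_trans H; rewrite -[z ^+ 2]ger0_norm ?sqr_ge0 // normrX expr2.
by rewrite ler_peMr // ltW.
Qed.

Lemma std_mean_id : std_mean id = 0.
Proof.
have i1 : mu.-integrable setT (EFin \o (fun z : R => z * std_pdf z)).
  apply: (@std_mean_integrable id 1 1) => // z; exact: (pow_le_quartic z).1.
have := @Rintegral_derive_eq0 (fun z => - std_pdf z) (fun z => z * std_pdf z); apply => //.
- by move=> x; have := is_derive_std_pdf x => dg; apply: is_derive_eq; rewrite opprK.
- by move=> z; apply: cvgM; [exact: cvg_id|exact: std_pdf_continuous].
- by under eq_cvg do rewrite std_pdf_even subrr; exact: cvg_cst.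
Qed.

Lemma sqr_std_pdf_integrable : mu.-integrable setT (EFin \o (fun z : R => z ^+ 2 * std_pdf z)).
Proof.
apply: (@std_mean_integrable (fun z => z ^+ 2) 1 1) => [|z].
  by apply: continuous_measurable_fun; exact: exprn_continuous.
by rewrite ger0_norm ?sqr_ge0 //; exact: (pow_le_quartic z).2.
Qed.

Lemma std_mean_sqr : std_mean (fun z => z ^+ 2) = 1.
Proof.
have i0 : mu.-integrable setT (EFin \o std_pdf) := integrable_normal_pdf 0 (1 : R).
have i2 := sqr_std_pdf_integrable.
have H : \int[mu]_z (z ^+ 2 * std_pdf z - std_pdf z) = 0.
  apply: (@Rintegral_derive_eq0 (fun z => - (z * std_pdf z)) (fun z => z ^+ 2 * std_pdf z - std_pdf z)).
  - move=> x; have := is_derive_std_pdf x => dg; apply: is_derive_eq.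
    by rewrite /GRing.scale /=; ring.
  - move=> z; apply: cvgB; last exact: std_pdf_continuous.
    by apply: cvgM; [exact: exprn_continuous|exact: std_pdf_continuous].
  - by apply: (integrableB _ i2 i0).
  - apply/cvgr0Pnorm_le => e e0; near=> n.
    have En : - (n%:R * std_pdf n%:R) - - (- n%:R * std_pdf (- n%:R)) = - (2 * (n%:R * std_pdf n%:R)) :> R.
      by rewrite std_pdf_even; ring.
    rewrite En normrN ger0_norm ?mulr_ge0 ?std_pdf_ge0 //.
    pose C : R := 8 * normal_peak 1.
    have C0 : 0 < C by rewrite mulr_gt0 // normal_peak_gt0 // oner_neq0.
    have n0 : C / e <= n%:R.
      near: n; exists (Num.trunc (C / e)).+1 => // m /= Hm.
      by apply: le_trans (ltW (truncnS_gt _)) _; rewrite ler_nat.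
    have n1 : 0 < (n%:R : R) by apply: lt_le_trans n0; rewrite divr_gt0.
    have K1 : (n%:R : R) ^+ 2 * std_pdf n%:R <= C / 2.
      rewrite std_pdfE mulrCA /C; have E := expR_ge1Dx ((n%:R : R) ^+ 2 / 2).
      have E2 : (n%:R : R) ^+ 2 <= 4 * expR (n%:R ^+ 2 / 2).
        have := sqr_ge0 (n%:R : R); lra.
      have := ler_wpM2r (expR_ge0 (- ((n%:R : R) ^+ 2 / 2))) E2.
      rewrite -[4 * _ * _]mulrA expRxMexpNx_1 mulr1 => E3.
      have -> : 8 * normal_peak 1 / 2 = normal_peak 1 * 4 :> R by field.
      by rewrite ler_wpM2l // normal_peak_ge0.
    rewrite -(ler_pM2l n1); apply: (@le_trans _ _ C).
      have -> : n%:R * (2 * (n%:R * std_pdf n%:R)) = 2 * (n%:R ^+ 2 * std_pdf n%:R) :> R by ring.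
      lra.
    by rewrite -ler_pdivrMr.
have E : \int[mu]_z (z ^+ 2 * std_pdf z) = \int[mu]_z std_pdf z.
  by move: H; rewrite RintegralB // => /eqP; rewrite subr_eq0 => /eqP.
by rewrite {1}/std_mean E -[RHS]std_mean1 /std_mean; apply: eq_Rintegral => z _; rewrite mul1r.
Unshelve. all: by end_near. Qed.

(** The fourth moment enters the error terms only, hence as an abstract constant. *)
Definition std_mean4 : R := std_mean (fun z => z ^+ 4).

Lemma std_mean4_ge0 : 0 <= std_mean4.
Proof.
by apply: Rintegral_ge0 => z _; rewrite mulr_ge0 ?std_pdf_ge0 // exprn_even_ge0.
Qed.

Lemma std_mean_poly (c0 c1 c2 c4 : R) :
  std_mean (fun z => c0 + c1 * z + c2 * z ^+ 2 + c4 * z ^+ 4) = c0 + c2 + c4 * std_mean4.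
Proof.
have i0 := integrable_normal_pdf 0 (1 : R); have i2 := sqr_std_pdf_integrable.
have i4 := quartic_integrable.
have i1 : mu.-integrable setT (EFin \o (fun z : R => z * std_pdf z)).
  apply: (@std_mean_integrable id 1 1) => // z; exact: (pow_le_quartic z).1.
have j0 : mu.-integrable setT (EFin \o (fun z : R => c0 * std_pdf z)) by apply: (integrableZl _ c0 i0).
have j1 : mu.-integrable setT (EFin \o (fun z : R => c1 * (z * std_pdf z))) by apply: (integrableZl _ c1 i1).
have j2 : mu.-integrable setT (EFin \o (fun z : R => c2 * (z ^+ 2 * std_pdf z))) by apply: (integrableZl _ c2 i2).
have j4 : mu.-integrable setT (EFin \o (fun z : R => c4 * (z ^+ 4 * std_pdf z))) by apply: (integrableZl _ c4 i4).
have j01 : mu.-integrable setT (EFin \o (fun z : R => c0 * std_pdf z + c1 * (z * std_pdf z))).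
  by apply: (integrableD _ j0 j1).
have j02 : mu.-integrable setT (EFin \o (fun z : R => c0 * std_pdf z + c1 * (z * std_pdf z) + c2 * (z ^+ 2 * std_pdf z))).
  by apply: (integrableD _ j01 j2).
have -> : std_mean (fun z => c0 + c1 * z + c2 * z ^+ 2 + c4 * z ^+ 4) =
  \int[mu]_z (c0 * std_pdf z + c1 * (z * std_pdf z) + c2 * (z ^+ 2 * std_pdf z) + c4 * (z ^+ 4 * std_pdf z)).
  by apply: eq_Rintegral => z _; ring.
rewrite RintegralD // RintegralD // RintegralD // !RintegralZl //.
have -> : \int[mu]_z std_pdf z = 1.
  by rewrite -[RHS]std_mean1 /std_mean; apply: eq_Rintegral => z _; rewrite mul1r.
have -> : \int[mu]_z (z * std_pdf z) = 0 by exact: std_mean_id.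
have -> : \int[mu]_z (z ^+ 2 * std_pdf z) = 1 by exact: std_mean_sqr.
by rewrite /std_mean4 /std_mean; ring.
Qed.

(** A Gaussian average is estimated by a polynomial majorant, whose average is
    known. *)
Lemma std_mean_bound phi (c0 c2 c4 : R) : measurable_fun setT phi ->
  (forall z, `|phi z| <= c0 + c2 * z ^+ 2 + c4 * z ^+ 4) ->
  `|std_mean phi| <= c0 + c2 + c4 * std_mean4.
Proof.
move=> mphi H; have mp : measurable_fun setT (fun z : R => c0 + 0 * z + c2 * z ^+ 2 + c4 * z ^+ 4).
  have mX n : measurable_fun setT (fun z : R => z ^+ n).
    by apply: continuous_measurable_fun; exact: exprn_continuous.
  apply: measurable_funD; last by apply: measurable_funM; [exact: measurable_cst|exact: mX].
  apply: measurable_funD; last by apply: measurable_funM; [exact: measurable_cst|exact: mX].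
  by apply: measurable_funD; [exact: measurable_cst|apply: measurable_funM].
have B2 (z : R) : `|c0 + 0 * z + c2 * z ^+ 2 + c4 * z ^+ 4| <=
    (`|c0| + `|c2|) + (`|c2| + `|c4|) * z ^+ 4.
  have := (pow_le_quartic z).2; rewrite mul0r addr0 mul1r => H2.
  have z4 : 0 <= z ^+ 4 by rewrite exprn_even_ge0.
  apply: le_trans (ler_normD _ _) _; apply: le_trans (lerD (ler_normD _ _) (lexx _)) _.
  have -> : `|c2 * z ^+ 2| = `|c2| * z ^+ 2 by rewrite normrM (ger0_norm (sqr_ge0 z)).
  have -> : `|c4 * z ^+ 4| = `|c4| * z ^+ 4 by rewrite normrM (ger0_norm z4).
  have := ler_wpM2l (normr_ge0 c2) H2; lra.
have B1 z : `|phi z| <= (`|c0| + `|c2|) + (`|c2| + `|c4|) * z ^+ 4.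
  by apply: le_trans (B2 z); apply: le_trans (H z) _; rewrite mul0r addr0 ler_norm.
have i1 := std_mean_integrable mphi B1; have ip := std_mean_integrable mp B2.
rewrite /std_mean -(std_mean_poly c0 0 c2 c4); apply: le_trans (le_normr_Rintegral _ i1) _ => //.
apply: le_Rintegral => //.
  exact: integrable_norm i1.
move=> z _; rewrite normrM (ger0_norm (std_pdf_ge0 z)) ler_wpM2r ?std_pdf_ge0 //.
by rewrite mul0r addr0.
Qed.

End gaussian.

(** * Gaussian averages of functions vanishing at infinity *)

Section gaussian_average.
Context {R : realType}.
Local Notation mu := (@lebesgue_measure R).
Implicit Types (f g : C0 R) (m s x z : R).

Lemma continuous_affine m s : continuous (fun z : R => m + s * z).
Proof.
by move=> z; apply: cvgD; [exact: cvg_cst|apply: cvgM; [exact: cvg_cst|exact: cvg_id]].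
Qed.

Lemma normal_pdf_affine m s z : 0 < s -> normal_pdf m s (m + s * z) * s = std_pdf z.
Proof.
move=> s0; have sn : s != 0 by rewrite lt0r_neq0.
rewrite std_pdfE normal_pdfE // /normal_fun [m + _]addrC addrK.
have -> : - (s * z) ^+ 2 / (s ^+ 2 *+ 2) = - (z ^+ 2 / 2).
  by rewrite -mulr_natl; field.
rewrite mulrAC; congr (_ * _); rewrite /normal_peak expr1n mul1r -mulrnAr.
rewrite sqrtrM ?sqr_ge0 // sqrtr_sqr gtr0_norm // invfM mulrAC mulVf ?mul1r //.
Qed.

(** Affine substitution in the integrals of the nonnegative functions [f + M] and
    [M], whose difference is [f]. *)
Lemma normal_mean (f : R -> R) m s (M : R) : 0 < s -> continuous f ->
  (forall y, `|f y| <= M) ->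
  mu.-integrable setT (EFin \o (fun y => normal_pdf m s y * f y)) /\
  \int[mu]_y (normal_pdf m s y * f y) = std_mean (fun z => f (m + s * z)).
Proof.
move=> s0 cf fM; have sn : s != 0 by rewrite lt0r_neq0.
have M0 : 0 <= M by apply: le_trans (fM 0); exact: normr_ge0.
have cn : continuous (normal_pdf m s) by exact: continuous_normal_pdf.
have iN : mu.-integrable setT (EFin \o normal_pdf m s) := integrable_normal_pdf m s.
have iM : mu.-integrable setT (EFin \o (fun y => M * normal_pdf m s y)).
  by apply: (integrableZl _ M iN).
have i1 : mu.-integrable setT (EFin \o (fun y => normal_pdf m s y * f y)).
  apply: le_integrable iM => //.
    by apply/measurable_EFinP; apply: continuous_measurable_fun => y; apply: cvgM; [exact: cn|exact: cf].
  move=> y _ /=; rewrite lee_fin !normrM mulrC (ger0_norm M0).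
  by rewrite ler_wpM2r.
split=> //.
pose F z := m + s * z; pose G y := normal_pdf m s y * f y + M * normal_pdf m s y.
have dF (z : R) : is_derive z 1 F s.
  by rewrite /F; apply: is_derive_eq; rewrite /GRing.scale /=; ring.
have F'E : F^`()%classic = cst s.
  by apply/funext => z; rewrite derive1E; apply: derive_val.
have G0 y : 0 <= G y.
  rewrite /G [M * _]mulrC -mulrDr mulr_ge0 ?normal_pdf_ge0 //.
  by rewrite -lerBlDr sub0r; have := fM y; rewrite ler_norml => /andP[].
have cG : continuous G.
  move=> y; apply: cvgD; first by apply: cvgM; [exact: cn|exact: cf].
  by apply: cvgM; [exact: cvg_cst|exact: cn].
have := @increasing_ge0_integration_by_substitutionT R F G.
rewrite F'E => sub.
have {sub} E : (\int[mu]_x (G x)%:E = \int[mu]_x (((G \o F) * cst s)%R x)%:E)%E.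
  apply: sub => //.
  - by move=> x y xy; rewrite ltrD2l ltr_pM2l.
  - by move=> x; exact: cvg_cst.
  - exact: is_cvg_cst.
  - exact: is_cvg_cst.
  - apply/cvgrNyPle => A; near=> x; have H : x <= s^-1 * (A - m).
      by near: x; apply: nbhs_ninfty_le; exact: num_real.
    by move: H; rewrite /F -lerBrDl ler_pdivlMl.
  - apply/cvgryPge => A; near=> x; have H : s^-1 * (A - m) <= x.
      by near: x; apply: nbhs_pinfty_ge; exact: num_real.
    by move: H; rewrite /F -lerBlDl ler_pdivrMl.
have mf : measurable_fun setT (fun z => f (m + s * z)).
  apply: continuous_measurable_fun => z.
  apply: (continuous_comp (f := fun z : R => m + s * z)); last exact: cf.
  exact: continuous_affine.
have i2 : mu.-integrable setT (EFin \o (fun z => f (m + s * z) * std_pdf z)).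
  by apply: (@std_mean_integrable _ _ M 0) => // z; rewrite mul0r addr0.
have ig : mu.-integrable setT (EFin \o std_pdf) := integrable_normal_pdf 0 (1 : R).
have iMg : mu.-integrable setT (EFin \o (fun z => M * std_pdf z)) by apply: (integrableZl _ M ig).
have E2 : \int[mu]_y (normal_pdf m s y * f y + M * normal_pdf m s y) =
    \int[mu]_z (f (m + s * z) * std_pdf z + M * std_pdf z).
  apply: (congr1 fine); apply: (etrans E).
  apply: eq_integral => z _; congr EFin.
  have -> : ((G \o F) * cst s)%R z = G (F z) * s by [].
  by rewrite -(normal_pdf_affine m z s0) /G /F; ring.
have E3 : \int[mu]_y (M * normal_pdf m s y) = \int[mu]_z (M * std_pdf z).
  have J1 : \int[mu]_y normal_pdf m s y = 1 by rewrite /Rintegral integral_normal_pdf.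
  have J2 : \int[mu]_y std_pdf y = 1 by rewrite /Rintegral integral_normal_pdf.
  have Z1 := RintegralZl M measurableT iN; have Z2 := RintegralZl M measurableT ig.
  by rewrite Z1 Z2 J1 J2.
have D1 := RintegralD measurableT i1 iM; have D2 := RintegralD measurableT i2 iMg.
by move: E2; rewrite D1 D2 E3 => /addIr.
Unshelve. all: by end_near. Qed.

(** Coupling: the two averages are taken over the same normal variable, and
    [C0_modulus] turns the mean square distance into the bound. *)
Lemma std_mean_C0_modulus f (e : R) : 0 < e -> exists2 K : R, 0 <= K &
  forall m m' s s', `|std_mean (fun z => f (m + s * z)) - std_mean (fun z => f (m' + s' * z))|
    <= e + K * ((m - m') ^+ 2 + (s - s') ^+ 2).
Proof.
move=> e0; have [K K0 HK] := C0_modulus f e0.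
exists (2 * K); first by rewrite mulr_ge0.
move=> m m' s s'.
have mf p q : measurable_fun setT (fun z => f (p + q * z)).
  apply: continuous_measurable_fun => z.
  apply: (continuous_comp (f := fun z : R => p + q * z)); last exact: C0_continuous.
  exact: continuous_affine.
have bf p q z : `|f (p + q * z)| <= `|f| + 0 * z ^+ 4 by rewrite mul0r addr0 C0_ler.
have -> : std_mean (fun z => f (m + s * z)) - std_mean (fun z => f (m' + s' * z)) =
   std_mean (fun z => f (m + s * z) - f (m' + s' * z)).
  rewrite /std_mean -RintegralB //; last 2 first.
  - exact: std_mean_integrable (mf _ _) (bf _ _).
  - exact: std_mean_integrable (mf _ _) (bf _ _).
  by apply: eq_Rintegral => z _; rewrite mulrBl.
have -> : e + 2 * K * ((m - m') ^+ 2 + (s - s') ^+ 2) =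
  (e + 2 * K * (m - m') ^+ 2) + 2 * K * (s - s') ^+ 2 + 0 * std_mean4 by ring.
apply: std_mean_bound; first exact: measurable_funB.
move=> z; apply: le_trans (HK _ _) _; rewrite mul0r addr0 -[leRHS]addrA lerD2l.
have -> : m + s * z - (m' + s' * z) = (m - m') + (s - s') * z by ring.
have -> : 2 * K * (m - m') ^+ 2 + 2 * K * (s - s') ^+ 2 * z ^+ 2 =
  K * ((m - m') + (s - s') * z) ^+ 2 + K * ((m - m') - (s - s') * z) ^+ 2 by ring.
by rewrite lerDl mulr_ge0 // sqr_ge0.
Qed.

Lemma std_mean_C0_le f m s : `|std_mean (fun z => f (m + s * z))| <= `|f|.
Proof.
have -> : `|f| = `|f| + 0 + 0 * std_mean4 by ring.
apply: std_mean_bound.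
  apply: continuous_measurable_fun => z.
  apply: (continuous_comp (f := fun z : R => m + s * z)); last exact: C0_continuous.
  exact: continuous_affine.
by move=> z; rewrite !mul0r !addr0 C0_ler.
Qed.

(** Chebyshev's inequality: a law with mean [m] beyond [N + D] puts at most the mass
    [s ^ 2 / D ^ 2] on the region where [f] may be large. *)
Lemma std_mean_C0_tail f (N D : R) m s (e : R) : 0 <= e -> 0 < D ->
  (forall y : R, N < `|y| -> `|f y| <= e) -> N + D <= `|m| ->
  `|std_mean (fun z => f (m + s * z))| <= e + `|f| * (s ^+ 2 / D ^+ 2).
Proof.
move=> e0 D0 HN mD.
have -> : e + `|f| * (s ^+ 2 / D ^+ 2) = e + `|f| * (s ^+ 2 / D ^+ 2) + 0 * std_mean4 by ring.
apply: std_mean_bound.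
  apply: continuous_measurable_fun => z.
  apply: (continuous_comp (f := fun z : R => m + s * z)); last exact: C0_continuous.
  exact: continuous_affine.
move=> z; rewrite mul0r addr0.
have q0 : 0 <= `|f| * (s ^+ 2 / D ^+ 2) * z ^+ 2.
  by rewrite mulr_ge0 ?sqr_ge0 // mulr_ge0 // divr_ge0 ?sqr_ge0.
have [yN|yN] := ltP N `|m + s * z|.
  by apply: le_trans (HN _ yN) _; rewrite lerDl.
apply: le_trans (C0_ler _ _) _; rewrite -[leLHS]add0r lerD // -mulrA ler_peMr //.
rewrite mulrAC ler_pdivlMr ?exprn_gt0 // mul1r -exprMn.
rewrite -[(s * z) ^+ 2]ger0_norm ?sqr_ge0 // normrX ler_pXn2r ?nnegrE ?(ltW D0) //.
have H : `|m| <= `|m + s * z| + `|s * z|.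
  by rewrite -{1}[m](addrK (s * z)); exact: ler_normB.
lra.
Qed.

Lemma gaussian_average_C0 f (mn sd : R -> R) (A B : R) :
  continuous mn -> continuous sd -> (forall x, `|mn x - x| <= B) ->
  (forall x, (sd x) ^+ 2 <= A) ->
  ((fun x => std_mean (fun z => f (mn x + sd x * z))) : R -> R^o) \in @C0_pred R R.
Proof.
move=> cm cs HB HA.
have lim e : 0 < e -> exists2 L : R, 0 < L & forall x, L <= `|x| ->
    `|std_mean (fun z => f (mn x + sd x * z))| <= e.
  move=> e0; have e2 : 0 < e / 2 by rewrite divr_gt0.
  have [N N0 HN] := C0_small_outside f e2.
  have B0 : 0 <= B by apply: le_trans (HB 0); exact: normr_ge0.
  have A0 : 0 <= A by apply: le_trans (HA 0); exact: sqr_ge0.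
  pose Q := `|f| * A / (e / 2).
  have Q0 : 0 <= Q by rewrite divr_ge0 ?(ltW e2) // mulr_ge0.
  (* [D ^ 2 >= Q] makes the Chebyshev term at most [e / 2] *)
  pose D := 1 + Q; have D0 : 0 < D by rewrite ltr_pwDl.
  exists (N + D + B); first by rewrite ltr_wpDr // addr_gt0.
  move=> x xL; have mD : N + D <= `|mn x|.
    have : `|x| <= `|mn x| + `|mn x - x|.
      by rewrite -{1}[x](subKr (mn x)); exact: ler_normB.
    by have := HB x; lra.
  apply: le_trans (std_mean_C0_tail (sd x) (ltW e2) D0 HN mD) _.
  rewrite [leRHS]splitr lerD2l mulrA ler_pdivrMr ?exprn_gt0 //.
  apply: (@le_trans _ _ (`|f| * A)); first by rewrite ler_wpM2l.
  have : Q <= D ^+ 2.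
    have -> : D ^+ 2 = Q + (1 + Q + Q ^+ 2) by rewrite /D; ring.
    by rewrite lerDl !addr_ge0 ?sqr_ge0.
  by rewrite /Q ler_pdivrMr // [leRHS]mulrC.
apply/C0_predP; split.
- move=> x; apply/cvgrPdist_le => e e0.
  have e2 : 0 < e / 2 by rewrite divr_gt0.
  have [K K0 HK] := std_mean_C0_modulus f e2.
  have H : K * ((mn x - mn y) ^+ 2 + (sd x - sd y) ^+ 2) @[y --> x] --> (0 : R).
    have c2 (u : R -> R) : continuous u -> (u x - u y) ^+ 2 @[y --> x] --> (0 : R).
      move=> cu; rewrite (_ : 0 = (u x - u x) ^+ 2); last by rewrite subrr expr0n.
      apply: (cvg_comp (fun y => u x - u y) (fun y => y ^+ 2)); last exact: exprn_continuous.
      by apply: cvgB; [exact: cvg_cst|exact: cu].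
    rewrite -(mulr0 K); apply: cvgM; first exact: cvg_cst.
    have H := cvgD (c2 _ cm) (c2 _ cs); rewrite addr0 in H; exact: H.
  move/cvgrPdist_le : H => /(_ _ e2); apply: filterS => y.
  rewrite sub0r normrN => Hy; apply: le_trans (HK _ _ _ _) _.
  by rewrite [leRHS]splitr lerD2l; apply: le_trans Hy; exact: ler_norm.
- apply/cvgrPdist_le => e e0; have [L L0 HL] := lim e e0.
  near=> x; rewrite sub0r normrN; apply: HL.
  by apply: le_trans (ler_norm _); near: x; apply: nbhs_pinfty_ge; exact: num_real.
- apply/cvgrPdist_le => e e0; have [L L0 HL] := lim e e0.
  near=> x; rewrite sub0r normrN; apply: HL; rewrite -normrN.
  apply: le_trans (ler_norm _); rewrite lerNr.
  by near: x; apply: nbhs_ninfty_le; exact: num_real.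
Unshelve. all: by end_near. Qed.

Lemma C0_mul_bounded f (u : R -> R) (M : R) : continuous u -> (forall x, `|u x| <= M) ->
  ((fun x => u x * f x) : R -> R^o) \in @C0_pred R R.
Proof.
move=> cu uM; have /C0_predP[cf pf nf] := C0_funP f.
have M0 : 0 <= M by apply: le_trans (uM 0); exact: normr_ge0.
have M1 : 0 < M + 1 by rewrite ltr_wpDl.
have lim (F : set_system R) (FF : Filter F) : f x @[x --> F] --> (0 : R^o) ->
   ((u x * f x : R^o) @[x --> F] --> (0 : R^o)).
  move=> /cvgrPdist_le fF; apply/cvgrPdist_le => e e0.
  have := fF (e / (M + 1)) (divr_gt0 e0 M1); apply: filterS => x.
  rewrite !sub0r !normrN normrM => Hx.
  apply: (@le_trans _ _ ((M + 1) * (e / (M + 1)))); last by rewrite mulrC divfK // lt0r_neq0.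
  by apply: ler_pM => //; apply: le_trans (uM x) _; rewrite lerDl.
apply/C0_predP; split; [|exact: lim|exact: lim].
by move=> x; apply: cvgM; [exact: cu|exact: cf].
Qed.

End gaussian_average.

(** * The Gaussian family tangent to the differential operator *)

Section taylor.
Context {R : realType}.

Lemma mean_value_bound (g dg : R -> R) (x u M : R) : (forall y : R, is_derive y 1 g (dg y)) ->
  g x = 0 -> (forall y : R, `|y - x| <= `|u| -> `|dg y| <= M) -> `|g (x + u)| <= M * `|u|.
Proof.
move=> dG gx HM.
have cg : continuous g.
  by move=> y; apply/differentiable_continuous/derivable1_diffP; have [] := dG y.
have [u0|u0|->] := ltgtP u 0; last by rewrite addr0 gx !normr0 mulr0.
- have [|y /= ] := @MVT_segment R g dg (x + u) x _ (fun y _ => dG y) (continuous_subspaceT cg).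
    by rewrite gerDl ltW.
  rewrite in_itv /= gx sub0r => /andP[y1 y2] E.
  rewrite -normrN E opprD addrA subrr sub0r normrM normrN ler_wpM2r //.
  by apply: HM; rewrite ler0_norm ?subr_le0 // ltr0_norm //; lra.
- have [|y /= ] := @MVT_segment R g dg x (x + u) _ (fun y _ => dG y) (continuous_subspaceT cg).
    by rewrite lerDl ltW.
  rewrite in_itv /= gx subr0 => /andP[y1 y2] E.
  rewrite E [x + u]addrC addrK normrM ler_wpM2r //.
  by apply: HM; rewrite ger0_norm ?subr_ge0 // gtr0_norm //; lra.
Qed.

(** Two applications of [mean_value_bound]. The modulus of [f2] is quadratic, so that
    the remainder is a polynomial in [u] and can be averaged. *)
Lemma taylor2_bound (f f1 f2 : R -> R) (x u e K : R) : 0 <= K ->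
  (forall y : R, is_derive y 1 f (f1 y)) -> (forall y : R, is_derive y 1 f1 (f2 y)) ->
  (forall y : R, `|f2 y - f2 x| <= e + K * (y - x) ^+ 2) ->
  `|f (x + u) - f x - u * f1 x - u ^+ 2 / 2 * f2 x| <= e * u ^+ 2 + K * u ^+ 4.
Proof.
move=> K0 d1 d2 H.
have B1 v : `|v| <= `|u| -> `|f1 (x + v) - f1 x - v * f2 x| <= (e + K * u ^+ 2) * `|v|.
  move=> vu; pose g y := f1 y - f1 x - (y - x) * f2 x.
  have -> : f1 (x + v) - f1 x - v * f2 x = g (x + v) by rewrite /g [x + v]addrC addrK.
  apply: (@mean_value_bound g (fun y => f2 y - f2 x)).
  - move=> y; have dy := d2 y; rewrite /g; apply: is_derive_eq.
    by rewrite /GRing.scale /=; ring.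
  - by rewrite /g !subrr mul0r subr0.
  - move=> y yv; apply: le_trans (H y) _; rewrite lerD2l ler_wpM2l //.
    rewrite -[leLHS]ger0_norm ?sqr_ge0 // -[leRHS]ger0_norm ?sqr_ge0 // !normrX.
    by rewrite ler_pXn2r ?nnegrE // (le_trans yv).
pose g y := f y - f x - (y - x) * f1 x - (y - x) ^+ 2 / 2 * f2 x.
have -> : f (x + u) - f x - u * f1 x - u ^+ 2 / 2 * f2 x = g (x + u).
  by rewrite /g; have -> : x + u - x = u by ring.
have -> : e * u ^+ 2 + K * u ^+ 4 = ((e + K * u ^+ 2) * `|u|) * `|u|.
  rewrite -mulrA -normrM -expr2 ger0_norm ?sqr_ge0 //; ring.
apply: (@mean_value_bound g (fun y => f1 y - f1 x - (y - x) * f2 x)).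
- move=> y; have dy := d1 y; rewrite /g; apply: is_derive_eq.
  by rewrite /GRing.scale /=; field.
- by rewrite /g !subrr mul0r expr0n /= mul0r mul0r !subr0.
- move=> y yu; have := B1 (y - x) yu; rewrite subrKC => /le_trans; apply.
  rewrite ler_wpM2l //; have := H x; rewrite !subrr expr0n /= mulr0 addr0 normr0 => e0.
  by rewrite addr_ge0 // mulr_ge0 // sqr_ge0.
Qed.

Lemma derive1_eq0_outside (f : R -> R) (N : R) : (forall x, N < `|x| -> f x = 0) ->
  forall x, N < `|x| -> derive1 f x = 0.
Proof.
move=> H x Nx; rewrite derive1E.
have E : \forall y \near x, f y = (cst 0 : R -> R) y.
  have /cvgrPdist_lt/(_ (`|x| - N)) : (fun y : R => `|y|) @ x --> `|x| by exact: norm_continuous.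
  rewrite subr_gt0 => /(_ Nx); apply: filterS => y Hy; apply: H.
  by move: Hy; rewrite ltr_norml => /andP[_]; lra.
by rewrite (near_eq_derive _ E) ?derive_cst.
Qed.

Lemma C2c_derive2_C0 (f : R -> R) : C2c f -> exists F2 : C0 R, forall x, F2 x = derive1 (derive1 f) x.
Proof.
move=> [d1 d2 c2 cf].
have [N HN] : exists N : R, forall x, N < `|x| -> f x = 0.
  have [M [Mr HM]] := compact_bounded cf; exists (M + 1) => x Mx.
  apply: contrapT => fx; have := HM (M + 1) ltac:(by rewrite ltrDl) x.
  have xin : closure [set x | f x != 0] x by apply: subset_closure; apply/eqP.
  by move=> /(_ xin) /=; rewrite leNgt Mx.
have H2 := derive1_eq0_outside (derive1_eq0_outside HN).
have Hc : (derive1 (derive1 f) : R -> R^o) \in @C0_pred R R.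
  apply/C0_predP; split; first exact: c2.
  - apply: cvg_near_cst; near=> x; apply: H2; apply: lt_le_trans (ler_norm _).
    by near: x; apply: nbhs_pinfty_gt; exact: num_real.
  - apply: cvg_near_cst; near=> x; apply: H2; rewrite -normrN; apply: lt_le_trans (ler_norm _).
    by rewrite ltrNr; near: x; apply: nbhs_ninfty_lt; exact: num_real.
by exists (mkC0 (derive1 (derive1 f))) => x; rewrite mkC0E.
Unshelve. all: by end_near. Qed.

Lemma expR_taylor_le (u : R) : `|u| <= 1 / 2 ->
  `|expR u - 1 - u| <= 2 * u ^+ 2 /\ `|expR u - 1| <= 2 * `|u|.
Proof.
move=> u2; have [ul uu] : - (1 / 2) <= u /\ u <= 1 / 2 by move: u2; rewrite ler_norml => /andP[].
have H1 := expR_ge1Dx u.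
have H2 : expR u * (1 - u) <= 1.
  rewrite -[leRHS](expRxMexpNx_1 u) ler_wpM2l ?expR_ge0 //; exact: expR_ge1Dx.
have K1 : `|expR u - 1 - u| <= 2 * u ^+ 2.
  rewrite ger0_norm; last by lra.
  have p : 0 < 1 - u by lra.
  rewrite -(ler_pM2r p); have : 0 <= u ^+ 2 * (1 - 2 * u).
    by rewrite mulr_ge0 ?sqr_ge0 //; lra.
  lra.
split=> //; rewrite -[expR u - 1](subrK u).
apply: le_trans (ler_normD _ _) _; apply: le_trans (lerD K1 (lexx _)) _.
have -> : u ^+ 2 = `|u| * `|u| by rewrite -normrM -expr2 ger0_norm ?sqr_ge0.
have := normr_ge0 u; have : `|u| * `|u| <= `|u| * (1 / 2) by rewrite ler_wpM2l.
lra.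
Qed.

End taylor.

Section chernoff_function.
Context {R : realType}.
Variables (a b c : R -> R) (A B C w : R).
Hypotheses (a_gt0 : forall x, 0 < a x) (ca : continuous a) (cb : continuous b) (cc : continuous c).
Hypotheses (aA : forall x, a x <= A) (bB : forall x, `|b x| <= B).
Hypotheses (cC : forall x, `|c x| <= C) (cw : forall x, c x <= w).
Implicit Types (f : C0 R) (x h : R).

Definition drift h x := x + b x * h.
Definition deviation h x := Num.sqrt (2 * a x * h).

(** With [Z] standard normal, [drift h x + deviation h x * Z] is one step of the
    Euler scheme for the diffusion with generator [a f'' + b f']. *)
Definition chernoff_fun h f x : R :=
  expR (h * c x) * std_mean (fun z => f (drift h x + deviation h x * z)).

Let A0 : 0 < A. Proof. exact: lt_le_trans (a_gt0 0) (aA 0). Qed.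
Let B0 : 0 <= B. Proof. exact: le_trans (normr_ge0 _) (bB 0). Qed.
Let C_ge0 : 0 <= C. Proof. exact: le_trans (normr_ge0 _) (cC 0). Qed.

Lemma deviation_sqr h x : 0 <= h -> deviation h x ^+ 2 = 2 * a x * h.
Proof. by move=> h0; rewrite sqr_sqrtr // !mulr_ge0 // ltW. Qed.

Lemma chernoff_fun_C0 h f : (chernoff_fun h f : R -> R^o) \in @C0_pred R R.
Proof.
have cdr : continuous (drift h).
  move=> x; apply: cvgD; first exact: cvg_id.
  by apply: cvgM; [exact: cb|exact: cvg_cst].
have cde : continuous (deviation h).
  move=> x; apply: (cvg_comp (fun x => 2 * a x * h) Num.sqrt); last exact: sqrt_continuous.
  by apply: cvgM; last exact: cvg_cst; apply: cvgM; [exact: cvg_cst|exact: ca].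
have H1 x : `|drift h x - x| <= B * `|h|.
  by rewrite /drift [x + _]addrC addrK normrM ler_wpM2r.
have H2 x : deviation h x ^+ 2 <= 2 * A * `|h|.
  have [h0|h0] := leP 0 h.
    by rewrite deviation_sqr // ger0_norm // ler_wpM2r // ler_wpM2l.
  rewrite /deviation ler0_sqrtr ?expr0n ?mulr_ge0 //; first exact: ltW.
  by rewrite nmulr_lle0 // mulr_ge0 // ltW.
have Hg := gaussian_average_C0 f cdr cde H1 H2.
have ce : continuous (fun x => expR (h * c x)).
  move=> x; apply: (cvg_comp (fun x => h * c x) expR); last exact: continuous_expR.
  by apply: cvgM; [exact: cvg_cst|exact: cc].
have be x : `|expR (h * c x)| <= expR (`|h| * C).
  rewrite ger0_norm ?expR_ge0 // ler_expR; apply: le_trans (ler_norm _) _.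
  by rewrite normrM ler_wpM2l.
have := C0_mul_bounded (mkC0 (fun x => std_mean (fun z => f (drift h x + deviation h x * z)))) ce be.
set u := (fun x => _ * _); have -> : u = chernoff_fun h f; last by [].
by apply/funext => x; rewrite /u mkC0E.
Qed.

Definition chernoff_op h f : C0 R := mkC0 (chernoff_fun h f).

Lemma chernoff_opE h f x : chernoff_op h f x = chernoff_fun h f x.
Proof. by rewrite mkC0E //; exact: chernoff_fun_C0. Qed.

Lemma continuous_C0_affine f m s : continuous (fun z : R => f (m + s * z)).
Proof.
move=> z; apply: (continuous_comp (f := fun z : R => m + s * z)); last exact: C0_continuous.
exact: continuous_affine.
Qed.

Lemma chernoff_op_linear h : linear (chernoff_op h).
Proof.
move=> k f g; apply: C0_ext => x.
rewrite C0_addE C0_scaleE !chernoff_opE /chernoff_fun.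
have m f' : measurable_fun setT (fun z => f' (drift h x + deviation h x * z) : R).
  apply: continuous_measurable_fun; exact: (@continuous_C0_affine f').
have bnd (f' : C0 R) z : `|f' (drift h x + deviation h x * z)| <= `|f'| + 0 * z ^+ 4.
  by rewrite mul0r addr0 C0_ler.
by rewrite (std_mean_comb k (m f) (m g) (bnd f) (bnd g)) mulrDr mulrCA.
Qed.

Definition chernoff_lin h : {linear C0 R -> C0 R} :=
  HB.pack (chernoff_op h) (GRing.isLinear.Build R (C0 R) (C0 R) *:%R (chernoff_op h) (chernoff_op_linear h)).

Lemma chernoff_linE h f x : chernoff_lin h f x = chernoff_fun h f x.
Proof. exact: chernoff_opE. Qed.

Lemma chernoff_lin_le h f : 0 <= h -> `|chernoff_lin h f| <= expR (w * h) * `|f|.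
Proof.
move=> h0; apply: C0_norm_ler => x; rewrite chernoff_linE /chernoff_fun normrM.
apply: ler_pM => //; last exact: std_mean_C0_le.
by rewrite ger0_norm ?expR_ge0 // ler_expR mulrC ler_wpM2r.
Qed.

Lemma sqrt_dist_sqr (p q : R) : 0 <= p -> 0 <= q -> (Num.sqrt p - Num.sqrt q) ^+ 2 <= `|p - q|.
Proof.
wlog pq : p q / q <= p.
  move=> H p0 q0; have [qp|pq] := leP q p; first exact: H.
  by rewrite distrC -sqrrN opprB; apply: H => //; exact: ltW.
move=> p0 q0; rewrite ger0_norm ?subr_ge0 //.
rewrite -{2}(sqr_sqrtr p0) -{2}(sqr_sqrtr q0) subr_sqr expr2 ler_wpM2l //.
  by rewrite subr_ge0 ler_wsqrtr.
by rewrite lerD2l; apply: (@le_trans _ _ 0); rewrite ?oppr_le0 sqrtr_ge0.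
Qed.

(** Continuity in [h] down to [h = 0] needs [(sqrt p - sqrt q) ^ 2 <= |p - q|], since the
    deviation is only Hoelder continuous in [h]; the averages are then compared by
    [std_mean_C0_modulus]. *)
Lemma chernoff_lin_cont f : cont_pos (fun h => chernoff_lin h f).
Proof.
move=> t e t0 e0; pose E := expR ((t + 1) * C).
have E0 : 0 < E by exact: expR_gt0.
have e1 : 0 < e / (2 * E) by rewrite divr_gt0 // mulr_gt0.
have [K K0 HK] := std_mean_C0_modulus f e1.
pose M := K * (B ^+ 2 + 2 * A) + 2 * C * `|f|.
have M0 : 0 <= M.
  by rewrite addr_ge0 // !mulr_ge0 // addr_ge0 ?sqr_ge0 // mulr_ge0 // ltW.
have M1 : 0 < M + 1 by rewrite ltr_wpDl.
have C1 : 0 < 2 * (C + 1) by rewrite mulr_gt0 // ltr_wpDl.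
pose d0 := Num.min 1 (Num.min (2 * (C + 1))^-1 (e / (2 * E * (M + 1)))).
exists d0; first by rewrite !lt_min ltr01 invr_gt0 C1 divr_gt0 // !mulr_gt0.
move=> h h0; rewrite !lt_min => /andP[/ltW d1 /andP[/ltW d2 /ltW d3]].
set d := `|h - t| in d1 d2 d3.
have dge0 : 0 <= d by exact: normr_ge0.
apply: C0_norm_ler => x; rewrite C0_subE (chernoff_linE h) (chernoff_linE t) /chernoff_fun.
set gh := std_mean _; set gt := std_mean _.
have eE s : 0 <= s <= t + 1 -> expR (s * c x) <= E.
  move=> /andP[s0 s1]; rewrite ler_expR; apply: le_trans (ler_norm _) _.
  by rewrite normrM (ger0_norm s0) ler_pM.
have H1 : `|gh - gt| <= e / (2 * E) + K * (B ^+ 2 + 2 * A) * d.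
  apply: le_trans (HK _ _ _ _) _; rewrite lerD2l -mulrA ler_wpM2l // mulrDl lerD //.
    have -> : drift h x - drift t x = b x * (h - t) by rewrite /drift; ring.
    rewrite -[leLHS]ger0_norm ?sqr_ge0 // normrX normrM exprMn ler_pM ?sqr_ge0 //.
      by rewrite ler_pXn2r ?nnegrE.
    by rewrite expr2 ler_piMl.
  apply: le_trans (sqrt_dist_sqr _ _) _; try by rewrite !mulr_ge0 // ltW.
  rewrite -mulrBr normrM ler_wpM2r // ger0_norm; first by rewrite ler_wpM2l.
  by rewrite mulr_ge0 // ltW.
have u1 : `|(h - t) * c x| <= 1 / 2.
  rewrite normrM; apply: (@le_trans _ _ (d * (C + 1))).
    by rewrite ler_wpM2l // (le_trans (cC x)) // lerDl.
  have Cp : 0 < C + 1 by rewrite ltr_wpDl.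
  by rewrite -ler_pdivlMr // div1r -invfM.
have [_ H2] := expR_taylor_le u1.
have -> : expR (h * c x) * gh - expR (t * c x) * gt =
   expR (h * c x) * (gh - gt) + expR (t * c x) * ((expR ((h - t) * c x) - 1) * gt).
  have -> : expR (h * c x) = expR (t * c x) * expR ((h - t) * c x).
    by rewrite -expRD; congr expR; ring.
  ring.
have hE : expR (h * c x) <= E.
  apply: eE; rewrite h0 /=; have := ler_norm (h - t); rewrite -/d; lra.
have tE : expR (t * c x) <= E by apply: eE; rewrite t0 lerDl ler01.
apply: le_trans (ler_normD _ _) _; rewrite !normrM !(ger0_norm (expR_ge0 _)).
have K1 : expR (h * c x) * `|gh - gt| <= E * (e / (2 * E) + K * (B ^+ 2 + 2 * A) * d).
  by rewrite ler_pM ?expR_ge0.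
have K2 : expR (t * c x) * (`|expR ((h - t) * c x) - 1| * `|gt|) <= E * (2 * C * d * `|f|).
  rewrite ler_pM ?expR_ge0 ?mulr_ge0 // ler_pM //; last exact: std_mean_C0_le.
  apply: le_trans H2 _; rewrite normrM -mulrA ler_wpM2l // mulrC ler_wpM2r //.
have K3 : E * (M * d) <= e / 2.
  apply: (@le_trans _ _ (E * ((M + 1) * (e / (2 * E * (M + 1)))))).
    by rewrite ler_wpM2l ?(ltW E0) // ler_pM // lerDl.
  by apply: le_of_eq; field; rewrite ?lt0r_neq0.
have -> : e = e / 2 + e / 2 by field.
apply: le_trans (lerD K1 K2) _.
have -> : E * (e / (2 * E) + K * (B ^+ 2 + 2 * A) * d) + E * (2 * C * d * `|f|) =
   e / 2 + E * (M * d) by rewrite /M; field; rewrite ?lt0r_neq0.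
by rewrite lerD2l.
Qed.

Lemma quadratic_bound (c0 c1 c2 z : R) : `|c0 + c1 * z + c2 * z ^+ 2| <=
  (`|c0| + `|c1| + `|c2|) + (`|c1| + `|c2|) * z ^+ 4.
Proof.
have [H1 H2] := pow_le_quartic z; rewrite mul1r in H1 H2.
apply: le_trans (ler_normD _ _) _; apply: le_trans (lerD (ler_normD _ _) (lexx _)) _.
have -> : `|c1 * z| = `|c1| * `|z| by rewrite normrM.
have -> : `|c2 * z ^+ 2| = `|c2| * z ^+ 2 by rewrite normrM (ger0_norm (sqr_ge0 z)).
have K1 := ler_wpM2l (normr_ge0 c1) H1; have K2 := ler_wpM2l (normr_ge0 c2) H2.
lra.
Qed.

(** Average the Taylor expansion at [x] over [u = b x * h + deviation * Z]: the odd
    moment vanishes, the second moment of [Z] is 1, and [deviation ^ 2 = 2 * a x * h]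
    leaves [h * (b f' + a f'')]. The remainder has a term [e h] from the modulus of
    [f''] and terms of order [h ^ 2]. *)
Lemma std_mean_expansion f (f1 f2 : R -> R) (e K h x : R) : 0 <= e -> 0 <= K -> 0 <= h <= 1 ->
  (forall y : R, is_derive y 1 (f : R -> R) (f1 y)) -> (forall y : R, is_derive y 1 f1 (f2 y)) ->
  (forall y : R, `|f2 y - f2 x| <= e + K * (y - x) ^+ 2) ->
  `|std_mean (fun z => f (drift h x + deviation h x * z)) - f x - h * (b x * f1 x + a x * f2 x)| <=
  h * (2 * e * (B ^+ 2 + 2 * A)) +
  h ^+ 2 * (8 * K * (B ^+ 4 + 4 * A ^+ 2 * std_mean4) + B ^+ 2 * `|f2 x|).
Proof.
move=> e0 K0 /andP[h0 h1] d1 d2 H2.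
set s := deviation h x; have s2 : s ^+ 2 = 2 * a x * h by exact: deviation_sqr.
pose u z := b x * h + s * z.
have E z : drift h x + s * z = x + u z by rewrite /drift /u addrA.
pose p0 := - (f x + b x * h * f1 x + (b x * h) ^+ 2 / 2 * f2 x).
pose p1 := - (s * f1 x + b x * h * s * f2 x).
pose p2 := - (s ^+ 2 / 2 * f2 x).
pose phi z := 1 * f (drift h x + s * z) + (p0 + p1 * z + p2 * z ^+ 2).
have phiE z : phi z = f (x + u z) - f x - u z * f1 x - u z ^+ 2 / 2 * f2 x.
  by rewrite /phi E /p0 /p1 /p2 /u; field.
have mf : measurable_fun setT (fun z => f (drift h x + s * z) : R).
  apply: continuous_measurable_fun; exact: (@continuous_C0_affine f).
have bf z : `|f (drift h x + s * z)| <= `|f| + 0 * z ^+ 4 by rewrite mul0r addr0 C0_ler.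
have mp : measurable_fun setT (fun z : R => p0 + p1 * z + p2 * z ^+ 2).
  apply: measurable_funD.
    by apply: measurable_funD; [exact: measurable_cst|apply: measurable_funM].
  apply: measurable_funM; first exact: measurable_cst.
  by apply: continuous_measurable_fun; exact: exprn_continuous.
have Ep : std_mean (fun z => p0 + p1 * z + p2 * z ^+ 2) = p0 + p2.
  have <- : std_mean (fun z => p0 + p1 * z + p2 * z ^+ 2 + 0 * z ^+ 4) = p0 + p2.
    by rewrite std_mean_poly mul0r addr0.
  by congr std_mean; apply/funext => z; rewrite mul0r addr0.
have Ephi : std_mean phi = std_mean (fun z => f (drift h x + s * z)) + (p0 + p2).
  by rewrite /phi (std_mean_comb 1 mf mp bf (quadratic_bound p0 p1 p2)) mul1r Ep.
have b2 : b x ^+ 2 <= B ^+ 2.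
  by rewrite -[leLHS]ger0_norm ?sqr_ge0 // normrX ler_pXn2r ?nnegrE.
have p4 (v : R) : v ^+ 4 = (v ^+ 2) ^+ 2 by ring.
have b4 : b x ^+ 4 <= B ^+ 4.
  by rewrite !p4 ler_pXn2r ?nnegrE ?sqr_ge0.
have a2 : a x ^+ 2 <= A ^+ 2 by rewrite ler_pXn2r ?nnegrE ?(ltW A0) // ltW.
have Bphi : `|std_mean phi| <= (2 * e * (b x * h) ^+ 2 + 8 * K * (b x * h) ^+ 4) +
    2 * e * s ^+ 2 + 8 * K * s ^+ 4 * std_mean4.
  apply: std_mean_bound; first by apply: measurable_funD => //; apply: measurable_funM.
  move=> z; rewrite phiE; apply: le_trans (taylor2_bound (u z) K0 d1 d2 H2) _.
  have q1 : u z ^+ 2 <= 2 * (b x * h) ^+ 2 + 2 * (s * z) ^+ 2.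
    have -> : 2 * (b x * h) ^+ 2 + 2 * (s * z) ^+ 2 = u z ^+ 2 + (b x * h - s * z) ^+ 2.
      by rewrite /u; ring.
    by rewrite lerDl sqr_ge0.
  have q2 : u z ^+ 4 <= 8 * (b x * h) ^+ 4 + 8 * (s * z) ^+ 4.
    rewrite (p4 (u z)).
    apply: (@le_trans _ _ ((2 * (b x * h) ^+ 2 + 2 * (s * z) ^+ 2) ^+ 2)).
      by rewrite ler_pXn2r ?nnegrE ?sqr_ge0 // addr_ge0 // mulr_ge0 // sqr_ge0.
    have -> : 8 * (b x * h) ^+ 4 + 8 * (s * z) ^+ 4 =
      (2 * (b x * h) ^+ 2 + 2 * (s * z) ^+ 2) ^+ 2 + (2 * (b x * h) ^+ 2 - 2 * (s * z) ^+ 2) ^+ 2 by ring.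
    by rewrite lerDl sqr_ge0.
  have r1 := ler_wpM2l e0 q1; have r2 := ler_wpM2l K0 q2.
  apply: le_trans (lerD r1 r2) _; apply: le_of_eq; ring.
have g4 := @std_mean4_ge0 R.
have hh : h ^+ 2 <= h by rewrite expr2 ler_piMl.
have h4 : h ^+ 4 <= h ^+ 2.
  by rewrite p4 [leLHS]expr2 ler_piMl ?sqr_ge0 // (le_trans hh).
have -> : std_mean (fun z => f (drift h x + s * z)) - f x - h * (b x * f1 x + a x * f2 x) =
    std_mean phi + (b x * h) ^+ 2 / 2 * f2 x.
  by rewrite Ephi /p0 /p2 s2; field.
apply: le_trans (ler_normD _ _) _.
have N1 : `|(b x * h) ^+ 2 / 2 * f2 x| <= h ^+ 2 * (B ^+ 2 * `|f2 x|).
  rewrite normrM ger0_norm ?divr_ge0 ?sqr_ge0 // mulrA ler_wpM2r //.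
  rewrite exprMn ler_pdivrMr //.
  have := ler_wpM2r (sqr_ge0 h) b2; have := mulr_ge0 (sqr_ge0 B) (sqr_ge0 h); lra.
have N2 : (2 * e * (b x * h) ^+ 2 + 8 * K * (b x * h) ^+ 4) +
    2 * e * s ^+ 2 + 8 * K * s ^+ 4 * std_mean4 <=
  h * (2 * e * (B ^+ 2 + 2 * A)) + h ^+ 2 * (8 * K * (B ^+ 4 + 4 * A ^+ 2 * std_mean4)).
  rewrite (p4 s) s2 !exprMn.
  have t1 : b x ^+ 2 * h ^+ 2 <= B ^+ 2 * h by rewrite ler_pM ?sqr_ge0.
  have t2 : b x ^+ 4 * h ^+ 4 <= B ^+ 4 * h ^+ 2 by rewrite ler_pM // exprn_even_ge0.
  have t3 : a x * h <= A * h by rewrite ler_wpM2r.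
  have t4 : a x ^+ 2 * (h ^+ 2 * std_mean4) <= A ^+ 2 * (h ^+ 2 * std_mean4).
    by rewrite ler_wpM2r // mulr_ge0 // sqr_ge0.
  have e2 : 0 <= 2 * e by rewrite mulr_ge0.
  have k8 : 0 <= 8 * K by rewrite mulr_ge0.
  have v1 := ler_wpM2l e2 t1; have v2 := ler_wpM2l k8 t2.
  have v3 := ler_wpM2l e2 t3; have v4 := ler_wpM2l k8 t4.
  lra.
have := le_trans Bphi N2; lra.
Qed.

(** Combine [std_mean_expansion] with [e ^ (h c) = 1 + h c + O(h ^ 2)]. The bounds are
    uniform in [x] because [f''] is in C_0 and the coefficients are bounded. *)
Lemma chernoff_lin_generator f k : diff_op a b c (f, k) -> forall e : R, 0 < e ->
  \forall h \near (0 : R)^'+, `|chernoff_lin h f - f - h *: k| <= e * h.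
Proof.
move=> [/= Cf kE] e e0; have [dd1 dd2 _ _] := Cf.
have [F2 F2E] := C2c_derive2_C0 Cf.
set f1 := derive1 (f : R -> R) in dd2 F2E kE.
have d1 (y : R) : is_derive y 1 (f : R -> R) (f1 y).
  by apply: DeriveDef; [exact: dd1|rewrite /f1 derive1E].
have d2 (y : R) : is_derive y 1 f1 (F2 y).
  by apply: DeriveDef; [exact: dd2|rewrite F2E derive1E].
pose Q := 8 * (B ^+ 2 + 2 * A).
have Q0 : 0 < Q by rewrite mulr_gt0 // ltr_wpDl ?sqr_ge0 // mulr_gt0.
have e1 : 0 < e / Q by rewrite divr_gt0.
have [K K0 HK] := C0_modulus F2 e1.
pose M1 := 8 * K * (B ^+ 4 + 4 * A ^+ 2 * std_mean4) + B ^+ 2 * `|F2|.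
have g4 := @std_mean4_ge0 R.
have M10 : 0 <= M1.
  apply: addr_ge0; last by rewrite mulr_ge0 ?sqr_ge0.
  apply: mulr_ge0; first by rewrite mulr_ge0.
  apply: addr_ge0; first exact: exprn_even_ge0.
  by apply: mulr_ge0 => //; rewrite mulr_ge0 ?sqr_ge0.
pose L := `|k| + C * `|f|.
have L0 : 0 <= L by rewrite addr_ge0 // mulr_ge0.
pose M2 := 2 * M1 + 2 * C ^+ 2 * `|f| + 2 * C * L.
have M20 : 0 <= M2 by rewrite !addr_ge0 // !mulr_ge0 // sqr_ge0.
have M21 : 0 < M2 + 1 by rewrite ltr_wpDl.
have C1 : 0 < C + 1 by rewrite ltr_wpDl.
near=> h.
have h0 : 0 < h by near: h; exact: nbhs_right_gt.
have h1 : h <= 1 by near: h; exact: nbhs_right_le.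
have hC : h <= 1 / 2 / (C + 1) by near: h; apply: nbhs_right_le; rewrite !divr_gt0.
have hM : h <= e / 2 / (M2 + 1) by near: h; apply: nbhs_right_le; rewrite !divr_gt0.
rewrite ler_pdivlMr // in hC; rewrite ler_pdivlMr // in hM.
apply: C0_norm_ler => x; rewrite !C0_subE C0_scaleE chernoff_linE /chernoff_fun.
have H3 : `|f x| <= `|f| by exact: C0_ler.
set l := b x * f1 x + a x * F2 x.
have kl : k x = l + c x * f x by rewrite kE /l F2E; ring.
have H1 := std_mean_expansion (ltW e1) K0 (introT andP (conj (ltW h0) h1)) d1 d2 (fun y => HK y x).
set g := std_mean _ in H1 *.
have hCx : `|h * c x| <= h * C by rewrite normrM gtr0_norm // ler_pM2l.
have hC2 : h * C <= 1 / 2 by apply: le_trans hC; rewrite ler_pM2l // lerDl.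
have [T1 T2] := expR_taylor_le (le_trans hCx hC2).
have T3 : expR (h * c x) <= 2.
  have := ler_norm (expR (h * c x) - 1); lra.
have Ll : `|l| <= L.
  have -> : l = k x - c x * f x by rewrite kl; ring.
  apply: le_trans (ler_normB _ _) _; rewrite normrM /L lerD ?C0_ler // ler_pM //.
have -> : expR (h * c x) * g - f x - h * k x =
   expR (h * c x) * (g - f x - h * l) + (expR (h * c x) - 1 - h * c x) * f x +
   (expR (h * c x) - 1) * (h * l) by rewrite kl; ring.
apply: le_trans (ler_normD _ _) _; apply: le_trans (lerD (ler_normD _ _) (lexx _)) _.
rewrite !normrM (ger0_norm (expR_ge0 _)) (gtr0_norm h0).
have W1 : expR (h * c x) * `|g - f x - h * l| <=
    2 * (h * (2 * (e / Q) * (B ^+ 2 + 2 * A)) + h ^+ 2 * M1).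
  rewrite ler_pM ?expR_ge0 //; apply: le_trans H1 _; rewrite lerD2l.
  rewrite ler_wpM2l ?sqr_ge0 // lerD2l ler_wpM2l ?sqr_ge0 // C0_ler //.
have hc2 : (h * c x) ^+ 2 <= h ^+ 2 * C ^+ 2.
  by rewrite -exprMn -[leLHS]ger0_norm ?sqr_ge0 // normrX ler_pXn2r ?nnegrE // mulr_ge0 // ltW.
have W2 : `|expR (h * c x) - 1 - h * c x| * `|f x| <= 2 * (h ^+ 2 * C ^+ 2) * `|f|.
  by rewrite ler_pM // (le_trans T1) // ler_pM2l.
have W3 : `|expR (h * c x) - 1| * (h * `|l|) <= 2 * (h * C) * (h * L).
  rewrite ler_pM ?mulr_ge0 ?(ltW h0) //; last by rewrite ler_pM2l.
  by apply: le_trans T2 _; rewrite ler_pM2l.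
apply: le_trans (lerD (lerD W1 W2) W3) _.
have -> : 2 * (h * (2 * (e / Q) * (B ^+ 2 + 2 * A)) + h ^+ 2 * M1) +
   2 * (h ^+ 2 * C ^+ 2) * `|f| + 2 * (h * C) * (h * L) = h * (e / 2) + h * (h * M2).
  rewrite /M2 /Q; field.
  by rewrite lt0r_neq0 // ltr_wpDl ?sqr_ge0 // mulr_gt0.
rewrite -mulrDr mulrC ler_pM2r //.
have : h * M2 <= e / 2 by apply: le_trans hM; rewrite ler_pM2l // lerDl.
lra.
Unshelve. all: by end_near. Qed.

End chernoff_function.

(** * Iterated integrals *)

Section iterated_integral.
Context {R : realType}.
Local Notation mu := (@lebesgue_measure R).
Implicit Types (F G : seq R -> R).

Lemma iter_int_ext n F G : (forall s, size s = n -> F s = G s) ->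
  iter_int n F = iter_int n G.
Proof.
elim: n F G => [|n ih] F G H /=; first exact: H.
by apply: eq_Rintegral => x _; apply: ih => s ss; apply: H; rewrite /= ss.
Qed.

Lemma iter_integrable_ext n F G : (forall s, size s = n -> F s = G s) ->
  iter_integrable n F -> iter_integrable n G.
Proof.
elim: n F G => [|n ih] F G H //= [H1 H2]; split.
  by move=> x; apply: ih (H1 x) => s ss; apply: H; rewrite /= ss.
rewrite (_ : (fun x : R => (iter_int n (fun s => G (x :: s)))%:E) =
  (fun x : R => (iter_int n (fun s => F (x :: s)))%:E)) //.
apply/funext => x; congr EFin; apply: iter_int_ext => s ss.
by apply/esym/H; rewrite /= ss.
Qed.

Lemma iter_intZ n F (k : R) : iter_integrable n F ->
  iter_integrable n (fun s => k * F s) /\ iter_int n (fun s => k * F s) = k * iter_int n F.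
Proof.
elim: n F => [|n ih] F //= [H1 H2].
have E x : iter_int n (fun s => k * F (x :: s)) = k * iter_int n (fun s => F (x :: s)).
  exact: (ih _ (H1 x)).2.
split; last first.
  rewrite -(RintegralZl k measurableT H2); apply: eq_Rintegral => x _; exact: E.
split; first by move=> x; exact: (ih _ (H1 x)).1.
have := integrableZl measurableT k H2.
by congr (_.-integrable _ _); apply/funext => x; rewrite E.
Qed.

Variable K : R -> R -> R.
Variables (T : C0 R -> C0 R) (g : C0 R).
Hypothesis TK : forall (f : C0 R) x, mu.-integrable setT (EFin \o (fun y => K x y * f y)) /\
  T f x = \int[mu]_y (K x y * f y).

(** The integrand of the [size s]-fold iterate of the operator with kernel [K]. *)
Fixpoint path_prod (x : R) (s : seq R) : R :=
  if s is y :: s' then K x y * path_prod y s' else g x.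

(** The outermost variable of [iter_int] is the first step of the path, so this is
    induction on the number of steps. *)
Lemma iter_int_path n x : iter_integrable n (path_prod x) /\
  iter_int n (path_prod x) = iter n T g x.
Proof.
elim: n x => [|n ih] x //=.
have E y : iter_int n (fun s => K x y * path_prod y s) = K x y * iter n T g y.
  by rewrite (iter_intZ (K x y) (ih y).1).2 (ih y).2.
have [iK TE] := TK (iter n T g) x.
split; last by rewrite TE; apply: eq_Rintegral => y _; exact: E.
split; first by move=> y; exact: (iter_intZ (K x y) (ih y).1).1.
by rewrite (_ : (fun y => _) = EFin \o (fun y => K x y * iter n T g y)) //; apply/funext => y; rewrite /= E.
Qed.

End iterated_integral.

Section kernel.
Context {R : realType}.
Local Notation mu := (@lebesgue_measure R).
Variables (a b c : R -> R).
Hypothesis a_gt0 : forall x, 0 < a x.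

Definition heat_kernel (h x y : R) : R :=
  expR (h * c x) * normal_pdf (drift b h x) (deviation a h x) y.

Lemma chernoff_fun_kernel (f : C0 R) (h x : R) : 0 < h ->
  mu.-integrable setT (EFin \o (fun y => heat_kernel h x y * f y)) /\
  chernoff_fun a b c h f x = \int[mu]_y (heat_kernel h x y * f y).
Proof.
move=> h0; have s0 : 0 < deviation a h x by rewrite sqrtr_gt0 !mulr_gt0.
have [i1 E] := normal_mean (drift b h x) s0 (@C0_continuous R f) (C0_ler f).
have H : (fun y => heat_kernel h x y * f y) =
   (fun y => expR (h * c x) * (normal_pdf (drift b h x) (deviation a h x) y * f y)).
  by apply/funext => y; rewrite mulrA.
rewrite H; split.
  by have := integrableZl measurableT (expR (h * c x)) i1.
by rewrite (RintegralZl _ measurableT i1) E.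
Qed.

(** Expand [(y - x - b h) ^ 2 / (4 a h)]: the cross term is the factor with
    [b (y - x) / (2 a)], and the square of the drift is the correction
    [- b ^ 2 / (4 a)] of the potential [c]. *)
Lemma heat_kernelE (h x y : R) : 0 < h ->
  heat_kernel h x y =
  expR (h * (c x - b x ^+ 2 / (4 * a x))) * expR (b x * (y - x) / (2 * a x)) *
  (Num.sqrt (4 * pi * h))^-1 * (a x `^ (- (1 / 2))) *
  expR (- (1 / (4 * h)) * ((x - y) ^+ 2 / a x)).
Proof.
move=> h0; have ax := a_gt0 x.
have s0 : 0 < deviation a h x by rewrite sqrtr_gt0 !mulr_gt0.
have sE : deviation a h x ^+ 2 = 2 * a x * h.
  by rewrite sqr_sqrtr // !mulr_ge0 // ltW.
rewrite /heat_kernel normal_pdfE ?lt0r_neq0 // /normal_fun /normal_peak sE.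
have -> : 2 * a x * h * pi *+ 2 = 4 * pi * h * a x by rewrite -mulr_natl; ring.
have p0 : 0 <= 4 * pi * h by rewrite !mulr_ge0 ?pi_ge0 // ltW.
rewrite sqrtrM // invfM powRN div1r powR12_sqrt ?(ltW ax) //.
set e1 := expR (h * c x); set e2 := expR _; set k1 := _^-1; set k2 := _^-1.
set e3 := expR _; set e4 := expR _; set e5 := expR _.
have E : e1 * e2 = e3 * e4 * e5.
  rewrite -!expRD; congr expR; rewrite /drift -mulr_natl.
  by field; rewrite !lt0r_neq0.
have -> : e1 * (k1 * k2 * e2) = k1 * k2 * (e1 * e2) by ring.
by rewrite E; ring.
Qed.

Lemma path_prodE (g : C0 R) (h x0 : R) (s : seq R) : 0 < h ->
  let x j := (x0 :: s)`_j in let n := size s in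
  path_prod (heat_kernel h) g x0 s =
  expR (h * \sum_(0 <= j < n) (c (x j) - b (x j) ^+ 2 / (4 * a (x j)))) *
  expR (\sum_(0 <= j < n) b (x j) * (x j.+1 - x j) / (2 * a (x j))) *
  ((Num.sqrt (4 * pi * h))^-1) ^+ n *
  (\prod_(0 <= j < n) a (x j)) `^ (- (1 / 2)) *
  expR (- (1 / (4 * h)) * \sum_(0 <= j < n) (x j - x j.+1) ^+ 2 / a (x j)) *
  g (x n).
Proof.
move=> h0; elim: s x0 => [|y s ih] x0 /=.
  by rewrite !big_geq // !mulr0 expR0 powR1 expr0 !mul1r.
rewrite ih /= heat_kernelE // !big_nat_recl //=.
rewrite [h * (_ + \sum_(0 <= i < size s) _)]mulrDr.
rewrite [- _ * (_ + _)]mulrDr !expRD [_^-1 ^+ _.+1]exprS.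
rewrite powRM ?(ltW (a_gt0 _)) //; last first.
  by rewrite big_nat_cond prodr_ge0 // => i _; exact: ltW.
ring.
Qed.

(** The factors of the integrand are sums and products over the steps of the path,
    so the formula reduces to [heat_kernelE] at each step. *)
Lemma feynman_integrandE (g : C0 R) (n : nat) (t x0 : R) (s : seq R) :
  (0 < n)%N -> 0 < t -> size s = n ->
  feynman_integrand a b c g n t x0 s = path_prod (heat_kernel (t / n%:R)) g x0 s.
Proof.
move=> n0 t0 sn; have nn : 0 < (n%:R : R) by rewrite ltr0n.
have h0 : 0 < t / n%:R by rewrite divr_gt0.
rewrite (path_prodE g x0 s h0) /= sn /feynman_integrand !big_add1 /=.
have -> : Num.sqrt n%:R / Num.sqrt (4 * pi * t) = (Num.sqrt (4 * pi * (t / n%:R)))^-1.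
  have p0 : 0 <= 4 * pi * t :> R by rewrite !mulr_ge0 ?pi_ge0 // ltW.
  by rewrite mulrA [in RHS](sqrtrM _ p0) sqrtrV ?ler0n // invfM invrK mulrC.
have -> : n%:R / (4 * t) = 1 / (4 * (t / n%:R)) by field; rewrite ?lt0r_neq0.
by [].
Qed.

End kernel.

(** * Complexification and the resolvent *)

Local Open Scope complex_scope.

Section complexification_of_C0.
Context {R : realType}.
Implicit Types (p q : C0 R) (u v : C0C R) (z : R[i]).
Import Normc.

Lemma normc_le_sum z : normc z <= `|complex.Re z| + `|complex.Im z|.
Proof.
case: z => x y /=; have -> : `|x| + `|y| = Num.sqrt ((`|x| + `|y|) ^+ 2).
  by rewrite sqrtr_sqr [RHS]ger0_norm // addr_ge0.
rewrite ler_wsqrtr // -[x ^+ 2]real_normK ?num_real // -[y ^+ 2]real_normK ?num_real //.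
by rewrite sqrrD lerD2r lerDl mulrn_wge0 // mulr_ge0.
Qed.

Lemma normc_ge_part z : `|complex.Re z| <= normc z /\ `|complex.Im z| <= normc z.
Proof.
case: z => x y /=; rewrite -!sqrtr_sqr; split; apply: ler_wsqrtr.
  by rewrite lerDl sqr_ge0.
by rewrite lerDr sqr_ge0.
Qed.

Lemma complex_gt0P (e : R[i]) : 0 < e -> exists2 r : R, 0 < r & e = r%:C.
Proof. by case: e => r s; rewrite ltcE /= => /andP[/eqP -> r0]; exists r. Qed.

Lemma C0C_ext u v : (forall x, u x = v x) -> u = v.
Proof. by move=> uv; apply/val_inj/funext => x; exact: uv. Qed.

Lemma C0C_norm_ler u (M : R) : (forall x, normc (u x) <= M) -> `|u| <= M%:C.
Proof.
move=> H; change (C0C_norm u <= M%:C); rewrite lecR.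
by apply: ge_sup => [|_ [x _ <-]] //; exists (normc (u 0)), 0.
Qed.

Lemma C0C_ler u x : (normc (u x))%:C <= `|u|.
Proof.
change ((normc (u x))%:C <= C0C_norm u); rewrite lecR.
by apply: ub_le_sup; [exact: C0C_bounded (C0C_funP u)|exists x].
Qed.

Lemma part_C0 (h : R[i] -> R) u :
    (forall z z' : R[i], `|h z - h z'| <= normc (z - z')) -> h 0 = 0 ->
  (fun x => h (u x) : R^o) \in @C0_pred R R.
Proof.
move=> hl h0; have /C0_predP[cu pu nu] := C0C_funP u.
have H (F : set_system R) (l : R[i]^o) : Filter F -> u @ F --> l ->
    (fun x => h (u x) : R^o) @ F --> (h l : R^o).
  move=> FF /cvgrPdist_lt ul; apply/cvgrPdist_lt => e e0.
  have ec : (0 : R[i]) < e%:C by rewrite ltcR.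
  apply: filterS (ul _ ec) => x; have -> : `|l - u x| = (normc (l - u x))%:C by case: (l - u x).
  by rewrite ltcR; apply: le_lt_trans; exact: hl.
apply/C0_predP; split; first by move=> x; apply: H; exact: cu.
- by rewrite -h0; exact: H.
- by rewrite -h0; exact: H.
Qed.

Definition C0_Re u : C0 R := mkC0 (fun x => complex.Re (u x)).
Definition C0_Im u : C0 R := mkC0 (fun x => complex.Im (u x)).

Lemma C0_ReE u x : C0_Re u x = complex.Re (u x).
Proof.
rewrite mkC0E //; apply: (part_C0 (h := @complex.Re R)) => // z z'.
by rewrite -raddfB; exact: (normc_ge_part _).1.
Qed.

Lemma C0_ImE u x : C0_Im u x = complex.Im (u x).
Proof.
rewrite mkC0E //; apply: (part_C0 (h := @complex.Im R)) => // z z'.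
by rewrite -raddfB; exact: (normc_ge_part _).2.
Qed.

Lemma C0_complexK u : C0_complex (C0_Re u) (C0_Im u) = u.
Proof. by apply: C0C_ext => x /=; rewrite C0_ReE C0_ImE; case: (u x). Qed.

Lemma C0_complex_Re p q : C0_Re (C0_complex p q) = p.
Proof. by apply: C0_ext => x; rewrite C0_ReE. Qed.

Lemma C0_complex_Im p q : C0_Im (C0_complex p q) = q.
Proof. by apply: C0_ext => x; rewrite C0_ImE. Qed.

Lemma C0_complexD p q p' q' :
  C0_complex p q + C0_complex p' q' = C0_complex (p + p') (q + q').
Proof. by apply: C0C_ext. Qed.

Lemma C0_complexB p q p' q' :
  C0_complex p q - C0_complex p' q' = C0_complex (p - p') (q - q').
Proof. by apply: C0C_ext. Qed.

Lemma C0_complexZ (k l : R) p q :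
  (k +i* l) *: C0_complex p q = C0_complex (k *: p - l *: q) (k *: q + l *: p).
Proof. by apply: C0C_ext. Qed.

Lemma C0_complex_norm p q : `|C0_complex p q| <= (`|p| + `|q|)%:C.
Proof.
apply: C0C_norm_ler => x; apply: le_trans (normc_le_sum _) _.
by apply: lerD; exact: C0_ler.
Qed.

Lemma C0_part_norm u : (`|C0_Re u|%:C <= `|u|) /\ (`|C0_Im u|%:C <= `|u|).
Proof.
have [r r0 ur] : exists2 r : R, 0 <= r & `|u| = r%:C.
  have := normr_ge0 u; case: `|u| => r s; rewrite lecE /= => /andP[/eqP -> r0].
  by exists r.
have H x : normc (u x) <= r by have := C0C_ler u x; rewrite ur lecR.
rewrite ur !lecR; split; apply: C0_norm_ler => x; apply: le_trans (H x).
  by rewrite C0_ReE; exact: (normc_ge_part _).1.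
by rewrite C0_ImE; exact: (normc_ge_part _).2.
Qed.

End complexification_of_C0.

Section complex_operator.
Context {R : realType}.
Variables (Lc Ls : {linear C0 R -> C0 R}).

Let LcD p q : Lc (p + q) = Lc p + Lc q. Proof. exact: linearD. Qed.
Let LsD p q : Ls (p + q) = Ls p + Ls q. Proof. exact: linearD. Qed.
Let LcN p : Lc (- p) = - Lc p. Proof. exact: linearN. Qed.
Let LsN p : Ls (- p) = - Ls p. Proof. exact: linearN. Qed.
Let LcZ (k : R) p : Lc (k *: p) = k *: Lc p. Proof. exact: linearZZ. Qed.
Let LsZ (k : R) p : Ls (k *: p) = k *: Ls p. Proof. exact: linearZZ. Qed.
Let linE := (LcD, LsD, LcN, LsN, LcZ, LsZ).

(** With [R = Lc - i Ls] this is [R (p + i q)], separated into real and imaginary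
    parts. *)
Definition complex_fun (u : C0C R) : C0C R :=
  C0_complex (Lc (C0_Re u) + Ls (C0_Im u)) (Lc (C0_Im u) - Ls (C0_Re u)).

Lemma complex_funE (p q : C0 R) :
  complex_fun (C0_complex p q) = C0_complex (Lc p + Ls q) (Lc q - Ls p).
Proof. by rewrite /complex_fun C0_complex_Re C0_complex_Im. Qed.

Fact complex_fun_linear : linear complex_fun.
Proof.
move=> [k l] u v; rewrite -[u]C0_complexK -[v]C0_complexK.
rewrite C0_complexZ C0_complexD !complex_funE C0_complexZ C0_complexD.
rewrite !linE !(scalerBr, scalerDr).
by congr C0_complex; zmod.
Qed.

Definition complex_lin : {linear C0C R -> C0C R} :=
  HB.pack complex_fun
    (GRing.isLinear.Build R[i] (C0C R) (C0C R) *:%R complex_fun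
       complex_fun_linear).

Lemma complex_linE p q :
  complex_lin (C0_complex p q) = C0_complex (Lc p + Ls q) (Lc q - Ls p).
Proof. exact: complex_funE. Qed.

Variable M : R.
Hypothesis M0 : 0 < M.
Hypothesis LcM : forall p, `|Lc p| <= M * `|p|.
Hypothesis LsM : forall p, `|Ls p| <= M * `|p|.

Lemma complex_lin_le u : `|complex_lin u| <= (4 * M)%:C * `|u|.
Proof.
have [r r0 ur] : exists2 r : R, 0 <= r & `|u| = r%:C.
  have := normr_ge0 u; case: `|u| => r s; rewrite lecE /= => /andP[/eqP -> r0].
  by exists r.
have [Hr Hi] := C0_part_norm u; rewrite ur !lecR in Hr Hi.
rewrite -[u in complex_lin u]C0_complexK complex_linE ur.
apply: le_trans (C0_complex_norm _ _) _; rewrite -rmorphM lecR.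
have bc p : `|p| <= r -> `|Lc p| <= M * r.
  by move=> pr; apply: le_trans (LcM p) _; rewrite ler_pM2l.
have bs p : `|p| <= r -> `|Ls p| <= M * r.
  by move=> pr; apply: le_trans (LsM p) _; rewrite ler_pM2l.
have -> : 4 * M * r = (M * r + M * r) + (M * r + M * r) by ring.
apply: lerD.
  by apply: le_trans (ler_normD _ _) _; apply: lerD; [exact: bc|exact: bs].
by apply: le_trans (ler_normB _ _) _; apply: lerD; [exact: bc|exact: bs].
Qed.

Lemma complex_lin_continuous : continuous complex_lin.
Proof.
move=> u; apply/(@cvgrPdist_le _ _ _ (nbhs u) (nbhs_filter u)) => e e0.
have M1 : (0 : R[i]) < (4 * M)%:C by rewrite ltcR mulr_gt0.
have e1 : 0 < e / (4 * M)%:C by rewrite divr_gt0.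
have : \forall v \near u, `|u - v| <= e / (4 * M)%:C by apply: (@cvgr_dist_le _ _ _ (nbhs u) (nbhs_filter u) id u) e1; exact: cvg_id.
apply: filterS => v H; rewrite -linearB; apply: le_trans (complex_lin_le _) _.
by rewrite mulrC -ler_pdivlMr.
Qed.

Variables (G : set (C0 R * C0 R)) (mu nu : R).
Hypothesis GD : forall f f' k k' (r : R), G (f, f') -> G (k, k') -> G (f + r *: k, f' + r *: k').
Hypothesis Gfun : forall f k1 k2, G (f, k1) -> G (f, k2) -> k1 = k2.
Hypothesis LcG : forall f, G (Lc f, mu *: Lc f + nu *: Ls f - f).
Hypothesis LsG : forall f, G (Ls f, mu *: Ls f - nu *: Lc f).
Hypothesis GLc : forall f k, G (f, k) -> G (Lc f, Lc k).
Hypothesis GLs : forall f k, G (f, k) -> G (Ls f, Ls k).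

(** The hypotheses [LcG] and [LsG] are the real and imaginary parts of
    [(lam - A) R = 1], where [G] is the graph of [A]; as [A] is a function and [Lc], [Ls] preserve its graph, the
    other identity [R (lam - A) = 1] follows from them. *)
Theorem complex_lin_resolvent : is_resolvent (complexification G) (mu +i* nu) complex_lin.
Proof.
split; first exact: complex_lin_continuous.
- move=> _ _ [[p1 p2] Gp [[q1 q2] Gq [<- <-]]].
  have gc p p' (H : G (p, p')) := Gfun (GLc H) (LcG p).
  have gs p p' (H : G (p, p')) := Gfun (GLs H) (LsG p).
    rewrite C0_complexZ C0_complexB complex_linE.
  rewrite !linE.
  rewrite (gc _ _ Gp) (gc _ _ Gq) (gs _ _ Gp) (gs _ _ Gq).
  by congr C0_complex; zmod.
- move=> g; rewrite -[g]C0_complexK; move: (C0_Re g) (C0_Im g) => p q.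
  have G1 := GD 1 (LcG p) (LsG q); have G2 := GD (-1) (LcG q) (LsG p).
  rewrite !scale1r in G1; rewrite !scaleN1r in G2.
  rewrite complex_linE; exists (C0_complex (mu *: Lc p + nu *: Ls p - p + (mu *: Ls q - nu *: Lc q))
    (mu *: Lc q + nu *: Ls q - q - (mu *: Ls p - nu *: Lc p))).
    by eexists; first exact: G1; eexists; first exact: G2.
  rewrite C0_complexZ C0_complexB !(scalerBr, scalerDr).
  by congr C0_complex; zmod.
Qed.

End complex_operator.

Lemma generator_comb (R : realType) (X : normedModType R) (T : R -> {linear X -> X})
    f f' k k' (r : R) : generator T (f, f') -> generator T (k, k') ->
  generator T (f + r *: k, f' + r *: k').
Proof.
rewrite /generator /= => H1 H2.
have H3 : r *: (t^-1 *: (T t k - k)) @[t --> 0^'+] --> r *: k' by apply: cvgZr.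
apply: cvg_trans (cvgD H1 H3).
apply: near_eq_cvg; near=> h; rewrite /= [T h _]linearD [T h (_ *: _)]linearZZ.
have -> : T h f + r *: T h k - (f + r *: k) = (T h f - f) + r *: (T h k - k).
  by rewrite scalerBr; zmod.
by rewrite scalerDr; congr (_ + _); rewrite !scalerA mulrC.
Unshelve. all: by end_near. Qed.

Section resolvent.
Context {R : realType}.
Variables (T : R -> {linear C0 R -> C0 R}) (w mu nu : R).
Hypothesis hT : C0_semigroup T.
Hypothesis Tle : forall (s : R) g, 0 <= s -> `|T s g| <= expR (w * s) * `|g|.
Hypothesis wmu : w < mu.

Definition laplace_resolvent : {linear C0C R -> C0C R} :=
  complex_lin (laplace_lin hT Tle wmu (weight_cosw mu nu))
    (laplace_lin hT Tle wmu (weight_sinw mu nu)).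

Lemma laplace_resolventE p q : laplace_resolvent (C0_complex p q) =
  C0_complex (laplace T (cosw mu nu) p + laplace T (sinw mu nu) q)
    (laplace T (cosw mu nu) q - laplace T (sinw mu nu) p).
Proof. by rewrite /laplace_resolvent complex_linE !laplace_linE. Qed.

Theorem laplace_is_resolvent :
  is_resolvent (complexification (generator T)) (mu +i* nu) laplace_resolvent.
Proof.
have wc := weight_cosw mu nu; have ws := weight_sinw mu nu.
have M0 : 0 < (mu - w)^-1 by rewrite invr_gt0 subr_gt0.
apply: (complex_lin_resolvent M0) => /=.
- by move=> p; exact: (laplace_le hT Tle wmu p wc).
- by move=> p; exact: (laplace_le hT Tle wmu p ws).
- exact: generator_comb.
- exact: generator_functional.
- by move=> f; exact: (@laplace_cos_generator R T hT w mu Tle wmu nu f).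
- by move=> f; exact: (@laplace_sin_generator R T hT w mu Tle wmu nu f).
- by move=> f k; exact: (laplace_generator hT Tle wmu wc).
- by move=> f k; exact: (laplace_generator hT Tle wmu ws).
Qed.

End resolvent.

(** * Convergence of the Laplace transforms *)

Section approximation.
Context {R : realType}.
Local Notation leb := (@lebesgue_measure R).
Variables (T S : R -> {linear C0 R -> C0 R}) (D : set (C0 R * C0 R)) (w0 mu : R).
Hypothesis hT : C0_semigroup T.
Hypothesis w00 : 0 <= w0.
Hypothesis w0mu : w0 < mu.
Hypothesis Sle : forall (h : R) f, 0 <= h -> `|S h f| <= expR (w0 * h) * `|f|.
Hypothesis Scont : forall f, cont_pos (fun h => S h f).
Hypothesis Sgen : forall f k, D (f, k) -> forall e : R, 0 < e ->
  \forall h \near (0 : R)^'+, `|S h f - f - h *: k| <= e * h.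
Hypothesis TD : generator T = closure D.

(** Continuity in [t] makes the integrand of the Laplace integral measurable. *)
Lemma iter_cont_pos (r : R) f n : 0 <= r -> cont_pos (fun t => iter n (S (t * r)) f).
Proof.
move=> r0; elim: n => [|n ih] t e t0 e0 /=.
  by exists 1 => // s _ _; rewrite subrr normr0 ltW.
set F := fun t => iter n (S (t * r)) f in ih *.
pose E := expR (w0 * ((t + 1) * r)); have E0 : 0 < E by exact: expR_gt0.
have e1 : 0 < e / (2 * E) by rewrite divr_gt0 // mulr_gt0.
have e2 : 0 < e / 2 by rewrite divr_gt0.
have [d1 d10 H1] := ih t _ t0 e1.
have [d2 d20 H2] := Scont (F t) (mulr_ge0 t0 r0) e2.
have r1 : 0 < r + 1 by rewrite ltr_wpDl.
exists (Num.min 1 (Num.min d1 (d2 / (r + 1)))).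
  by rewrite !lt_min ltr01 d10 divr_gt0.
move=> s s0; rewrite !lt_min => /and3P[s1 sd1 sd2].
have sr0 : 0 <= s * r by rewrite mulr_ge0.
have -> : S (s * r) (iter n (S (s * r)) f) - S (t * r) (iter n (S (t * r)) f) =
    S (s * r) (F s - F t) + (S (s * r) (F t) - S (t * r) (F t)).
  by rewrite [S (s * r) (_ - _)]linearB addrA subrK.
rewrite [leRHS]splitr; apply: le_trans (ler_normD _ _) _; apply: lerD.
  apply: le_trans (Sle _ sr0) _.
  have -> : e / 2 = E * (e / (2 * E)) by field; rewrite lt0r_neq0.
  apply: ler_pM => //; last exact: H1.
  rewrite ler_expR ler_wpM2l // ler_wpM2r //.
  by move: s1; rewrite ltr_norml => /andP[_]; lra.
apply: H2 => //; rewrite -mulrBl normrM [`|r|]ger0_norm //.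
apply: (@le_lt_trans _ _ (`|s - t| * (r + 1))); first by rewrite ler_wpM2l // lerDl.
by rewrite -ltr_pdivlMr.
Qed.

Lemma cont_pos_measurable (F : R -> C0 R) x : cont_pos F ->
  measurable_fun (`]0, +oo[%classic : set R) (fun s => F s x : R).
Proof.
move=> cF; apply: subspace_continuous_measurable_fun => //.
apply: (@continuous_subspaceW R R _ `[0, +oo[%classic).
  by apply: subset_itvr; rewrite bnd_simp.
exact: (@cont_pos_within _ _ x cF).
Qed.

Let iter_S n f t := iter n (S (t / n%:R)) f.

Lemma iter_S_le n f (t : R) : (0 < n)%N -> 0 <= t -> `|iter_S n f t| <= expR (w0 * t) * `|f|.
Proof.
move=> n0 t0; have nn : (n%:R : R) != 0 by rewrite pnatr_eq0 -lt0n.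
have h0 : 0 <= t / n%:R by rewrite divr_ge0.
have := iter_contract n f (expR_ge0 _) (fun g => Sle g h0).
by rewrite -expRM_natl mulrCA [n%:R * _]mulrC divfK.
Qed.

Lemma iter_S_measurable n f x : (0 < n)%N ->
  measurable_fun (`]0, +oo[%classic : set R) (fun t => iter_S n f t x : R).
Proof.
by move=> n0; apply: cont_pos_measurable; apply: iter_cont_pos; rewrite invr_ge0.
Qed.

Lemma weight_measurable phi : weight mu phi -> measurable_fun (`]0, +oo[%classic : set R) phi.
Proof. by move=> [cphi _]; apply: measurable_funTS; exact: continuous_measurable_fun. Qed.

Lemma iter_S_integrable n f x phi : (0 < n)%N -> weight mu phi ->
  leb.-integrable `]0, +oo[ (EFin \o (fun t => phi t * iter_S n f t x)).
Proof.
move=> n0 wphi; have d0 : 0 < mu - w0 by rewrite subr_gt0.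
apply: (dom_integrable (C := `|f|) d0).
  by apply: measurable_funM; [exact: weight_measurable|exact: iter_S_measurable].
move=> s s0; rewrite normrM.
have := ler_pM (normr_ge0 _) (normr_ge0 _) (wphi.2 s (ltW s0))
  (le_trans (C0_ler _ x) (iter_S_le f n0 (ltW s0))).
move=> H; apply: le_trans H _; apply: le_of_eq.
by rewrite mulrA -expRD [RHS]mulrC; congr (expR _ * _); ring.
Qed.

(** The bound of [chernoff_semigroup] at some [l] strictly below [mu], integrated
    against the weight. Uniformity in [x] and in the weight is inherited from the norm. *)
Lemma laplace_iter_S_cvg f (e : R) : 0 < e -> exists N : nat, forall n x phi,
  (N <= n)%N -> (0 < n)%N -> weight mu phi ->
  `|laplace T phi f x - \int[leb]_(t in `]0, +oo[) (phi t * iter_S n f t x)| <= e.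
Proof.
move=> e0; pose w := (w0 + mu) / 2; pose l := (w + mu) / 2.
(* [w] bounds the growth of [T] and [l] is the rate of the Chernoff estimate *)
have w0w : w0 < w by exact: (midf_lt w0mu).1.
have wmu : w < mu by exact: (midf_lt w0mu).2.
have wl : w < l by exact: (midf_lt wmu).1.
have lmu : l < mu by exact: (midf_lt wmu).2.
have Tle := growth hT w00 w0w Sle Sgen TD.
have d0 : 0 < mu - l by rewrite subr_gt0.
have [N HN] := chernoff_semigroup hT w00 w0w Sle Sgen TD wl f (mulr_gt0 e0 d0).
exists N => n x phi Nn n0 wphi.
have mT := weighted_orbit_measurable hT f x wphi.
have iT := dom_integrable _ mT (fun s s0 => weighted_orbit_le Tle f x wphi s0).
have mS : measurable_fun (`]0, +oo[%classic : set R) (fun t => phi t * iter_S n f t x).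
  by apply: measurable_funM; [exact: weight_measurable|exact: iter_S_measurable].
rewrite (laplaceE hT Tle wmu) // -RintegralB //; last 2 first.
- by apply: iT; rewrite subr_gt0.
- exact: iter_S_integrable.
have -> : e = e * (mu - l) * (expR (- ((mu - l) * 0)) / (mu - l)).
  by rewrite mulr0 oppr0 expR0 div1r mulfK // lt0r_neq0.
apply: dom_tail => //; first exact: measurable_funB.
move=> s s0; rewrite -mulrBr normrM distrC.
have := ler_pM (normr_ge0 _) (normr_ge0 _) (wphi.2 s (ltW s0))
  (le_trans (C0_ler _ x) (HN n s Nn n0 s0)).
rewrite C0_subE => H; apply: le_trans H _; apply: le_of_eq.
by rewrite mulrCA -expRD; congr (_ * expR _); ring.
Qed.

End approximation.

Section coefficients.
Context {R : realType}.

Lemma bounded_fun_le (f : R -> R) : bounded_fun f -> exists M : R, forall x, `|f x| <= M.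
Proof. by move=> [M [Mr HM]]; exists (M + 1) => x; apply: HM => //; rewrite ltrDl. Qed.

Lemma hoelder_continuous (beta : R) (f : R -> R) : 0 < beta -> Defs.hoelder beta f -> continuous f.
Proof.
move=> b0 [C HC] x; apply/cvgrPdist_le => e e0.
have C0 : 0 < `|C| + 1 by rewrite ltr_wpDl.
have e1 : 0 < e / (`|C| + 1) by rewrite divr_gt0.
have d0 : 0 < (e / (`|C| + 1)) `^ beta^-1 by exact: powR_gt0.
have := nbhsx_ballx x _ d0; apply: filterS => y /ltW xy.
apply: le_trans (HC x y) _.
have H : `|x - y| `^ beta <= e / (`|C| + 1).
  have -> : e / (`|C| + 1) = ((e / (`|C| + 1)) `^ beta^-1) `^ beta.
    by rewrite -powRrM mulVf ?lt0r_neq0 // powRr1 // ltW.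
  by apply: ge0_ler_powR; rewrite ?nnegrE ?(ltW b0) ?(ltW d0).
apply: (@le_trans _ _ ((`|C| + 1) * (`|x - y| `^ beta))).
  by rewrite ler_wpM2r ?powR_ge0 //; apply: le_trans (ler_norm _) _; rewrite lerDl.
by rewrite mulrC -ler_pdivlMr.
Qed.

Lemma derivable_continuous (f : R -> R) : (forall x, derivable f x 1) -> continuous f.
Proof. by move=> df x; apply: differentiable_continuous; apply/derivable1_diffP. Qed.

End coefficients.

Section laplace_integrand_parts.
Context {R : realType}.
Variables (a b c g : R -> R) (mu nu : R).

(** The factor [e ^ (- lam t)] is [cosw - i sinw]. *)
Lemma laplace_integrand_parts n x0 t :
  complex.Re (laplace_integrand a b c g (mu +i* nu) n x0 t) =
    cosw mu nu t * iter_int n (feynman_integrand a b c g n t x0) /\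
  complex.Im (laplace_integrand a b c g (mu +i* nu) n x0 t) =
    - (sinw mu nu t * iter_int n (feynman_integrand a b c g n t x0)).
Proof.
rewrite /laplace_integrand /cexp /= !mulr0 ?add0r !subr0.
by rewrite /cosw /sinw !mulNr cosN sinN; split; ring.
Qed.

End laplace_integrand_parts.

Lemma laplace_resolvent_real (R : realType) (T : R -> {linear C0 R -> C0 R}) (w mu nu : R)
    (hT : C0_semigroup T)
    (Tle : forall (s : R) g, 0 <= s -> `|T s g| <= expR (w * s) * `|g|)
    (wmu : w < mu) g x :
  laplace_resolvent nu hT Tle wmu (C0_complex g 0) x =
  laplace T (cosw mu nu) g x -i* laplace T (sinw mu nu) g x.
Proof.
rewrite laplace_resolventE -!(laplace_linE hT Tle wmu (weight_cosw mu nu)).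
rewrite -!(laplace_linE hT Tle wmu (weight_sinw mu nu)) !linear0 addr0 sub0r.
by [].
Qed.

Unset Implicit Arguments.

Theorem theorem4 (R : realType) (a b c : R -> R) (beta : R)
    (a_gt0 : forall x, 0 < a x)
    (beta_gt0 : 0 < beta) (beta_le1 : beta <= 1)
    (hc : bounded_hoelder beta c)
    (ha : bounded_hoelder2 beta a)
    (hainv : bounded_hoelder2 beta (fun x => 1 / a x))
    (hb : bounded_hoelder2 beta b)
    (H_closable : closable (diff_op a b c))
    (H_generates : generates_C0_semigroup (closure (diff_op a b c)))
    (lam : R[i])
    (hlam : Num.max 0 (sup (range c)) < complex.Re lam) :
  exists Q : {linear C0C R -> C0C R},
    is_resolvent (complexification (closure (diff_op a b c))) lam Q /\
    forall g : C0 R,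
      (forall (n : nat) (x0 : R), (0 < n)%N ->
         (forall t : R, 0 < t ->
            iter_integrable n (feynman_integrand a b c g n t x0)) /\
         cintegrable `]0, +oo[ (laplace_integrand a b c g lam n x0)) /\
      {uniform, (fun (n : nat) (x0 : R) =>
                   cint `]0, +oo[ (laplace_integrand a b c g lam n x0) : R[i]^o)
                @ \oo --> (Q (C0_complex g 0) : R -> R[i]^o)}.
Proof.
have [A0 aA0] := bounded_fun_le (let: And5 _ _ (conj h _) _ _ := ha in h).
have aA x : a x <= A0 by apply: le_trans (ler_norm _) (aA0 x).
have [B bB] := bounded_fun_le (let: And5 _ _ (conj h _) _ _ := hb in h).
have [C cC] := bounded_fun_le hc.1.
have ca : continuous a by case: ha => da _ _ _ _; exact: derivable_continuous.
have cb : continuous b by case: hb => db _ _ _ _; exact: derivable_continuous.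
have cc : continuous c by exact: hoelder_continuous beta_gt0 hc.2.
set w0 := Num.max 0 (sup (range c)) in hlam.
have w00 : 0 <= w0 by rewrite le_max lexx.
have cw x : c x <= w0.
  rewrite le_max; apply/orP; right; apply: ub_le_sup; last by exists x.
  by exists C => _ [y _ <-]; apply: le_trans (ler_norm _) (cC y).
have [T [hT TD]] := H_generates.
case: lam hlam => mu nu /= w0mu.
pose S := chernoff_lin a_gt0 ca cb cc aA bB cC.
have Sle (h : R) f : 0 <= h -> `|S h f| <= expR (w0 * h) * `|f|.
  exact: chernoff_lin_le.
have Scont f : cont_pos (fun h => S h f) by exact: chernoff_lin_cont.
have Sgen f k : diff_op a b c (f, k) -> forall e : R, 0 < e ->
    \forall h \near (0 : R)^'+, `|S h f - f - h *: k| <= e * h.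
  exact: chernoff_lin_generator.
pose w := (w0 + mu) / 2.
have w0w : w0 < w by exact: (midf_lt w0mu).1.
have wmu : w < mu by exact: (midf_lt w0mu).2.
have Tle := growth hT w00 w0w Sle Sgen TD.
have wc := weight_cosw mu nu; have ws := weight_sinw mu nu.
exists (laplace_resolvent nu hT Tle wmu); split.
  by rewrite -TD; exact: laplace_is_resolvent.
move=> g.
have path n (t x0 : R) : (0 < n)%N -> 0 < t ->
    iter_integrable n (feynman_integrand a b c g n t x0) /\
    iter_int n (feynman_integrand a b c g n t x0) = iter n (S (t / n%:R)) g x0.
  move=> n0 t0; have h0 : 0 < t / n%:R by rewrite divr_gt0 // ltr0n.
  have SK (f : C0 R) x : lebesgue_measure.-integrable setT
      (EFin \o (fun y => heat_kernel a b c (t / n%:R) x y * f y)) /\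
      S (t / n%:R) f x = \int[lebesgue_measure]_y (heat_kernel a b c (t / n%:R) x y * f y).
    by rewrite chernoff_linE; exact: chernoff_fun_kernel.
  have [i E] := iter_int_path g SK n x0.
  have FE s (sn : size s = n) := feynman_integrandE b c a_gt0 g x0 n0 t0 sn.
  rewrite -E (iter_int_ext FE); split=> //.
  by apply: iter_integrable_ext i => s sn; rewrite FE.
have parts n x0 t : (0 < n)%N -> 0 < t ->
    complex.Re (laplace_integrand a b c g (mu +i* nu) n x0 t) =
      cosw mu nu t * iter n (S (t / n%:R)) g x0 /\
    complex.Im (laplace_integrand a b c g (mu +i* nu) n x0 t) =
      - (sinw mu nu t * iter n (S (t / n%:R)) g x0).
  move=> n0 t0; have [-> ->] := laplace_integrand_parts a b c g mu nu n x0 t.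
  by rewrite (path n t x0 n0 t0).2.
have pos (t : R) : t \in (`]0, +oo[%classic : set R) -> 0 < t.
  by rewrite inE /= in_itv /= andbT.
have S_int n x0 phi (n0 : (0 < n)%N) (wphi : weight mu phi) :=
  iter_S_integrable w00 w0mu Sle Scont g x0 n0 wphi.
split.
  move=> n x0 n0; split; first by move=> t t0; exact: (path n t x0 n0 t0).1.
  split.
    apply: eq_integrable (S_int n x0 _ n0 wc) => // t /pos t0.
    by congr EFin; rewrite (parts n x0 t n0 t0).1.
  have := integrableN (S_int n x0 _ n0 ws) => //.
  apply: eq_integrable => // t /pos t0.
  by rewrite (parts n x0 t n0 t0).2 EFinN.
have cintE n x0 : (0 < n)%N -> cint `]0, +oo[ (laplace_integrand a b c g (mu +i* nu) n x0) =
    (\int[lebesgue_measure]_(t in `]0, +oo[) (cosw mu nu t * iter n (S (t / n%:R)) g x0))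
    -i* (\int[lebesgue_measure]_(t in `]0, +oo[) (sinw mu nu t * iter n (S (t / n%:R)) g x0)).
  move=> n0; rewrite /cint; congr (_ +i* _).
    apply: eq_Rintegral => t /pos t0.
    exact: (parts n x0 t n0 t0).1.
  rewrite -mulN1r -RintegralZl //; last exact: S_int.
  apply: eq_Rintegral => t /pos t0.
  by rewrite (parts n x0 t n0 t0).2 mulN1r.
move=> P /uniform_nbhs[E [entE EP]].
move: entE; rewrite -entourage_ballE => -[e /= /complex_gt0P[r r0 er] Ee].
have r4 : 0 < r / 4 by rewrite divr_gt0.
have [N HN] := laplace_iter_S_cvg hT w00 w0mu Sle Scont Sgen TD g r4.
(* the successor excludes [n = 0] *)
exists N.+1 => // n /= Nn; apply: EP => x _; apply: Ee.
have n0 : (0 < n)%N by exact: leq_ltn_trans Nn.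
have Hc := HN n x _ (ltnW Nn) n0 wc; have Hs := HN n x _ (ltnW Nn) n0 ws.
rewrite er -ball_normE.
suff : `|(laplace_resolvent nu hT Tle wmu (C0_complex g 0) x : R[i]) -
    cint `]0, +oo[ (laplace_integrand a b c g (mu +i* nu) n x)| < r%:C by [].
rewrite laplace_resolvent_real cintE //.
set u1 := laplace _ _ _ _ in Hc *; set u2 := laplace _ _ _ _ in Hs *.
set v1 := Rintegral _ _ _ in Hc *; set v2 := Rintegral _ _ _ in Hs *.
have -> : `|(u1 -i* u2 : R[i]) - (v1 -i* v2)| = (Normc.normc ((u1 - v1) +i* (- u2 + v2)))%:C.
  by rewrite normc_def /= opprK.
rewrite ltcR; apply: le_lt_trans (normc_le_sum _) _ => /=.
apply: (@le_lt_trans _ _ (r / 4 + r / 4)); last by lra.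
by apply: lerD => //; rewrite -normrN opprD opprK.
Qed.
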